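(* Let $V$ be an irreducible integrable $\tau$-module on which $K_0$ acts as a scalar $C_0>0$ and $K_i$ acts trivially for $1\le i\le n$, with associated finite-dimensional $\tilde L$-module $\tilde V=T/W$ and $L$-module $L(\tilde V)=\bigoplus_{\bar p\in\Lambda}L(\tilde V)(\bar p)$. Then $\tilde V$ is an irreducible $\tilde L$-module if and only if the $L$-modules $L(\tilde V)(\bar p)$, $\bar p\in\Lambda$, are mutually non-isomorphic.
   Context: All vector spaces and algebras are over $\mathbb C$; $\mathbb N=\{0,1,2,\dots\}$. **The Lie algebra $\tau$.** Let $\mathfrak g$ be a finite-dimensional simple Lie algebra with a non-degenerate symmetric invariant bilinear form $(\cdot,\cdot)$. Fix $n\ge1$ and commuting automorphisms $\sigma_0,\dots,\sigma_n$ of $\mathfrak g$ of finite orders $m_0,\dots,m_n$; let $\xi_i$ be a primitive $m_i$-th root of unity, $\Gamma_0=m_0\mathbb Z$, $\Gamma=m_1\mathbb Z\oplus\cdots\oplus m_n\mathbb Z$, $\Lambda_0=\mathbb Z/\Gamma_0$, $\Lambda=\mathbb Z^n/\Gamma$; bars denote images in $\Lambda_0$, $\Lambda$. For $k_0\in\mathbb Z$, $k\in\mathbb Z^n$ put $\mathfrak g(\bar k_0,\bar k)=\{x\in\mathfrak g:\sigma_ix=\xi_i^{k_i}x,\ 0\le i\le n\}$, $t^k=t_1^{k_1}\cdots t_n^{k_n}$, $L(\mathfrak g,\sigma)=\bigoplus_{(k_0,k)\in\mathbb Z^{n+1}}\mathfrak g(\bar k_0,\bar k)\otimes t_0^{k_0}t^k$,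 and $X(k_0,k)=X\otimes t_0^{k_0}t^k$. Let $Z(m_0,m)$ be the space spanned by symbols $t_0^{r_0}t^rK_i$ ($0\le i\le n$, $r_0\in\Gamma_0$, $r\in\Gamma$) modulo the span of all $\sum_{i=0}^n r_it_0^{r_0}t^rK_i$. Let $D(m_0,m)$ be the derivation algebra of $\mathbb C[t_0^{\pm m_0},\dots,t_n^{\pm m_n}]$, with basis $t_0^{r_0}t^rd_i$ ($0\le i\le n$, $r_0\in\Gamma_0$, $r\in\Gamma$), $d_i=t_i\frac{d}{dt_i}$. Then $\tau=L(\mathfrak g,\sigma)\oplus Z(m_0,m)\oplus D(m_0,m)$ with brackets ($r,s\in\Gamma$, $r_0,s_0\in\Gamma_0$, $0\le a,b\le n$): $[X(k_0,k),Y(l_0,l)]=[X,Y](k_0+l_0,k+l)+(X,Y)\sum_{i=0}^nk_it_0^{k_0+l_0}t^{k+l}K_i$; $Z(m_0,m)$ is abelian and commutes with $L(\mathfrak g,\sigma)$; $[t_0^{r_0}t^rd_a,X(k_0,k)]=k_aX(k_0+r_0,k+r)$; $[t_0^{r_0}t^rd_a,t_0^{s_0}t^sK_b]=s_at_0^{r_0+s_0}t^{r+s}K_b+\delta_{ab}\sum_{p=0}^nr_pt_0^{r_0+s_0}t^{r+s}K_p$; $[t_0^{r_0}t^rd_a,t_0^{s_0}t^sd_b]=s_at_0^{r_0+s_0}t^{r+s}d_b-r_bt_0^{r_0+s_0}t^{r+s}d_a+\varphi(t_0^{r_0}t^rd_a,t_0^{s_0}t^sd_b)$, where $\varphi$ is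 a fixed linear combination of the cocycles $\varphi_1(t_0^{r_0}t^rd_a,t_0^{s_0}t^sd_b)=-s_ar_b\sum_{p=0}^nr_pt_0^{r_0+s_0}t^{r+s}K_p$ and $\varphi_2(t_0^{r_0}t^rd_a,t_0^{s_0}t^sd_b)=r_as_b\sum_{p=0}^nr_pt_0^{r_0+s_0}t^{r+s}K_p$. **Standing assumptions.** $\mathfrak g(\bar0,\bar0)$ is a simple Lie algebra; there are Cartan subalgebras $\mathfrak h(0)$ of $\mathfrak g(\bar0,\bar0)$ and $\mathfrak h$ of $\mathfrak g$ with $\mathfrak h(0)\subseteq\mathfrak h$. Let $\Delta_0^\times$ be the root system of $(\mathfrak g(\bar0,\bar0),\mathfrak h(0))$, $\Delta_{0,sh}^\times$ its short roots, $\Delta_{0,en}^\times=\Delta_0^\times\cup2\Delta_{0,sh}^\times$ if $\Delta_0^\times$ is of type $B_l$ and $\Delta_{0,en}^\times=\Delta_0^\times$ otherwise, $\Delta_{0,en}=\Delta_{0,en}^\times\cup\{0\}$. It is assumed that the set of weights (including $0$) of $\mathfrak h(0)$ acting on $\mathfrak g$ by $\mathrm{ad}$ is $\Delta_{0,en}$. **Weights, integrable modules.** $H=\mathfrak h(0)\oplus\sum_{i=0}^n\mathbb CK_i\oplus\sum_{i=0}^n\mathbb Cd_i$. $\delta_i\in H^*$ vanishes on $\mathfrak h(0)$ and all $K_j$, with $\delta_i(d_j)=\delta_{ij}$. Elements of $\mathfrak h(0)^*$ are extended to $H$ by $0$ on $K_i,d_i$. $\mathfrak g(\bar k_0,\bar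 k,\alpha)=\{x\in\mathfrak g(\bar k_0,\bar k):[h,x]=\alpha(h)x\ \forall h\in\mathfrak h(0)\}$. A $\tau$-module $V$ is integrable if $V=\bigoplus_{\lambda\in H^*}V_\lambda$, $V_\lambda=\{v:hv=\lambda(h)v\ \forall h\in H\}$, with $\dim V_\lambda<\infty$, and $\mathfrak g(\bar k_0,\bar k,\alpha)\otimes t_0^{k_0}t^k$ acts locally nilpotently on $V$ for all $\alpha\ne0$. $P(V)=\{\gamma\in H^*:V_\gamma\neq0\}$. **Triangular decomposition.** Let $\alpha_1,\dots,\alpha_p$ be simple roots of $(\mathfrak g(\bar0,\bar0),\mathfrak h(0))$, $\beta_0$ the maximal root in $\Delta_{0,en}$, $\alpha_0=-\beta_0+\delta_0$, $Q^+=\bigoplus_{i=0}^p\mathbb N\alpha_i$; $\beta>0$ means $\beta\in Q^+\setminus\{0\}$. $\tau^+$ is the span of all $\mathfrak g(\bar k_0,\bar k,\alpha)\otimes t_0^{k_0}t^k$ with $\alpha+k_0\delta_0>0$ ($k\in\mathbb Z^n$) and all $t_0^{s_0}t^sK_i$, $t_0^{s_0}t^sd_i$ with $0\le i\le n$, $s_0>0$, $s\in\Gamma$. **The algebras $L$, $\tilde L$.** $(u,s)=\sum u_is_i$ for $u,s\in\mathbb C^n$; $A(m)=\mathbb C[t_1^{\pm m_1},\dots,t_n^{\pm m_n}]$; $D(u,r)=\sum_{i=1}^nu_it^rd_i$ ($u\in\mathbb C^n$, $r\in\Gamma$), spanning $\mathrm{Der}A(m)$. $\mathring{\mathfrak g}=\{X\in\mathfrak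 g:\sigma_0X=X,\ [h,X]=0\ \forall h\in\mathfrak h(0)\}=\bigoplus_{\bar k\in\Lambda}\mathring{\mathfrak g}_{\bar k}$, $\mathring{\mathfrak g}_{\bar k}=\{X\in\mathring{\mathfrak g}:\sigma_iX=\xi_i^{k_i}X,\ 1\le i\le n\}$; $L(\mathring{\mathfrak g},\sigma)=\bigoplus_{k\in\mathbb Z^n}\mathring{\mathfrak g}_{\bar k}\otimes t^k$, $X(k)=X\otimes t^k$ for $X\in\mathring{\mathfrak g}_{\bar k}$. $L=L(\mathring{\mathfrak g},\sigma)\oplus\mathrm{Der}A(m)\oplus A(m)\oplus\sum_{r\in\Gamma}\mathbb Ct^rd_0$ has brackets $[X(k),Y(l)]=[X,Y](k+l)$, $[D(u,r),D(v,s)]=D((u,s)v-(v,r)u,r+s)$, $[D(u,r),t^s]=(u,s)t^{r+s}$, $[D(u,r),X(k)]=(u,k)X(k+r)$, $[D(u,r),t^sd_0]=(u,s)t^{r+s}d_0$, all others zero. $I$ is the span of $I(u,r)=D(u,r)-D(u,0)$, a subalgebra of $\mathrm{Der}A(m)$, and $\tilde L=I\ltimes L(\mathring{\mathfrak g},\sigma)\subset L$. **The modules $T$, $\tilde V$, $L(\tilde V)$.** For $V$ as in the claim, $T=\{v\in V:\tau^+v=0\}$; it is a nonzero $L$-module, where $t^r\in A(m)$ acts as $C_0^{-1}t^rK_0$ and the other elements act as the corresponding elements of $\tau$ (the $t^rK_p$, $1\le p\le n$, act by $0$ on $T$). Fix $\lambda\in P(V)$ with $T\cap V_\lambda\ne0$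 and put $\alpha=(\lambda(d_1),\dots,\lambda(d_n))\in\mathbb C^n$; $T=\bigoplus_{k\in\mathbb Z^n}T_k$, $T_k=\{v\in T:d_iv=(\lambda(d_i)+k_i)v,\ 1\le i\le n\}$. $W$ is the span of all $t^r\cdot v-v$ ($r\in\Gamma$, $v\in T$), an $\tilde L$-submodule, and $\tilde V=T/W=\bigoplus_{\bar k\in\Lambda}\tilde V_{\bar k}$ with $\tilde V_{\bar k}$ the image of $T_k$; it is finite-dimensional. For an $\tilde L$-module $V_1$, $L(V_1)=V_1\otimes\mathbb C[t_1^{\pm1},\dots,t_n^{\pm1}]$ is the $L$-module with $X(k)(v\otimes t^l)=X(k)v\otimes t^{l+k}$, $D(u,r)(v\otimes t^l)=I(u,r)v\otimes t^{l+r}+(u,l+\alpha)v\otimes t^{l+r}$, $t^s(v\otimes t^l)=v\otimes t^{l+s}$, $t^rd_0(v\otimes t^l)=\lambda(d_0)v\otimes t^{l+r}$. For $p\in\mathbb Z^n$, $L(\tilde V)(\bar p)$ is the $L$-submodule spanned by all $v\otimes t^{k+r+p}$ with $k\in\mathbb Z^n$, $v\in\tilde V_{\bar k}$, $r\in\Gamma$. *)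

(* Defs.v *)
From HB Require Import structures.
From mathcomp Require Import all_boot all_order all_algebra.
From mathcomp Require Import generic_quotient ring_quotient.
From mathcomp Require Import boolp classical_sets functions reals.
From mathcomp Require Export complex.

Set Implicit Arguments.
Unset Strict Implicit.
Unset Printing Implicit Defensive.
Import Order.TTheory GRing.Theory Num.Theory.
Local Open Scope ring_scope.
Local Open Scope classical_set_scope.

HB.mixin Record Lmodule_isLie (K : fieldType) g of GRing.Lmodule K g := {
  lie : g -> g -> g;
  lie_linear_l : forall y : g, linear (fun x : g => lie x y);
  lie_linear_r : forall x : g, linear (lie x);
  lie_alt : forall x : g, lie x x = 0;
  lie_jacobi : forall x y z : g,
    lie x (lie y z) + lie y (lie z x) + lie z (lie x y) = 0
}.

#[short(type="finLieType")]
HB.structure Definition FinLie (K : fieldType) :=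
  {g of Vector K g & Lmodule_isLie K g}.

Notation "{[ x , y ]}" := (lie x y) (at level 0, format "{[ x ,  y ]}").

Section FinLieTheory.
Variables (K : fieldType) (g : finLieType K).
Implicit Types (S H I : {vspace g}).

Definition lie_subalgebra S :=
  forall x y, x \in S -> y \in S -> {[x, y]} \in S.

Definition lie_ideal_of S I :=
  (I <= S)%VS /\ forall x y, x \in S -> y \in I -> {[x, y]} \in I.

Definition lie_simple S :=
  [/\ lie_subalgebra S,
      exists x y, [/\ x \in S, y \in S & {[x, y]} != 0]
    & forall I, lie_ideal_of S I -> I = 0%VS \/ I = S].

(* The lower central series of H reaches 0: all iterated brackets
   [x_1, [x_2, ... [x_N, y]]] of some fixed length vanish. *)
Definition lie_nilpotent H :=
  exists N : nat, forall (s : seq g) (y : g),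
    size s = N -> {in s, forall x, x \in H} -> y \in H ->
    foldr (fun x z => {[x, z]}) y s = 0.

Definition lie_cartan S H :=
  [/\ (H <= S)%VS, lie_subalgebra H, lie_nilpotent H
    & forall x, x \in S -> (forall h, h \in H -> {[x, h]} \in H) -> x \in H].

Definition lie_automorphism (f : 'End(g)) :=
  bijective f /\ forall x y, f {[x, y]} = {[f x, f y]}.

Definition has_order (f : g -> g) (k : nat) :=
  [/\ (0 < k)%N, iter k f =1 id
    & forall j, (0 < j < k)%N -> ~ (iter j f =1 id)].

Definition invariant_form (B : g -> g -> K) :=
  [/\ forall a x y z, B (a *: x + y) z = a * B x z + B y z,
      forall x y, B x y = B y x,
      forall x y z, B {[x, y]} z = B x {[y, z]}
    & forall x, (forall y, B x y = 0) -> x = 0].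

End FinLieTheory.

Section Span.
Variables (K : pzRingType) (V : lmodType K).

Definition lspan (A : set V) : set V :=
  [set v | exists (N : nat) (c : 'I_N -> K) (a : 'I_N -> V),
     (forall i, A (a i)) /\ v = \sum_(i < N) c i *: a i].

Definition is_subspace (U : set V) :=
  U 0 /\ forall a u v, U u -> U v -> U (a *: u + v).

Lemma lspan_subspace A : is_subspace (lspan A).
Proof.
split; first by exists 0%N, (fun=> 0), (fun=> 0); split=> [[]|] //; rewrite big_ord0.
move=> a _ _ [N1 [c1 [a1 [A1 ->]]]] [N2 [c2 [a2 [A2 ->]]]].
exists (N1 + N2)%N.
exists (fun i => match fintype.split i with inl j => a * c1 j | inr j => c2 j end).
exists (fun i => match fintype.split i with inl j => a1 j | inr j => a2 j end).
split=> [i|]; first by case: fintype.splitP.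
rewrite big_split_ord /= scaler_sumr; congr (_ + _).
  apply: eq_bigr => i _; rewrite scalerA.
  by have -> : fintype.split (lshift N2 i) = inl i := unsplitK (inl i).
apply: eq_bigr => i _.
by have -> : fintype.split (rshift N1 i) = inr i := unsplitK (inr i).
Qed.

Definition span_pred (A : set V) : {pred V} := fun v => `[< lspan A v >].

Fact span_pred_zmod A : zmod_closed (span_pred A).
Proof.
have [H0 HD] := lspan_subspace A.
split; first exact/asboolP.
move=> u v /asboolP Hu /asboolP Hv; apply/asboolP.
by rewrite addrC -scaleN1r; exact: HD.
Qed.
HB.instance Definition _ A :=
  GRing.isZmodClosed.Build V (span_pred A) (span_pred_zmod A).

Lemma span_predZ A a v : v \in span_pred A -> a *: v \in span_pred A.
Proof.
have [H0 HD] := lspan_subspace A.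
by move=> /asboolP Hv; apply/asboolP; rewrite -[_ *: _]addr0; exact: HD.
Qed.

End Span.

Section Quot.
Variables (K : pzRingType) (V : lmodType K) (A : set V).
Local Open Scope quotient_scope.

Definition lquot := Quotient.quot (span_pred A).
HB.instance Definition _ := GRing.Zmodule.on lquot.
HB.instance Definition _ := EqQuotient.on lquot.

Definition lquot_scale (a : K) : lquot -> lquot := lift_op1 lquot ( *:%R a).

Lemma pi_lquot_scale a : {morph (\pi_lquot : V -> lquot) : x / a *: x >-> lquot_scale a x}.
Proof.
move=> x; unlock lquot_scale; apply/eqP.
rewrite -[_ == _]/(_ == _ %[mod Quotient.quot (span_pred A)]) -Quotient.idealrBE.
rewrite -scalerBr; apply: span_predZ; rewrite Quotient.idealrBE.
by rewrite reprK.
Qed.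

Lemma pi_lquotD : {morph (\pi_lquot : V -> lquot) : x y / x + y}.
Proof. by move=> x y; exact: (raddfD (\pi_(Quotient.quot (span_pred A)))). Qed.

Fact lquot_scaleA a b v : lquot_scale a (lquot_scale b v) = lquot_scale (a * b) v.
Proof. by rewrite -[v]reprK -!pi_lquot_scale scalerA. Qed.
Fact lquot_scale1 : left_id 1 lquot_scale.
Proof. by move=> v; rewrite -[v]reprK -!pi_lquot_scale scale1r. Qed.
Fact lquot_scaleDr : right_distributive lquot_scale +%R.
Proof.
move=> a u v; rewrite -[u]reprK -[v]reprK -!pi_lquot_scale -!pi_lquotD.
by rewrite -pi_lquot_scale scalerDr.
Qed.
Fact lquot_scaleDl v : {morph lquot_scale^~ v : a b / a + b}.
Proof.
by move=> a b; rewrite -[v]reprK -!pi_lquot_scale scalerDl pi_lquotD.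
Qed.
HB.instance Definition _ := GRing.Zmodule_isLmodule.Build K lquot
  lquot_scaleA lquot_scale1 lquot_scaleDr lquot_scaleDl.

Definition lproj (v : V) : lquot := \pi_lquot v.
Definition lrepr (x : lquot) : V := repr x.

Lemma lprojK x : lproj (lrepr x) = x.
Proof. exact: reprK. Qed.

Lemma lproj_linear : linear lproj.
Proof. by move=> a u v; rewrite /lproj pi_lquotD pi_lquot_scale. Qed.

Lemma lproj_eq u v : lproj u = lproj v <-> lspan A (u - v).
Proof.
split=> [/eqP|/asboolP H]; last first.
  by apply/eqP; move: H; rewrite -[`[< _ >]]/(_ \in span_pred A) Quotient.idealrBE.
by rewrite -[_ == _]/(_ == _ %[mod Quotient.quot (span_pred A)])
  -Quotient.idealrBE => /asboolP.
Qed.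

End Quot.

(* A Lie algebra spanned by symbols s : G subject to [ok s] acts on M through
   the operators [act s]; submodules, irreducibility and isomorphisms only
   involve these operators.  Modules are carried by a subspace S of an ambient
   space M. *)
Section Modules.
Variables (K : pzRingType) (G : Type) (ok : G -> Prop).

Definition submodule_of (M : lmodType K) (act : G -> M -> M) (S U : set M) :=
  [/\ is_subspace U, U `<=` S
    & forall s, ok s -> forall v, U v -> U (act s v)].

Definition irreducible_module (M : lmodType K) (act : G -> M -> M) (S : set M) :=
  S <> [set 0] /\
  forall U, submodule_of act S U -> U = [set 0] \/ U = S.

Definition module_iso (M1 M2 : lmodType K)
    (act1 : G -> M1 -> M1) (S1 : set M1) (act2 : G -> M2 -> M2) (S2 : set M2) :=
  exists f : M1 -> M2,
    [/\ set_bij S1 S2 f,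
        forall a u v, S1 u -> S1 v -> f (a *: u + v) = a *: f u + f v
      & forall s, ok s -> forall v, S1 v -> f (act1 s v) = act2 s (f v)].

End Modules.

Record datum (K : fieldType) := Datum {
  gfin : finLieType K;
  form : gfin -> gfin -> K;
  nvar : nat;
  sigma : 'I_nvar.+1 -> 'End(gfin);
  mord : 'I_nvar.+1 -> nat;
  xi : 'I_nvar.+1 -> K;
  (* phi = phi_c1 * phi_1 + phi_c2 * phi_2 *)
  phi_c1 : K;
  phi_c2 : K;
  h0 : {vspace gfin};
  rank0 : nat;
  simple_root : rank0.-tuple 'Hom(subvs_of h0, K^o);
  beta0 : 'Hom(subvs_of h0, K^o);
  (* whether type A_1 counts as type B_1: both conventions are in use *)
  A1_is_B1 : bool
}.

Section Datum.
Variables (K : numFieldType) (D : datum K).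

Local Notation g := (gfin D).
Local Notation n := (nvar D).
Local Notation h0 := (h0 D).
Local Notation sigma := (@sigma K D).
Local Notation m := (@mord K D).
Local Notation xi := (@xi K D).
Local Notation form := (@form K D).
Local Notation h0dual := 'Hom(subvs_of h0, K^o).

(* (k_0, k) in Z^{n+1}; the index ord0 is the one of t_0. *)
Local Notation deg := 'rV[int]_n.+1.

Definition in_Gamma (r : deg) := forall i, dvdz (m i) (r 0 i).

(* k in Z^n as (0, k) in Z^{n+1} *)
Definition deg0 (k : 'rV[int]_n) : deg := row_mx (0 : 'rV[int]_1) k.

Definition gdeg (k : deg) : {vspace g} :=
  (\bigcap_(i < n.+1) passmx.leigenspace (sigma i) (xi i ^ k 0%R i))%VS.

Lemma gdegP (k : deg) x :
  x \in gdeg k <-> forall i, sigma i x = xi i ^ k 0 i *: x.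
Proof.
have E i : (x \in passmx.leigenspace (sigma i) (xi i ^ k 0 i)) =
    (sigma i x == xi i ^ k 0 i *: x).
  by rewrite memv_ker !(add_lfunE, opp_lfunE, scale_lfunE, id_lfunE) subr_eq0.
rewrite memvE; split=> [/subv_bigcapP H i|H].
  by apply/eqP; rewrite -E memvE; exact: H.
by apply/subv_bigcapP => i _; rewrite -memvE E; apply/eqP.
Qed.

(* g(k_0, k, a) *)
Definition gweight (k : deg) (a : h0dual) (x : g) :=
  x \in gdeg k /\ forall h : subvs_of h0, {[vsval h, x]} = a h *: x.

Definition root0 (a : h0dual) :=
  a != 0 /\ exists2 x, x != 0 & gweight 0 a x.

Definition represents (t : subvs_of h0) (a : h0dual) :=
  forall h : subvs_of h0, form (vsval t) (vsval h) = a h.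

(* With t representing a, [a t] is (a, a).  The form restricted to g(0,0) is
   only a complex multiple of the Killing form, hence the comparison of (a, a)
   and (b, b) through their quotient. *)
Definition short_root0 (a : h0dual) :=
  root0 a /\ forall b t u, root0 b -> represents t a -> represents u b ->
    a t / b u <= 1.

(* The standard model: e_1, ..., e_l is a basis and the roots are the +-e_i
   and the +-e_i +- e_j for i <> j. *)
Definition type_Bl (l : nat) :=
  exists e : l.-tuple h0dual, basis_of fullv e /\
    forall a, root0 a <->
      (exists (i : 'I_l) (s : bool), a = (-1) ^+ s *: tnth e i) \/
      (exists (i j : 'I_l) (s t : bool),
         i != j /\ a = (-1) ^+ s *: tnth e i + (-1) ^+ t *: tnth e j).

Definition type_B :=
  exists2 l, ((if A1_is_B1 D then 1 else 2) <= l)%N & type_Bl l.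

Definition root0_en (a : h0dual) :=
  root0 a \/ (type_B /\ exists2 b, short_root0 b & a = 2 *: b).

Definition weight0_en (a : h0dual) := root0_en a \/ a = 0.

Definition h0_weight (a : h0dual) :=
  exists2 x : g, x != 0 & forall h : subvs_of h0, {[vsval h, x]} = a h *: x.

Definition simple_comb (c : 'I_(rank0 D) -> nat) : h0dual :=
  \sum_(i < rank0 D) (c i)%:R *: tnth (simple_root D) i.

Definition is_simple_system :=
  [/\ basis_of fullv (simple_root D),
      forall i, root0 (tnth (simple_root D) i)
    & forall a, root0 a -> exists c, a = simple_comb c \/ a = - simple_comb c].

Definition is_maximal_root (b : h0dual) :=
  root0_en b /\ forall a, root0_en a -> exists c, b - a = simple_comb c.

Record standing_assumptions : Prop := {
  n_gt0 : (0 < n)%N;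
  g_simple : lie_simple (fullv : {vspace g});
  formP : invariant_form form;
  sigmaP : forall i, lie_automorphism (sigma i);
  sigmaC : forall i j x, sigma i (sigma j x) = sigma j (sigma i x);
  mP : forall i, has_order (sigma i) (m i);
  xiP : forall i, (m i).-primitive_root (xi i);
  g00_simple : lie_simple (gdeg 0);
  h0_cartan : lie_cartan (gdeg 0) h0;
  h_cartan : exists h : {vspace g}, lie_cartan fullv h /\ (h0 <= h)%VS;
  h0_weights : forall a, h0_weight a <-> weight0_en a;
  simple_rootP : is_simple_system;
  beta0P : is_maximal_root (beta0 D)
}.

(* X (x) t_0^{k_0} t^k, t_0^{r_0} t^r K_i and t_0^{r_0} t^r d_i *)
Inductive tau_sym :=
  | tX of deg & g
  | tK of deg & 'I_n.+1
  | td of deg & 'I_n.+1.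

Definition tau_ok (s : tau_sym) : Prop :=
  match s with
  | tX k x => x \in gdeg k
  | tK r _ | td r _ => in_Gamma r
  end.

Section TauModule.
Variables (V : lmodType K) (rho : tau_sym -> V -> V).

Definition bracket (f h : V -> V) (v : V) := f (h v) - h (f v).

(* sum_i k_i t_0^{r_0} t^r K_i *)
Definition rhoK (k r : deg) (v : V) :=
  \sum_(i < n.+1) (k 0 i)%:~R *: rho (tK r i) v.

(* tau is spanned by the admissible symbols, subject to the linear relations
   [tau_addX] (linearity in X) and [tau_K0] (definition of Z(m_0, m)) only, so
   a linear map from tau to End V amounts to operators [rho s] satisfying these
   two relations; the remaining fields state compatibility with the brackets.
   In [tau_XX], if k + l is not in Gamma_0 + Gamma then [form x y = 0]. *)
Record tau_module : Prop := {
  tau_linear : forall s, tau_ok s -> linear (rho s);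
  tau_addX : forall k a x y v, x \in gdeg k -> y \in gdeg k ->
    rho (tX k (a *: x + y)) v = a *: rho (tX k x) v + rho (tX k y) v;
  tau_K0 : forall r v, in_Gamma r -> rhoK r r v = 0;
  tau_XX : forall k l x y v, x \in gdeg k -> y \in gdeg l ->
    bracket (rho (tX k x)) (rho (tX l y)) v =
    rho (tX (k + l) {[x, y]}) v + form x y *: rhoK k (k + l) v;
  tau_KX : forall r i k x v, in_Gamma r -> x \in gdeg k ->
    bracket (rho (tK r i)) (rho (tX k x)) v = 0;
  tau_KK : forall r i s j v, in_Gamma r -> in_Gamma s ->
    bracket (rho (tK r i)) (rho (tK s j)) v = 0;
  tau_dX : forall r a k x v, in_Gamma r -> x \in gdeg k ->
    bracket (rho (td r a)) (rho (tX k x)) v =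
    (k 0 a)%:~R *: rho (tX (k + r) x) v;
  tau_dK : forall r a s b v, in_Gamma r -> in_Gamma s ->
    bracket (rho (td r a)) (rho (tK s b)) v =
    (s 0 a)%:~R *: rho (tK (r + s) b) v + (a == b)%:R *: rhoK r (r + s) v;
  tau_dd : forall r a s b v, in_Gamma r -> in_Gamma s ->
    bracket (rho (td r a)) (rho (td s b)) v =
    (s 0 a)%:~R *: rho (td (r + s) b) v - (r 0 b)%:~R *: rho (td (r + s) a) v
    + (phi_c1 D * - (s 0 a * r 0 b)%:~R + phi_c2 D * (r 0 a * s 0 b)%:~R)
        *: rhoK r (r + s) v
}.

(* lam in H^* is the triple of its restriction to h(0), its values on the K_i
   and its values on the d_i. *)
Definition Hdual := (h0dual * 'rV[K]_n.+1 * 'rV[K]_n.+1)%type.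

Definition weight_space (lam : Hdual) : set V :=
  [set v | [/\ forall h : subvs_of h0, rho (tX 0 (vsval h)) v = lam.1.1 h *: v,
               forall i, rho (tK 0 i) v = lam.1.2 0 i *: v
             & forall i, rho (td 0 i) v = lam.2 0 i *: v]].

Record integrable : Prop := {
  (* such a sum of simultaneous eigenspaces is automatically direct *)
  weight_sum : lspan [set v | exists lam, weight_space lam v] = setT;
  weight_findim : forall lam,
    exists s : seq V, weight_space lam `<=` lspan [set` s];
  real_nilpotent : forall k a x, a != 0 -> gweight k a x ->
    forall v, exists N : nat, iter N (rho (tX k x)) v = 0
}.

Definition ext_h0 (a : h0dual) : Hdual := (a, 0, 0).
Definition delta (i : 'I_n.+1) : Hdual := (0, 0, delta_mx 0 i).
Definition alpha0 : Hdual := ext_h0 (- beta0 D) + delta ord0.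

Definition in_Qplus (b : Hdual) :=
  exists (c0 : nat) (c : 'I_(rank0 D) -> nat),
    b = c0%:R *: alpha0 + ext_h0 (simple_comb c).

Definition positive (b : Hdual) := in_Qplus b /\ b != 0.

Definition tau_plus (s : tau_sym) : Prop :=
  match s with
  | tX k x => exists a, gweight k a x /\
      positive (ext_h0 a + (k 0 ord0)%:~R *: delta ord0)
  | tK r _ | td r _ => in_Gamma r /\ 0 < r 0 ord0
  end.

Definition Tspace : set V := [set v | forall s, tau_plus s -> rho s v = 0].

End TauModule.

Definition gring (k : 'rV[int]_n) (x : g) :=
  [/\ sigma ord0 x = x,
      forall h : subvs_of h0, {[vsval h, x]} = 0
    & forall i : 'I_n, sigma (lift ord0 i) x = xi (lift ord0 i) ^ k 0 i *: x].

(* X(k), D(u, r), t^r and t^r d_0 *)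
Inductive L_sym :=
  | LX of 'rV[int]_n & g
  | LD of 'rV[K]_n & 'rV[int]_n
  | LA of 'rV[int]_n
  | Ld0 of 'rV[int]_n.

Definition L_ok (s : L_sym) : Prop :=
  match s with
  | LX k x => gring k x
  | LD _ r | LA r | Ld0 r => in_Gamma (deg0 r)
  end.

(* X(k) and I(u, r) *)
Inductive Lt_sym :=
  | LtX of 'rV[int]_n & g
  | LtI of 'rV[K]_n & 'rV[int]_n.

Definition Lt_ok (s : Lt_sym) : Prop :=
  match s with
  | LtX k x => gring k x
  | LtI _ r => in_Gamma (deg0 r)
  end.

Definition dot (u : 'rV[K]_n) (s : 'rV[K]_n) : K := \sum_(i < n) u 0 i * s 0 i.

Section Loop.
Variables (V1 : lmodType K) (act1 : Lt_sym -> V1 -> V1).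
Variables (alpha : 'rV[K]_n) (lam0 : K).

(* V1 (x) C[t_1^{+-1}, ..., t_n^{+-1}] is the space of finitely supported
   functions on Z^n with values in V1. *)
Definition loop := 'rV[int]_n -> V1.
HB.instance Definition _ := GRing.Lmodule.on loop.

(* v (x) t^l *)
Definition tens (v : V1) (l : 'rV[int]_n) : loop :=
  fun k => if k == l then v else 0.

Definition loop_act (s : L_sym) (f : loop) : loop :=
  match s with
  | LX k x => fun l => act1 (LtX k x) (f (l - k))
  | LD u r => fun l => act1 (LtI u r) (f (l - r))
                + dot u (map_mx intr (l - r) + alpha) *: f (l - r)
  | LA r => fun l => f (l - r)
  | Ld0 r => fun l => lam0 *: f (l - r)
  end.

Lemma loop_act_tens (s : L_sym) v l : (forall z, act1 z 0 = 0) ->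
  loop_act s (tens v l) =
  match s with
  | LX k x => tens (act1 (LtX k x) v) (l + k)
  | LD u r => tens (act1 (LtI u r) v) (l + r)
                + dot u (map_mx intr l + alpha) *: tens v (l + r)
  | LA r => tens v (l + r)
  | Ld0 r => lam0 *: tens v (l + r)
  end.
Proof.
move=> act0.
have E (k r : 'rV[int]_n) : (k - r == l) = (k == l + r) by rewrite subr_eq.
by case: s => [k x|u r|r|r]; apply/funext => j;
  rewrite /loop_act /tens /= ?scalrfctE ?addrfctE ?E /=; case: eqP => [Ej|_] //;
  rewrite ?Ej ?addrK ?act0 ?scaler0 ?addr0.
Qed.

End Loop.

Section Tilde.
Variables (V : lmodType K) (rho : tau_sym -> V -> V) (C0 : K).

Definition L_act (s : L_sym) (v : V) : V :=
  match s with
  | LX k x => rho (tX (deg0 k) x) v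
  | LD u r => \sum_(i < n) u 0 i *: rho (td (deg0 r) (lift ord0 i)) v
  | LA r => C0^-1 *: rho (tK (deg0 r) ord0) v
  | Ld0 r => rho (td (deg0 r) ord0) v
  end.

Definition Lt_act (s : Lt_sym) (v : V) : V :=
  match s with
  | LtX k x => L_act (LX k x) v
  | LtI u r => L_act (LD u r) v - L_act (LD u 0) v
  end.

(* W is the span of W_gen. *)
Definition W_gen : set V :=
  [set w | exists r v, [/\ in_Gamma (deg0 r), Tspace rho v & w = L_act (LA r) v - v]].

(* T / W inside V / W *)
Definition Vtilde : set (lquot W_gen) := [set lproj W_gen v | v in Tspace rho].

(* The action induced on T / W, computed on representatives: those of elements
   of T / W lie in T since W is contained in T. *)
Definition Vtilde_act (s : Lt_sym) (x : lquot W_gen) : lquot W_gen :=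
  lproj W_gen (Lt_act s (lrepr x)).

Variable lam : Hdual.

Definition T_deg (k : 'rV[int]_n) : set V :=
  [set v | Tspace rho v /\ forall i : 'I_n, rho (td 0 (lift ord0 i)) v =
             (lam.2 0 (lift ord0 i) + (k 0 i)%:~R) *: v].

Definition Vtilde_deg (k : 'rV[int]_n) : set (lquot W_gen) :=
  [set lproj W_gen v | v in T_deg k].

Definition alpha_of : 'rV[K]_n := \row_i lam.2 0 (lift ord0 i).

Definition LVtilde_act : L_sym -> loop (lquot W_gen) -> loop (lquot W_gen) :=
  loop_act Vtilde_act alpha_of (lam.2 0 ord0).

Definition LVtilde (p : 'rV[int]_n) : set (loop (lquot W_gen)) :=
  lspan [set f | exists k v r,
    [/\ Vtilde_deg k v, in_Gamma (deg0 r) & f = tens v (k + r + p)]].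

End Tilde.

End Datum.

Arguments tau_ok {K} D s.
Arguments L_ok {K} D s.
Arguments Lt_ok {K} D s.
Arguments Vtilde {K D V} rho C0 x.
Arguments Vtilde_act {K D V} rho C0 s x.
Arguments LVtilde_act {K D V} rho C0 lam s f.
Arguments LVtilde {K D V} rho C0 lam p.

(* Main.v *)
Require Import Defs.
From mathcomp Require Import all_boot all_order all_algebra.
From mathcomp Require Import spectral ring lra zify.
From mathcomp Require Import boolp classical_sets functions reals complex.
Import Order.TTheory GRing.Theory Num.Theory.
Import VectorInternalTheory.
Set Implicit Arguments.
Unset Strict Implicit.
Unset Printing Implicit Defensive.
Local Open Scope ring_scope.
Local Open Scope classical_set_scope.

(** Write V~ for T / W. The proof describes the L-module T, and then L(V~) in terms of T.

    On T the elements t^r = C_0^-1 t^r K_0 are invertible with t^r t^s = t^(r+s) ([kk_mul]),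
    t^r K_p is zero for p > 0 ([kp_zero]), t^r d_0 is lambda(d_0) t^r ([dz_scalar]), and T is
    irreducible under the X(k), D(u, r) and t^r ([T_irr_L]). For this, T is recognised as
    the highest eigenspace of an element E that measures the height of roots ([T_top]), so
    a submodule of T generates V by lowering operators and T is irreducible under the
    elements of height zero. An operator on T that commutes with its derivatives is then
    injective or locally nilpotent ([inj_or_nil]). A nilpotent t^r would be surjective, by
    the Weyl relation with t^(-r) d_i; products of reflections of sl2-triples bound the
    dimensions of the spaces T_k from the other side and exclude this ([kk_inj]). The
    relations hold first up to nilpotent operators, because the derivatives of a nilpotent
    operator cannot be injective ([nil_der_not_inj]), and then exactly, because commuting
    nilpotent operators have a common kernel, which is a submodule ([T_relations]). The
    sl2-triples come from the root system of g(0,0), once the form is known to be a multiple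
    of the Killing form, which is nonzero ([killing_neq0], [form_killing], [sl2_exists]).

    Sending v in T_l to its image in degree l + p identifies L(V~)(p) with T, on which
    D(u, r) acts by D(u, r) + (u, p) t^r ([iota_act]). An isomorphism from L(V~)(p) to
    L(V~)(q) is thus a nonzero map F on T that commutes with X(k) and t^r and satisfies
    F D(u, r) = (D(u, r) + (u, q - p) t^r) F ([intertw]); it maps T_k to T_(k + p - q).

    Such an F induces an endomorphism of V~. If V~ is irreducible, this is a scalar by the
    lemma of Schur. As F shifts degrees by p - q, this is possible only for p - q in Gamma
    ([irr_intertw]).

    Conversely, the operators of L~ shift cosets of Gamma and V~ is the direct sum of its
    parts indexed by cosets. An element v of T is followed through its coset sums [psi v k],
    which are elements of T_k and describe its image in V~. Let x have minimal support,
    as a set of cosets, in a nonzero submodule U. An element of U whose support lies in a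
    translate of that of x is determined by one coset sum, which may be any element of T_l
    by the irreducibility of T ([moved_eq0], [moved_onto]). If the support of x contains two
    cosets a and b, then passing from the coset sum at l to the one at l + b - a defines an
    isomorphism of twists with p - q = b - a ([supp_intertw]). If it contains only one, all
    the images of the T_l lie in U ([supp_full]). *)

(** * Linear operators and subspaces *)

Section LinearOps.
Variables (K : pzRingType) (U V W : lmodType K).
Implicit Types (f : U -> V).

(** The operators of a representation are bare functions whose linearity is a
    hypothesis, because [rho s] is linear for admissible s only. *)
Lemma linD f : linear f -> forall u v, f (u + v) = f u + f v.
Proof. by move=> H u v; have := H 1 u v; rewrite !scale1r. Qed.

Lemma lin0 f : linear f -> f 0 = 0.
Proof.
move=> H; have := linD H 0 0; rewrite addr0 => /eqP.
by rewrite -subr_eq0 opprD addrA subrr sub0r oppr_eq0 => /eqP.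
Qed.

Lemma linZ f : linear f -> forall a v, f (a *: v) = a *: f v.
Proof. by move=> H a v; have := H a v 0; rewrite (lin0 H) !addr0. Qed.

Lemma linN f : linear f -> forall v, f (- v) = - f v.
Proof. by move=> H v; rewrite -scaleN1r linZ // scaleN1r. Qed.

Lemma linB f : linear f -> forall u v, f (u - v) = f u - f v.
Proof. by move=> H u v; rewrite linD // linN. Qed.

Lemma lin_sum f : linear f -> forall I (r : seq I) (P : pred I) F,
  f (\sum_(i <- r | P i) F i) = \sum_(i <- r | P i) f (F i).
Proof.
move=> H I r P F.
by elim/big_rec2: _ => [|i y z _ <-]; rewrite ?(lin0 H) ?(linD H).
Qed.

Lemma lin_comp f (h : V -> W) : linear f -> linear h -> linear (h \o f).
Proof. by move=> Hf Hh a u v /=; rewrite Hf Hh. Qed.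

End LinearOps.

Lemma lin_iter (K : pzRingType) (V : lmodType K) (f : V -> V) N :
  linear f -> linear (iter N f).
Proof. by move=> H; elim: N => [|N IH] a u v //=; rewrite IH H. Qed.

Lemma lin_addf (K : comPzRingType) (U V : lmodType K) (f h : U -> V) a b :
  linear f -> linear h -> linear (fun v => a *: f v + b *: h v).
Proof.
move=> Hf Hh c u v; rewrite Hf Hh !scalerDr !scalerA ![_ * c]mulrC -!addrA.
by congr (_ + _); rewrite addrCA.
Qed.

Lemma lin_scale (K : comPzRingType) (V : lmodType K) (f : V -> V) c :
  linear f -> linear (fun v => c *: f v).
Proof. by move=> Hf a u v; rewrite Hf scalerDr !scalerA mulrC. Qed.

Lemma lin_sub (K : comPzRingType) (V : lmodType K) (f h : V -> V) :
  linear f -> linear h -> linear (fun v => f v - h v).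
Proof.
move=> Hf Hh a u v; rewrite Hf Hh scalerBr opprD -!addrA; congr (_ + _).
by rewrite addrCA.
Qed.

Section Subspaces.
Variables (K : pzRingType) (V : lmodType K) (S : set V).
Hypothesis HS : is_subspace S.

Lemma subsp0 : S 0. Proof. by case: HS. Qed.
Lemma subspL a u v : S u -> S v -> S (a *: u + v). Proof. by case: HS => _; apply. Qed.
Lemma subspD u v : S u -> S v -> S (u + v).
Proof. by move=> Hu Hv; rewrite -[u]scale1r; exact: subspL. Qed.
Lemma subspZ a u : S u -> S (a *: u).
Proof. by move=> Hu; rewrite -[_ *: _]addr0; apply: subspL => //; exact: subsp0. Qed.
Lemma subspN u : S u -> S (- u).
Proof. by rewrite -scaleN1r; exact: subspZ. Qed.
Lemma subspB u v : S u -> S v -> S (u - v).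
Proof. by move=> Hu Hv; apply: subspD => //; exact: subspN. Qed.
Lemma subsp_sum I (r : seq I) (P : pred I) F :
  (forall i, P i -> S (F i)) -> S (\sum_(i <- r | P i) F i).
Proof. by move=> H; elim/big_ind: _ => //; [exact: subsp0|exact: subspD]. Qed.
Lemma lspan_sub (A : set V) : A `<=` S -> lspan A `<=` S.
Proof.
move=> HA _ [N [c [a [Ha ->]]]]; apply: subsp_sum => i _.
by apply: subspZ; apply: HA.
Qed.

End Subspaces.

Section Spans.
Variables (K : pzRingType) (V : lmodType K).

Lemma lspan_in (A : set V) v : A v -> lspan A v.
Proof.
move=> HA; exists 1%N, (fun=> 1), (fun=> v); split=> //.
by rewrite big_ord1 scale1r.
Qed.

Lemma lspan_lin_sub (W : lmodType K) (f : V -> W) (A : set V) (S : set W) :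
  linear f -> is_subspace S -> (forall v, A v -> S (f v)) ->
  forall v, lspan A v -> S (f v).
Proof.
move=> Hf HS HA _ [N [c [a [Ha ->]]]]; rewrite lin_sum //.
by apply: subsp_sum => // i _; rewrite linZ //; apply: subspZ => //; exact: HA.
Qed.

Lemma lspan_mono (A B : set V) : A `<=` B -> lspan A `<=` lspan B.
Proof.
move=> AB; apply: (lspan_sub (lspan_subspace B)) => v /AB; exact: lspan_in.
Qed.

Lemma lspan_ind (A : set V) (P : V -> Prop) :
  is_subspace P -> (forall v, A v -> P v) -> forall v, lspan A v -> P v.
Proof. by move=> HP H v; apply: lspan_sub. Qed.

End Spans.

Section PolyAction.
Variables (K : fieldType) (V : lmodType K) (A : V -> V).
Hypothesis linA : linear A.
Implicit Types (p q : {poly K}) (v : V).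

(** The value at v of the polynomial p in the operator A. *)
Definition pact p v : V := \sum_(i < size p) p`_i *: iter i A v.

Lemma pactE n p v : (size p <= n)%N -> pact p v = \sum_(i < n) p`_i *: iter i A v.
Proof.
move=> Hn; rewrite /pact (big_ord_widen n (fun i => p`_i *: iter i A v)) //.
rewrite big_mkcond /=; apply: eq_bigr => i _.
by case: ltnP => // /(nth_default 0) ->; rewrite scale0r.
Qed.

Lemma pactD p q v : pact (p + q) v = pact p v + pact q v.
Proof.
set n := maxn (size p) (size q).
rewrite !(@pactE n) ?leq_maxl ?leq_maxr ?size_polyD // -big_split /=.
by apply: eq_bigr => i _; rewrite coefD scalerDl.
Qed.

Lemma pactC c v : pact c%:P v = c *: v.
Proof. by rewrite (@pactE 1) ?size_polyC_leq1 // big_ord1 coefC. Qed.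

Lemma pactZ c p v : pact (c *: p) v = c *: pact p v.
Proof.
rewrite (@pactE (size p)) ?size_scale_leq // scaler_sumr.
by apply: eq_bigr => i _; rewrite coefZ scalerA.
Qed.

Lemma pact0 v : pact 0 v = 0.
Proof. by rewrite -[0]/(0%:P) pactC scale0r. Qed.

Lemma pact1 v : pact 1 v = v.
Proof. by rewrite -[1]/(1%:P) pactC scale1r. Qed.

Lemma pactMX p v : pact (p * 'X) v = pact p (A v).
Proof.
rewrite (@pactE (size p).+1) ?size_polyMX ?big_ord_recl; last first.
  by have [->|/size_mulX ->] := eqVneq p 0; rewrite ?mul0r ?size_poly0.
rewrite coefMX eqxx scale0r add0r; apply: eq_bigr => i _.
by rewrite coefMX /= add0n -iterS iterSr.
Qed.

Lemma pact_lin p : linear (pact p).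
Proof.
move=> a u v; rewrite /pact scaler_sumr -big_split; apply: eq_bigr => i _ /=.
by rewrite (lin_iter _ linA) scalerDr !scalerA mulrC.
Qed.

Lemma pactv0 p : pact p 0 = 0.
Proof. exact: (lin0 (@pact_lin p)). Qed.

Lemma pact_comm (B : V -> V) : linear B -> (forall v, A (B v) = B (A v)) ->
  forall p v, pact p (B v) = B (pact p v).
Proof.
move=> HB AB p v; rewrite /pact lin_sum //; apply: eq_bigr => i _.
by rewrite linZ //; congr (_ *: _); elim: (i : nat) => //= k ->; rewrite AB.
Qed.

Lemma pactA p v : A (pact p v) = pact p (A v).
Proof. by rewrite pact_comm. Qed.

Lemma pactM p q v : pact (p * q) v = pact p (pact q v).
Proof.
elim/poly_ind: p q v => [|p c IH] q v; first by rewrite mul0r !pact0.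
rewrite mulrDl pactD -mulrA ['X * q]mulrC mulrA pactMX IH pactD pactMX.
by rewrite pactA mul_polyC pactZ pactC.
Qed.

Lemma pactMC p q v : pact p (pact q v) = pact q (pact p v).
Proof. by rewrite -!pactM mulrC. Qed.

Lemma pactXsubC c v : pact ('X - c%:P) v = A v - c *: v.
Proof. by rewrite pactD -['X]mul1r pactMX pact1 -rmorphN pactC scaleNr. Qed.

Lemma pactXn p N v : pact (p ^+ N) v = iter N (pact p) v.
Proof. by elim: N => [|N IH]; rewrite ?expr0 ?pact1 // exprS pactM IH. Qed.

Lemma pact_eigen c v : A v = c *: v -> forall p, pact p v = p.[c] *: v.
Proof.
move=> Hv; elim/poly_ind => [|p a IH]; first by rewrite pact0 horner0 scale0r.
rewrite pactD pactMX Hv linZ ?IH; last exact: pact_lin.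
by rewrite pactC hornerMXaddC scalerDl scalerA mulrC.
Qed.

Lemma pact_stable (S : set V) : is_subspace S -> (forall v, S v -> S (A v)) ->
  forall p v, S v -> S (pact p v).
Proof.
move=> HS HA p v Hv; apply: subsp_sum => // i _; apply: subspZ => //.
by elim: (i : nat) => //= k; exact: HA.
Qed.

Lemma pact_modp p q v : q %| p -> pact q v = 0 -> pact p v = 0.
Proof.
by move=> /divpK <- Hq; rewrite pactM Hq pactv0.
Qed.

Lemma pact_coprime0 p q v : coprimep p q -> pact p v = 0 -> pact q v = 0 -> v = 0.
Proof.
move=> /Bezout_eq1_coprimepP [[a b] /= E] Hp Hq.
by rewrite -[v]pact1 -E pactD !pactM Hp Hq !pactv0 addr0.
Qed.

(** Primary decomposition as an induction principle: an additive property may be checked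
    on generalised eigenvectors. The identity of Bezout for one factor and the product
    of the others splits v. *)
Lemma primary_ind (S : set V) (P : V -> Prop) (s : seq K) N :
  is_subspace S -> (forall v, S v -> S (A v)) -> P 0 ->
  (forall u v, P u -> P v -> P (u + v)) ->
  (forall c v, c \in s -> S v -> pact (('X - c%:P) ^+ N) v = 0 -> P v) ->
  uniq s -> forall v, S v -> pact (\prod_(c <- s) ('X - c%:P) ^+ N) v = 0 -> P v.
Proof.
move=> HS SA P0 PD; elim: s => [|c s IH] Pc /=.
  by move=> _ v _; rewrite big_nil pact1 => ->.
move=> /andP[cs us] v Sv; rewrite big_cons => Hv.
set q := \prod_(j <- s) _ in Hv; set r := _ ^+ N in Hv.
have /Bezout_eq1_coprimepP [[a b] /= E] : coprimep r q.
  rewrite /q; elim: (s) cs {Hv q IH us Pc} => [|d t IH]; first by rewrite big_nil coprimep1.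
  rewrite inE negb_or big_cons => /andP[cd ct]; rewrite coprimepMr IH // andbT.
  apply: coprimep_expl; apply: coprimep_expr.
  by rewrite coprimep_XsubC root_XsubC eq_sym.
rewrite -[v]pact1 -E pactD; apply: PD.
- apply: IH => //.
  + by move=> d u ds; apply: Pc; rewrite inE ds orbT.
  + by apply: pact_stable.
  + by rewrite -/q -pactM mulrCA pactM [q * r]mulrC Hv pactv0.
- apply: (Pc c); first by rewrite inE eqxx.
  + by apply: pact_stable.
  + by rewrite -!pactM mulrCA pactM Hv pactv0.
Qed.

End PolyAction.

(** * Finite-dimensional subspaces *)

Section FinDim.
Variables (K : fieldType) (V : lmodType K).

Definition lincomb d (b : 'I_d -> V) (u : 'rV[K]_d) : V := \sum_i u 0 i *: b i.

Lemma lincomb_lin d (b : 'I_d -> V) : linear (lincomb b).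
Proof.
move=> a u v; rewrite /lincomb scaler_sumr -big_split; apply: eq_bigr => i _ /=.
by rewrite !mxE scalerDl scalerA.
Qed.

Lemma lincomb0 d (b : 'I_d -> V) : lincomb b 0 = 0.
Proof. exact: (lin0 (lincomb_lin b)). Qed.

Definition is_basis (S : set V) d (b : 'I_d -> V) :=
  [/\ forall u, S (lincomb b u), forall u, lincomb b u = 0 -> u = 0
    & forall v, S v -> exists u, v = lincomb b u].

Definition findim (S : set V) := exists s : seq V, S `<=` lspan [set` s].

Lemma lincomb_delta d (b : 'I_d -> V) i : lincomb b (delta_mx 0 i) = b i.
Proof.
rewrite /lincomb (bigD1 i) //= big1 ?mxE ?eqxx ?scale1r ?addr0 //.
by move=> j ji; rewrite mxE eqxx (negbTE ji) scale0r.
Qed.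

Lemma lspan_seq_coord (s : seq V) v : lspan [set` s] v ->
  exists u : 'rV_(size s), v = lincomb (fun i : 'I_(size s) => s`_i) u.
Proof.
apply: (@lspan_ind _ _ _ (fun v => exists u : 'rV_(size s),
  v = lincomb (fun i : 'I_(size s) => s`_i) u)) => [|w ws].
  split; first by exists 0; rewrite lincomb0.
  by move=> a _ _ [u ->] [w ->]; exists (a *: u + w); rewrite lincomb_lin.
have ltw : (index w s < size s)%N by rewrite index_mem.
by exists (delta_mx 0 (Ordinal ltw)); rewrite lincomb_delta /= nth_index.
Qed.

Lemma choice_mx (m n : nat) (P : 'I_m -> 'rV[K]_n -> Prop) :
  (forall i, exists u, P i u) -> exists M : 'M[K]_(m, n), forall i, P i (row i M).
Proof.
move=> /choice [f Hf]; exists (\matrix_i f i) => i; by rewrite rowK.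
Qed.

Lemma lincomb_mulmx m n (M : 'M[K]_(m, n)) (b : 'I_n -> V) (u : 'rV_m) :
  lincomb b (u *m M) = lincomb (fun i => lincomb b (row i M)) u.
Proof.
rewrite /lincomb; under eq_bigr do rewrite mxE scaler_suml.
rewrite exchange_big; apply: eq_bigr => i _ /=; rewrite scaler_sumr.
by apply: eq_bigr => j _; rewrite scalerA !mxE.
Qed.

(** The coordinates of the b i on s form a row-free matrix. *)
Lemma indep_bound (s : seq V) d (b : 'I_d -> V) :
  (forall i, lspan [set` s] (b i)) -> (forall u, lincomb b u = 0 -> u = 0) ->
  (d <= size s)%N.
Proof.
move=> Hb ib.
have [M HM] := choice_mx (fun i => lspan_seq_coord (Hb i)).
suff fM : row_free M by rewrite -(eqP fM) rank_leq_col.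
apply/inj_row_free => u uM; apply: ib.
transitivity (lincomb (fun i => lincomb (fun j : 'I_(size s) => s`_j) (row i M)) u).
  by rewrite /lincomb; apply: eq_bigr => i _; rewrite {1}HM.
by rewrite -lincomb_mulmx uM lincomb0.
Qed.

(** An independent family of maximal size, which exists by [indep_bound], spans S. *)
Lemma findim_basis (S : set V) : is_subspace S -> findim S ->
  exists d (b : 'I_d -> V), is_basis S b.
Proof.
move=> HS [s Hs].
pose Q d := exists b : 'I_d -> V,
  (forall i, S (b i)) /\ forall u, lincomb b u = 0 -> u = 0.
have exQ : exists d, `[< Q d >].
  exists 0%N; apply/asboolP; exists (fun=> 0); split; first by case.
  by move=> u _; apply/rowP; case.
have bQ d : `[< Q d >] -> (d <= size s)%N.
  by move=> /asboolP [b [Sb ib]]; apply: indep_bound ib => i; apply: Hs.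
case: (ex_maxnP exQ bQ) => d /asboolP [b [Sb ib]] dmax.
exists d, b; split=> // [u|v Sv].
  by apply: subsp_sum => // i _; apply: subspZ.
apply: contrapT => nv; suff : (d.+1 <= d)%N by rewrite ltnn.
apply: dmax; apply/asboolP.
pose b' (i : 'I_(d + 1)) := match fintype.split i with inl j => b j | inr _ => v end.
rewrite -addn1; exists b'; split=> [i|u].
  by rewrite /b'; case: fintype.split.
have E : lincomb b' u = lincomb b (lsubmx u) + u 0 (rshift d 0) *: v.
  rewrite /lincomb big_split_ord big_ord1 /=; congr (_ + _).
    apply: eq_bigr => j _; rewrite /b' mxE.
    by have -> : fintype.split (lshift 1 j) = inl j := unsplitK (inl j).
  by rewrite /b'; have -> : fintype.split (rshift d ord0) = inr ord0 := unsplitK (inr ord0).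
rewrite E => E0; have [u0|u0] := eqVneq (u 0 (rshift d 0)) 0.
  have /ib l0 : lincomb b (lsubmx u) = 0 by rewrite -E0 u0 scale0r addr0.
  rewrite -[u]hsubmxK l0; apply/rowP => j; rewrite !mxE; case: fintype.splitP => k _.
    by rewrite mxE.
  by rewrite ord1 mxE u0.
case: nv; exists (- (u 0 (rshift d 0))^-1 *: lsubmx u).
rewrite (linZ (lincomb_lin _)).
have -> : lincomb b (lsubmx u) = - (u 0 (rshift d 0) *: v).
  by apply/eqP; rewrite -addr_eq0 E0.
by rewrite scaleNr scalerN opprK scalerA mulVf // scale1r.
Qed.

End FinDim.

(** A homomorphism between modules carried by subspaces is linear on its domain only,
    not on the ambient space. *)
Definition linear_on (K : pzRingType) (V W : lmodType K) (A : set V) (f : V -> W) :=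
  forall a u v, A u -> A v -> f (a *: u + v) = a *: f u + f v.

Lemma linear_onW (K : pzRingType) (V W : lmodType K) (A : set V) (f : V -> W) :
  linear f -> linear_on A f.
Proof. by move=> lf a u v _ _; exact: lf. Qed.

Section FinDimMaps.
Variables (K : fieldType) (V W : lmodType K) (A : set V) (B : set W).
Hypotheses (HA : is_subspace A) (HB : is_subspace B).
Hypotheses (fA : findim A) (fB : findim B).

Lemma map_matrix m n (a : 'I_m -> V) (b : 'I_n -> W) (f : V -> W) :
  is_basis A a -> is_basis B b -> linear_on A f -> (forall v, A v -> B (f v)) ->
  exists M : 'M[K]_(m, n), forall u, f (lincomb a u) = lincomb b (u *m M).
Proof.
move=> [Aa _ _] [_ _ sB] lf fAB.
have Ha i : exists u, f (a i) = lincomb b u.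
  by apply: sB; apply: fAB; rewrite -lincomb_delta; exact: Aa.
have [M HM] := choice_mx Ha; exists M => u.
have Aai i : A (a i) by rewrite -lincomb_delta; exact: Aa.
have A0 := subsp0 HA.
have f0 : f 0 = 0.
  by have := lf (-1) 0 0 A0 A0; rewrite scaler0 addr0 scaleN1r addNr.
rewrite lincomb_mulmx /lincomb.
suff [] : A (\sum_i u 0 i *: a i) /\
    f (\sum_i u 0 i *: a i) = \sum_i u 0 i *: lincomb b (row i M) by [].
elim: (index_enum _) => [|i r [IHA IHf]]; first by rewrite !big_nil.
by rewrite !big_cons lf // HM IHf; split=> //; exact: subspL.
Qed.

Variables (f g : V -> W) (h : W -> V).
Hypotheses (lf : linear f) (lg : linear g) (lh : linear h).
Hypotheses (fAB : forall v, A v -> B (f v)) (gAB : forall v, A v -> B (g v))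
  (hBA : forall v, B v -> A (h v)).

(** Injections in both directions force equal dimensions. *)
Lemma inj_inj_surj : (forall v, A v -> f v = 0 -> v = 0) ->
  (forall v, B v -> h v = 0 -> v = 0) -> forall w, B w -> exists2 v, A v & f v = w.
Proof.
move=> injf injh w Bw.
have [m [a Ha]] := findim_basis HA fA; have [n [b Hb]] := findim_basis HB fB.
have [F HF] := map_matrix Ha Hb (linear_onW lf) fAB.
have [H HH] : exists M : 'M[K]_(n, m), forall u, h (lincomb b u) = lincomb a (u *m M).
  case: Ha Hb => [Aa ia sA] [Bb ib sB].
  have Hc i : exists u, h (b i) = lincomb a u.
    by apply: sA; apply: hBA; rewrite -lincomb_delta; exact: Bb.
  have [M HM] := choice_mx Hc; exists M => u.
  rewrite lincomb_mulmx /lincomb lin_sum //; apply: eq_bigr => i _.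
  by rewrite linZ // HM.
case: Ha Hb => [Aa ia sA] [Bb ib sB].
have freeF : row_free F.
  apply/inj_row_free => u uF; apply: ia; apply: injf => //.
  by rewrite HF uF lincomb0.
have freeH : row_free H.
  apply/inj_row_free => u uH; apply: ib; apply: injh => //.
  by rewrite HH uH lincomb0.
have mn : (m <= n)%N by rewrite -(eqP freeF) rank_leq_col.
have nm : (n <= m)%N by rewrite -(eqP freeH) rank_leq_col.
have fullF : row_full F by rewrite /row_full (eqP freeF) eqn_leq mn nm.
have [u Ew] := sB _ Bw.
have [D ED] := row_fullP fullF.
exists (lincomb a (u *m D)); first exact: Aa.
by rewrite HF -mulmxA ED mulmx1 Ew.
Qed.

(** The injection g bounds the dimension of A by that of B, so a surjection f is a
    bijection. *)
Lemma surj_inj_inj : (forall w, B w -> exists2 v, A v & f v = w) ->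
  (forall v, A v -> g v = 0 -> v = 0) -> forall v, A v -> f v = 0 -> v = 0.
Proof.
move=> surf injg v Av fv0.
have [m [a Ha]] := findim_basis HA fA; have [n [b Hb]] := findim_basis HB fB.
have [F HF] := map_matrix Ha Hb (linear_onW lf) fAB.
have [G HG] := map_matrix Ha Hb (linear_onW lg) gAB.
case: Ha Hb => [Aa ia sA] [Bb ib sB].
have freeG : row_free G.
  apply/inj_row_free => u uF; apply: ia; apply: injg => //.
  by rewrite HG uF lincomb0.
have injb u w : lincomb b u = lincomb b w -> u = w.
  move=> E; apply/eqP; rewrite -subr_eq0; apply/eqP; apply: ib.
  by rewrite (linB (lincomb_lin _)) E subrr.
have fullF : row_full F.
  rewrite -sub1mx; apply/row_subP => i.
  have [w Aw Ew] := surf _ (Bb (row i 1%:M)).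
  have [u Eu] := sA _ Aw; apply/submxP; exists u; apply: injb.
  by rewrite -HF -Eu Ew.
have mn : (m <= n)%N by rewrite -(eqP freeG) rank_leq_col.
have nm : (n <= m)%N by rewrite -(eqP fullF) rank_leq_row.
have freeF : row_free F by rewrite /row_free (eqP fullF) eqn_leq nm mn.
have [u Ev] := sA _ Av; rewrite Ev in fv0 *.
have : u *m F = 0 by apply: ib; rewrite -HF.
move/eqP; rewrite (mulmx_free_eq0 _ freeF) => /eqP ->.
by rewrite lincomb0.
Qed.

End FinDimMaps.

Section Pencil.
Variables (K : closedFieldType) (V W : lmodType K) (A : set V) (B : set W).
Hypotheses (HA : is_subspace A) (HB : is_subspace B).
Hypotheses (fA : findim A) (fB : findim B).
Variables (f g : V -> W).
Hypotheses (lf : linear_on A f) (lg : linear_on A g).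
Hypotheses (fAB : forall v, A v -> B (f v)) (gAB : forall v, A v -> B (g v)).

(** An eigenvector of f followed by the inverse of g. *)
Lemma pencil_singular : (exists2 v, A v & v != 0) ->
  (forall v, A v -> g v = 0 -> v = 0) ->
  (forall w, B w -> exists2 v, A v & g v = w) ->
  exists c v, [/\ A v, v != 0 & f v = c *: g v].
Proof.
move=> [v0 Av0 v0n] injg surg.
have [m [a Ha]] := findim_basis HA fA; have [n [b Hb]] := findim_basis HB fB.
have [F HF] := map_matrix HA Ha Hb lf fAB.
have [G HG] := map_matrix HA Ha Hb lg gAB.
case: Ha Hb => [Aa ia sA] [Bb ib sB].
have freeG : row_free G.
  apply/inj_row_free => u uF; apply: ia; apply: injg => //.
  by rewrite HG uF lincomb0.
have injb u w : lincomb b u = lincomb b w -> u = w.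
  move=> E; apply/eqP; rewrite -subr_eq0; apply/eqP; apply: ib.
  by rewrite (linB (lincomb_lin _)) E subrr.
have fullG : row_full G.
  rewrite -sub1mx; apply/row_subP => i.
  have [w Aw Ew] := surg _ (Bb (row i 1%:M)).
  have [u Eu] := sA _ Aw; apply/submxP; exists u; apply: injb.
  by rewrite -HG -Eu Ew.
have emn : m = n by apply/eqP; rewrite -(eqP freeG) (eqP fullG).
subst n; have uG : G \in unitmx by rewrite -row_free_unit.
have m_gt0 : (0 < m)%N.
  have [u Eu] := sA _ Av0; rewrite lt0n; apply: contra_neq v0n => m0.
  by rewrite Eu /lincomb big1 // => i _; have := ltn_ord i; rewrite {2}m0.
have [c rc] : exists c, root (char_poly (F *m invmx G)) c.
  apply/closed_rootP; rewrite size_char_poly.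
  by case: (m) m_gt0.
have /eigenvalueP [u Eu un0] : eigenvalue (F *m invmx G) c.
  by rewrite eigenvalue_root_char.
exists c, (lincomb a u); split=> //.
  by apply: contraNneq un0 => /ia ->.
rewrite HF HG -(linZ (lincomb_lin _)).
by rewrite -[in LHS](mulmxKV uG F) mulmxA Eu -scalemxAl.
Qed.

End Pencil.

Lemma findim_nilp (K : fieldType) (V : lmodType K) (S : set V) (f : V -> V) :
  is_subspace S -> findim S -> linear f ->
  (forall v, S v -> exists N, iter N f v = 0) ->
  exists N, forall v, S v -> iter N f v = 0.
Proof.
move=> HS fS lf nf; have [d [b [Sb _ spb]]] := findim_basis HS fS.
have Hb i : exists N, iter N f (b i) = 0.
  by apply: nf; rewrite -lincomb_delta.
have [N HN] := choice Hb.
exists (\sum_i N i)%N => v /spb [u ->].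
rewrite /lincomb (lin_sum (lin_iter _ lf)).
apply: big1 => i _; rewrite (linZ (lin_iter _ lf)).
by rewrite (bigD1 i) //= addnC iterD HN (lin0 (lin_iter _ lf)) scaler0.
Qed.

(** Induction on the dimension: if some operator of the family is nonzero, its kernel is
    a proper nonzero subspace, stable under the others. *)
Lemma common_kernel (K : fieldType) (V : lmodType K) (I : Type) (ok : I -> Prop)
    (y : I -> V -> V) (S : set V) :
  is_subspace S -> findim S -> (exists2 v, S v & v != 0) ->
  (forall i, ok i -> linear (y i)) ->
  (forall i, ok i -> forall v, S v -> S (y i v)) ->
  (forall i j, ok i -> ok j -> forall v, S v -> y i (y j v) = y j (y i v)) ->
  (forall i, ok i -> forall v, S v -> exists N, iter N (y i) v = 0) ->
  exists v, [/\ S v, v != 0 & forall i, ok i -> y i v = 0].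
Proof.
move=> HS fS; have [d [b Hb]] := findim_basis HS fS.
have [n dn] : exists n, (d <= n)%N by exists d.
elim: n d b dn S HS fS Hb => [|n IH] d b dn S HS fS Hb [v0 Sv0 v0n] ly Sy cy ny.
  have d0 : d = 0%N by apply/eqP; rewrite -leqn0.
  subst d; case: Hb => _ _ /(_ _ Sv0) [u E]; case/eqP: v0n.
  by rewrite E /lincomb big_ord0.
have [all0|] := pselect (forall i, ok i -> forall v, S v -> y i v = 0).
  by exists v0; split=> // i oi; apply: all0.
move=> /existsNP [i /not_implyP [oi /existsNP [w /not_implyP [Sw yw]]]].
pose S' : set V := [set v | S v /\ y i v = 0].
have HS' : is_subspace S'.
  split; first by split; [exact: subsp0|rewrite (lin0 (ly _ oi))].
  move=> a u v [Su yu] [Sv yv]; split; first exact: subspL.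
  by rewrite (ly i oi) yu yv scaler0 addr0.
have fS' : findim S' by case: fS => s Hs; exists s => v [/Hs].
have [d' [b' Hb']] := findim_basis HS' fS'.
have d'n : (d' <= n)%N.
  (* [y i] does not vanish on S, so its kernel S' has smaller dimension *)
  rewrite -ltnS (leq_trans _ dn) //.
  have Hsub i' : exists u, b' i' = lincomb b u.
    by case: Hb Hb' => _ _ sb [sb' _ _]; apply: sb;
      have [] := sb' (delta_mx 0 i'); rewrite lincomb_delta.
  have [M HM] := choice_mx Hsub.
  have EM u : lincomb b' u = lincomb b (u *m M).
    by rewrite lincomb_mulmx /lincomb; apply: eq_bigr => j _; rewrite {1}HM.
  have freeM : row_free M.
    apply/inj_row_free => u uM; case: Hb' => _ ib' _; apply: ib'.
    by rewrite EM uM lincomb0.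
  rewrite ltn_neqAle -(eqP freeM) rank_leq_col andbT.
  apply: contra_notN yw => fullM.
  have [u Eu] : exists u, w = lincomb b u by case: Hb => _ _; apply.
  have [D ED] := row_fullP (fullM : row_full M).
  have : S' w.
    by rewrite Eu -[u]mulmx1 -ED mulmxA -EM; case: Hb' => + _ _; apply.
  by case.
have ex' : exists2 v, S' v & v != 0.
  have exN : exists N, iter N (y i) v0 == 0 by have [N HN] := ny i oi _ Sv0; exists N; apply/eqP.
  case: (ex_minnP exN) => [[|N]] /eqP HN Nmin; first by case/eqP: v0n.
  exists (iter N (y i) v0).
    split; last by rewrite -HN.
    by elim: (N) => //= k; exact: Sy.
  by apply: contraTneq isT => /eqP /Nmin; rewrite ltnn.
have [v [[Sv _] vn Hv]] : exists v, [/\ S' v, v != 0 & forall j, ok j -> y j v = 0].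
  apply: (IH d' b' d'n S') => // [j oj v [Sv yv]|j k oj ok' v [Sv _]|j oj v [Sv _]].
  - by split; [exact: Sy|rewrite cy // yv (lin0 (ly _ oj))].
  - exact: cy.
  - exact: ny.
by exists v.
Qed.

(** * The Killing form of a simple Lie algebra *)

Section Polys.
Variable (K : fieldType).

(** Chinese remainder theorem. As p is congruent to f c to order N at c, the operator
    p(A) is the scalar f c on the vectors killed by (A - c)^N. *)
Lemma interpolation (f : K -> K) (s : seq K) N : uniq s ->
  exists p : {poly K}, forall c, c \in s -> ('X - c%:P) ^+ N %| p - (f c)%:P.
Proof.
elim: s => [|c s IH] /=; first by exists 0.
move=> /andP[cs /IH [p Hp]].
set q := \prod_(e <- s) ('X - e%:P) ^+ N; set r := ('X - c%:P) ^+ N.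
have /Bezout_eq1_coprimepP [[a b] /= E] : coprimep r q.
  rewrite /q; elim: (s) cs {q IH Hp} => [|d t IH]; first by rewrite big_nil coprimep1.
  rewrite inE negb_or big_cons => /andP[cd ct]; rewrite coprimepMr IH // andbT.
  apply: coprimep_expl; apply: coprimep_expr.
  by rewrite coprimep_XsubC root_XsubC eq_sym.
exists (p + b * q * ((f c)%:P - p)) => e; rewrite inE => /orP[/eqP ->|es].
  have -> : p + b * q * ((f c)%:P - p) - (f c)%:P = r * (a * (p - (f c)%:P)).
    have -> : b * q = 1 - a * r by apply/eqP; rewrite eq_sym subr_eq addrC E.
    by rewrite /r; ring.
  exact: dvdp_mulIl.
rewrite addrAC dvdp_add ?Hp // -!mulrA dvdp_mull // dvdp_mulr //.
by rewrite /q (big_rem e) //= dvdp_mulIl.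
Qed.

Lemma prod_XsubC_dvd (l s : seq K) : {subset l <= s} ->
  \prod_(x <- l) ('X - x%:P) %| \prod_(c <- s) ('X - c%:P) ^+ size l.
Proof.
rewrite prodrXl; elim: l => [|x l IH] Hs /=; first by rewrite big_nil dvd1p.
rewrite big_cons exprS dvdp_mul //; last by apply: IH => y yl; apply: Hs; rewrite inE yl orbT.
by rewrite (big_rem x) ?dvdp_mulIl //; apply: Hs; rewrite inE eqxx.
Qed.

Lemma pact_transport (V W : lmodType K) (A : V -> V) (B : W -> W) (f : V -> W) p v :
  linear f -> (forall u, f (A u) = B (f u)) -> f (pact A p v) = pact B p (f v).
Proof.
move=> lf E; rewrite /pact lin_sum //; apply: eq_bigr => i _; rewrite linZ //.
by congr (_ *: _); elim: (i : nat) => //= k <-; rewrite E.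
Qed.

(** Cayley-Hamilton, on row vectors. *)
Lemma pact_char_poly n (M : 'M[K]_n) (u : 'rV_n) :
  pact (fun v => v *m M) (char_poly M) u = 0.
Proof.
case: n M u => [|n] M u; first by apply/rowP; case.
suff E p : pact (fun v => v *m M) p u = u *m horner_mx M p.
  by rewrite E Cayley_Hamilton mulmx0.
elim/poly_ind: p u => [|p c IH] u; first by rewrite pact0 rmorph0 mulmx0.
rewrite pactD pactMX IH pactC rmorphD rmorphM /= horner_mx_X horner_mx_C.
rewrite mulmxDr mul_mx_scalar; congr (_ + _).
by rewrite -mulmxE -mulmxA; congr (_ *m _); exact: comm_mx_horner.
Qed.

End Polys.

Section LieBasics.
Variables (K : fieldType) (g : finLieType K).
Implicit Types x y z : g.

Lemma lieDl x y z : {[x + y, z]} = {[x, z]} + {[y, z]}.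
Proof. exact: (linD (lie_linear_l z)). Qed.
Lemma lieDr x y z : {[x, y + z]} = {[x, y]} + {[x, z]}.
Proof. exact: (linD (lie_linear_r x)). Qed.
Lemma lieZl a x z : {[a *: x, z]} = a *: {[x, z]}.
Proof. exact: (linZ (lie_linear_l z)). Qed.
Lemma lieZr a x z : {[x, a *: z]} = a *: {[x, z]}.
Proof. exact: (linZ (lie_linear_r x)). Qed.
Lemma lie0l x : {[0, x]} = 0 :> g.
Proof. exact: (lin0 (lie_linear_l x)). Qed.
Lemma lie0r x : {[x, 0]} = 0 :> g.
Proof. exact: (lin0 (lie_linear_r x)). Qed.
Lemma lieC x y : {[x, y]} = - {[y, x]}.
Proof.
have := lie_alt (x + y); rewrite lieDl !lieDr !lie_alt add0r addr0 => /eqP.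
by rewrite addr_eq0 => /eqP.
Qed.
Lemma lieNr x y : {[x, - y]} = - {[x, y]}.
Proof. by rewrite -scaleN1r lieZr scaleN1r. Qed.
Lemma lieNl x y : {[- x, y]} = - {[x, y]}.
Proof. by rewrite -scaleN1r lieZl scaleN1r. Qed.

Lemma lie_der x y z : {[x, {[y, z]}]} = {[{[x, y]}, z]} + {[y, {[x, z]}]}.
Proof.
have /eqP := lie_jacobi x y z; rewrite -addrA addr_eq0 => /eqP ->.
by rewrite opprD addrC -(lieC {[x, y]}) -lieNr -lieC.
Qed.

(** The operator ad h - (a + b) maps [x, y] to [(ad h - a) x, y] + [x, (ad h - b) y],
    which allows an induction on M + N. *)
Lemma lie_gen_weight h x y a b M N :
  pact (lie h) (('X - a%:P) ^+ M) x = 0 -> pact (lie h) (('X - b%:P) ^+ N) y = 0 ->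
  pact (lie h) (('X - (a + b)%:P) ^+ (M + N)) {[x, y]} = 0.
Proof.
have lh := lie_linear_r h.
have [n E] : exists n, (M + N)%N = n by exists (M + N)%N.
elim: n M N E x y => [|n IH] M N E x y.
  by move: E; case: M => // _; rewrite expr0 pact1 // => ->; rewrite lie0l pactv0.
case: M N E => [|M] [|N] // E.
- by rewrite expr0 pact1 // => -> _; rewrite lie0l pactv0.
- by move=> _; rewrite expr0 pact1 // => ->; rewrite lie0r pactv0.
rewrite !exprSr !pactM // !pactXsubC // => Hx Hy.
have -> : {[h, {[x, y]}]} - (a + b) *: {[x, y]} =
    {[{[h, x]} - a *: x, y]} + {[x, {[h, y]} - b *: y]}.
  rewrite lie_der lieDl lieDr lieNl lieNr lieZl lieZr scalerDl opprD.
  by rewrite -!addrA; congr (_ + _); rewrite addrCA; congr (_ + _); rewrite addrCA.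
rewrite (linD (pact_lin lh _)).
rewrite (IH M N.+1) ?add0r //; first last.
- by rewrite exprSr pactM // pactXsubC.
- by case: E.
have E' : (M.+1 + N)%N = n by rewrite addSnnS; case: E.
have := IH M.+1 N E' x ({[h, y]} - b *: y); rewrite addSnnS; apply=> //.
by rewrite exprSr pactM // pactXsubC.
Qed.

End LieBasics.

Section Killing.
Variables (K : numClosedFieldType) (g : finLieType K).
Implicit Types x y z : g.
Local Notation d := (dim g).

(** The matrix acts on row vectors on the right, so that the product of operators
    becomes the product of matrices in the opposite order. *)
Definition opmx (f : g -> g) : 'M[K]_d := \matrix_i v2r (f (r2v (delta_mx 0 i))).

Lemma opmxE f : linear f -> forall v, v2r (f v) = v2r v *m opmx f.
Proof.
move=> lf v; rewrite -{1}[v]v2rK [in LHS](row_sum_delta (v2r v)) linear_sum /=.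
rewrite (lin_sum lf) linear_sum /= mulmx_sum_row; apply: eq_bigr => i _.
by rewrite linearZ /= (linZ lf) linearZ /= rowK.
Qed.

Lemma opmx_uniq f M : (forall v, v2r (f v) = v2r v *m M) -> opmx f = M.
Proof.
by move=> H; apply/row_matrixP => i; rewrite rowK H r2vK -rowE.
Qed.

Definition killing x y : K := \tr (opmx (lie x) *m opmx (lie y)).

Lemma opmx_lie_lin : linear (fun x => opmx (lie x)).
Proof.
move=> a x y; apply: opmx_uniq => v.
rewrite lieDl lieZl linearP /= mulmxDr -scalemxAr.
by rewrite !(opmxE (lie_linear_r _)).
Qed.

Lemma opmx_lie2 y z : opmx (lie {[y, z]}) =
  opmx (lie z) *m opmx (lie y) - opmx (lie y) *m opmx (lie z).
Proof.
apply: opmx_uniq => v; have /eqP := lie_der y z v; rewrite -subr_eq => /eqP <-.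
by rewrite linearB /= !(opmxE (lie_linear_r _)) mulmxBr !mulmxA.
Qed.

Lemma killing_lin a x y z : killing (a *: x + y) z = a * killing x z + killing y z.
Proof.
rewrite /killing (opmx_lie_lin a x y).
by rewrite mulmxDl -scalemxAl linearP.
Qed.

Lemma killing0l z : killing 0 z = 0.
Proof. by have := killing_lin (-1) 0 0 z; rewrite scaler0 addr0 mulN1r addNr. Qed.

Lemma killingZl a x z : killing (a *: x) z = a * killing x z.
Proof. by have := killing_lin a x 0 z; rewrite addr0 killing0l addr0. Qed.

Lemma killingC x y : killing x y = killing y x.
Proof. exact: mxtrace_mulC. Qed.

Lemma killing_inv x y z : killing {[x, y]} z = killing x {[y, z]}.
Proof.
rewrite /killing !opmx_lie2 mulmxBl mulmxBr !linearB /= !mulmxA.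
congr (_ - _).
by rewrite -(mulmxA (opmx (lie y))) [LHS]mxtrace_mulC.
Qed.

(** A derivation P satisfies ad (P z) = [P, ad z]; the rest is the cyclicity of the
    trace. *)
Lemma killing_der (P : g -> g) y z : linear P ->
  (forall u v, P {[u, v]} = {[P u, v]} + {[u, P v]}) ->
  \tr (opmx (lie {[y, z]}) *m opmx P) = - killing y (P z).
Proof.
move=> lP dP.
have -> : killing y (P z) =
    \tr (opmx (lie y) *m (opmx (lie z) *m opmx P - opmx P *m opmx (lie z))).
  rewrite /killing; congr (\tr (_ *m _)); apply: opmx_uniq => v.
  have -> : {[P z, v]} = P {[z, v]} - {[z, P v]} by rewrite dP addrK.
  by rewrite linearB /= (opmxE lP) !(opmxE (lie_linear_r _)) (opmxE lP) mulmxBr !mulmxA.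
rewrite opmx_lie2 mulmxBl mulmxBr !linearB /= opprB; congr (_ - _); last by rewrite mulmxA.
by rewrite -mulmxA mxtrace_mulC mulmxA.
Qed.

Lemma killing_aut (f : g -> g) (h : g -> g) : linear f -> cancel f h -> cancel h f ->
  (forall u v, f {[u, v]} = {[f u, f v]}) -> forall x y, killing (f x) (f y) = killing x y.
Proof.
move=> lf fK hK fm.
have lh : linear h.
  by move=> a u v; apply: (can_inj fK); rewrite lf !hK.
have E x : opmx (lie (f x)) = opmx h *m opmx (lie x) *m opmx f.
  apply: opmx_uniq => v; rewrite -{1}[v]hK -fm (opmxE lf) (opmxE (lie_linear_r _)).
  by rewrite (opmxE lh) !mulmxA.
have fh : opmx f *m opmx h = 1%:M.
  transitivity (opmx id); [symmetry|]; apply: opmx_uniq => v; last by rewrite mulmx1.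
  by rewrite -{1}[v]fK (opmxE lh) (opmxE lf) mulmxA.
move=> x y; rewrite /killing !E.
rewrite !mulmxA mxtrace_mulC !mulmxA fh mul1mx.
by rewrite -!mulmxA [opmx f *m (_ *m _)]mulmxA fh mul1mx.
Qed.

Section Nonzero.
Variables (h : g).
Let A := lie h.
Let lA : linear A := lie_linear_r h.

Lemma triangular_coords : (0 < d)%N -> exists Q : 'M[K]_d, exists T : 'M[K]_d,
  [/\ Q \in unitmx, is_trig_mx T & opmx A = invmx Q *m T *m Q].
Proof.
move=> d0; have [P Pu] := Schur (opmx A) d0.
move=> tT; have uP := unitarymx_unit Pu; exists P, (conjmx P (opmx A)); split=> //.
by rewrite conjumx // !mulmxA mulVmx // mul1mx -mulmxA mulVmx // mulmx1.
Qed.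

Lemma trig_mul n (S T : 'M[K]_n) : is_trig_mx S -> is_trig_mx T ->
  is_trig_mx (S *m T) /\ forall i, (S *m T) i i = S i i * T i i.
Proof.
move=> /is_trig_mxP S0 /is_trig_mxP T0; split.
  apply/is_trig_mxP => i j ij; rewrite mxE big1 // => k _.
  have [ik|ki] := ltnP i k; first by rewrite S0 // mul0r.
  by rewrite T0 ?mulr0 // (leq_ltn_trans ki).
move=> i; rewrite mxE (bigD1 i) //= big1 ?addr0 // => k ki.
have [ik|] := ltnP i k; first by rewrite S0 // mul0r.
rewrite leq_eqVlt => /orP[/eqP/val_inj E|ki']; first by rewrite E eqxx in ki.
by rewrite T0 ?mulr0.
Qed.

Lemma trig_pact (Q T : 'M[K]_d) : Q \in unitmx -> is_trig_mx T ->
  opmx A = invmx Q *m T *m Q -> forall p,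
  is_trig_mx (Q *m opmx (pact A p) *m invmx Q) /\
  forall i, (Q *m opmx (pact A p) *m invmx Q) i i = p.[T i i].
Proof.
move=> uQ tT EA; elim/poly_ind => [|p c [tp dp]].
  have -> : opmx (pact A 0) = 0 by apply: opmx_uniq => v; rewrite pact0 linear0 mulmx0.
  rewrite mulmx0 mul0mx; split=> [|i]; last by rewrite mxE horner0.
  by apply/is_trig_mxP => i j _; rewrite mxE.
have -> : opmx (pact A (p * 'X + c%:P)) = opmx A *m opmx (pact A p) + c%:M.
  apply: opmx_uniq => v; rewrite pactD pactMX pactC linearD linearZ /=.
  by rewrite (opmxE (pact_lin lA p)) (opmxE lA) mulmxDr mul_mx_scalar mulmxA.
rewrite mulmxDr mulmxDl.
have -> : Q *m c%:M *m invmx Q = c%:M.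
  by rewrite mul_mx_scalar -scalemxAl mulmxV // scalemx1.
have -> : Q *m (opmx A *m opmx (pact A p)) *m invmx Q = T *m (Q *m opmx (pact A p) *m invmx Q).
  by rewrite EA !mulmxA mulmxV // mul1mx.
have [tm dm] := trig_mul tT tp.
split=> [|i].
  apply/is_trig_mxP => i j ij; rewrite mxE (is_trig_mxP tm) // mxE.
  by rewrite -val_eqE (ltn_eqF ij) mulr0n addr0.
by rewrite mxE dm dp [c%:M _ _]mxE eqxx mulr1n hornerMXaddC mulrC.
Qed.

(** Let P act on the generalised eigenspace of ad h for c as the conjugate of c. It is a
    polynomial in ad h, and it is a derivation because conjugation is additive. As in
    the proof of the criterion of Cartan, P will detect nonzero eigenvalues of ad h. *)
Lemma conj_derivation (x0 : g) : x0 != 0 -> exists p, exists Q T : 'M[K]_d,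
  [/\ Q \in unitmx, is_trig_mx T, opmx A = invmx Q *m T *m Q,
    (forall u v, pact A p {[u, v]} = {[pact A p u, v]} + {[u, pact A p v]})
  & forall i, p.[T i i] = (T i i)^*].
Proof.
move=> x0n; have d0 : (0 < d)%N.
  rewrite lt0n; apply: contra_neq x0n => d0; rewrite -[x0]v2rK -[0](linear0 r2v).
  by congr r2v; apply/rowP => i; have := ltn_ord i; rewrite {2}d0.
have [Q [T [uQ tT EA]]] := triangular_coords d0.
pose t := [seq T i i | i <- enum 'I_d]; have st : size t = d by rewrite size_map size_enum_ord.
pose s := undup (t ++ [seq a + b | a <- t, b <- t]).
(* brackets of generalised eigenvectors have sums of eigenvalues and of exponents *)
have [p Hp] := interpolation Num.conj_op (d + d) (undup_uniq (t ++ [seq a + b | a <- t, b <- t])).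
have ts i : T i i \in t by apply/mapP; exists i => //; rewrite mem_enum.
have t_s : {subset t <= s} by move=> a at_; rewrite mem_undup mem_cat at_.
exists p, Q, T; split=> // [u v|i]; last first.
  have := Hp _ (t_s _ (ts i)); set q := p - _ => dq.
  have : root q (T i i).
    rewrite -dvdp_XsubCl; apply: dvdp_trans dq.
    have dvdX (r : {poly K}) N : (0 < N)%N -> r %| r ^+ N.
      by case: N => // N _; rewrite exprS dvdp_mulIl.
    by apply: dvdX; rewrite addn_gt0 d0.
  by rewrite /root /q hornerD hornerN hornerC subr_eq0 => /eqP.
have pP c w N : c \in s -> (N <= d + d)%N -> pact A (('X - c%:P) ^+ N) w = 0 ->
    pact A p w = c^* *: w.
  move=> cs Nd Hw; have := Hp _ cs => dq.
  have : pact A (p - (c^*)%:P) w = 0.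
    apply: (pact_modp lA) Hw; apply: dvdp_trans dq.
    by rewrite -(subnK Nd) addnC exprD dvdp_mulIl.
  by rewrite pactD -polyCN pactC scaleNr => /eqP; rewrite subr_eq0 => /eqP.
have kill w : pact A (\prod_(c <- undup t) ('X - c%:P) ^+ d) w = 0.
  apply: (@pact_modp _ _ _ lA _ (char_poly T)).
    rewrite char_poly_trig //.
    have -> : \prod_(i < d) ('X - (T i i)%:P) = \prod_(c <- t) ('X - c%:P).
      by rewrite big_map big_enum.
    by rewrite -st; apply: prod_XsubC_dvd => c; rewrite mem_undup.
  pose f w := v2r w *m invmx Q.
  have lf : linear f by move=> a y z; rewrite /f linearP mulmxDl scalemxAl.
  have Ef y : f (A y) = f y *m T.
    by rewrite /f (opmxE lA) EA !mulmxA mulmxK.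
  have : f (pact A (char_poly T) w) = 0.
    rewrite (@pact_transport _ _ _ A (fun v => v *m T) f _ _ lf Ef).
    exact: pact_char_poly.
  rewrite /f => /(congr1 (mulmx^~ Q)); rewrite mulmxKV // mul0mx.
  by move=> /(congr1 r2v); rewrite v2rK linear0.
have tT_sub : is_subspace (@setT g) by [].
apply: (@primary_ind _ _ _ lA setT (fun u => pact A p {[u, v]} =
  {[pact A p u, v]} + {[u, pact A p v]}) (undup t) d) (kill u) => //.
- by rewrite lie0l !pactv0 // !lie0l addr0.
- move=> u1 u2 E1 E2; rewrite lieDl !(linD (pact_lin lA p)) E1 E2 !lieDl.
  by rewrite -!addrA; congr (_ + _); rewrite addrCA.
- move=> c u1 ct _ Hu1.
  apply: (@primary_ind _ _ _ lA setT (fun v => pact A p {[u1, v]} =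
    {[pact A p u1, v]} + {[u1, pact A p v]}) (undup t) d) (kill v) => //.
  + by rewrite lie0r !pactv0 // !lie0r addr0.
  + move=> v1 v2 E1 E2; rewrite lieDr !(linD (pact_lin lA p)) E1 E2 !lieDr.
    by rewrite -!addrA; congr (_ + _); rewrite addrCA.
  + move=> e v1 et _ Hv1.
    rewrite (pP c u1 d) ?leq_addr //; last by apply: t_s; rewrite mem_undup in ct.
    rewrite (pP e v1 d) ?leq_addr //; last by apply: t_s; rewrite mem_undup in et.
    rewrite (pP (c + e) _ (d + d)%N) ?lie_gen_weight //.
      by rewrite lieZl lieZr rmorphD scalerDl.
    rewrite !mem_undup in ct et *; rewrite mem_cat; apply/orP; right.
    by apply/allpairsP; exists (c, e).
  + exact: undup_uniq.
- exact: undup_uniq.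
Qed.

End Nonzero.

Lemma subspace_vspace (S : set g) : is_subspace S ->
  exists U : {vspace g}, forall x, (x \in U) <-> S x.
Proof.
move=> HS; have fS : findim S.
  exists (vbasis {:g}) => x _.
  exists (\dim {:g}), (fun i => coord (vbasis {:g}) i x), (fun i => (vbasis {:g})`_i).
  split=> [i|]; last by rewrite -coord_vbasis ?memvf.
  by rewrite /= mem_nth // size_tuple.
have [e [b [Sb _ sb]]] := findim_basis HS fS.
exists <<[seq b i | i <- enum 'I_e]>>%VS => x; split=> [|/sb [u ->]].
  move=> /coord_span ->; apply: subsp_sum => // i _; apply: subspZ => //.
  have ie : (i < e)%N by rewrite -[X in (_ < X)%N](card_ord e); exact: ltn_ord.
  rewrite (nth_map (Ordinal ie)) ?size_enum_ord // -lincomb_delta.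
  exact: Sb.
rewrite /lincomb; apply: memv_suml => i _; apply: memvZ; apply: memv_span.
by apply/mapP; exists i => //; rewrite mem_enum.
Qed.

Lemma simple_ideal (S : set g) : lie_simple (fullv : {vspace g}) -> is_subspace S ->
  (forall x y, S y -> S {[x, y]}) -> (exists2 y, S y & y != 0) -> forall x, S x.
Proof.
move=> [_ _ Hs] HS Si [y Sy yn] x; have [U HU] := subspace_vspace HS.
have : lie_ideal_of fullv U.
  by split=> [|u v _ /HU Sv]; [exact: subvf|apply/HU; exact: Si].
move=> /Hs [U0|UT]; last by apply/HU; rewrite UT memvf.
by move/HU: Sy; rewrite U0 memv0 (negbTE yn).
Qed.

Lemma simple_perfect : lie_simple (fullv : {vspace g}) -> forall x,
  lspan [set w | exists y z : g, w = {[y, z]}] x.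
Proof.
move=> Hs; apply: (simple_ideal Hs (lspan_subspace _)) => [x y _|].
  by apply: lspan_in; exists x, y.
case: (Hs) => _ [x [y [_ _ xy]]] _; exists {[x, y]} => //.
by apply: lspan_in; exists x, y.
Qed.

(** Suppose that the Killing form is zero. As g = [g, g], [killing_der] gives tr (ad h
    P) = 0 for the derivation P of [conj_derivation]. This trace is the sum of the |c|^2
    over the eigenvalues c of ad h, one of which is a. *)
Lemma killing_neq0 : lie_simple (fullv : {vspace g}) -> forall h x a,
  x != 0 -> a != 0 -> {[h, x]} = a *: x -> exists u v, killing u v != 0.
Proof.
move=> Hs h x a xn an hx.
have lA := lie_linear_r h.
have [p [Q [T [uQ tT EA dP cP]]]] := conj_derivation h xn.
apply: contrapT => k0; have {}k0 u v : killing u v = 0.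
  by apply: contrapT => uv; apply: k0; exists u, v; apply/eqP.
have tr0 : \tr (opmx (lie h) *m opmx (pact (lie h) p)) = 0.
  have lP := pact_lin lA p.
  apply: (@lspan_ind _ _ _ (fun h' => \tr (opmx (lie h') *m opmx (pact (lie h) p)) = 0))
    (simple_perfect Hs h).
    split=> [|b u v E1 E2].
      have -> : opmx (lie 0) = 0 by apply: opmx_uniq => v; rewrite lie0l linear0 mulmx0.
      by rewrite mul0mx mxtrace0.
    by rewrite (opmx_lie_lin b u v) mulmxDl -scalemxAl linearP /= E1 E2 mulr0 addr0.
  by move=> _ [y [z ->]]; rewrite (killing_der _ _ lP dP) k0 oppr0.
have E : \tr (opmx (lie h) *m opmx (pact (lie h) p)) = \sum_i `|T i i| ^+ 2.
  have -> : \tr (opmx (lie h) *m opmx (pact (lie h) p)) =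
      \tr (T *m (Q *m opmx (pact (lie h) p) *m invmx Q)).
    by rewrite EA -!mulmxA [LHS]mxtrace_mulC !mulmxA.
  have [tp dp] := trig_pact uQ tT EA p.
  rewrite /mxtrace; apply: eq_bigr => i _.
  by have [_ ->] := trig_mul tT tp; rewrite dp cP normCK.
have Ti i : T i i = 0.
  apply/eqP; rewrite -normr_eq0 -sqrf_eq0; apply/eqP.
  move: tr0; rewrite E => /eqP; rewrite psumr_eq0 => [/allP H|j _]; last exact: exprn_ge0.
  by apply/eqP/H; rewrite mem_index_enum.
have : eigenvalue T a.
  apply/eigenvalueP; exists (v2r x *m invmx Q).
    have E' : invmx Q *m T = opmx (lie h) *m invmx Q by rewrite EA mulmxK.
    by rewrite -mulmxA E' mulmxA -(opmxE lA) hx linearZ /= scalemxAl.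
  apply: contraNneq xn => /(congr1 (mulmx^~ Q)); rewrite mulmxKV // mul0mx => E0.
  by rewrite -[x]v2rK E0 linear0.
rewrite eigenvalue_root_char char_poly_trig //.
have -> : \prod_(i < d) ('X - (T i i)%:P) = 'X ^+ d.
  by under eq_bigr do rewrite Ti subr0; rewrite prodr_const card_ord.
by rewrite /root hornerXn expf_eq0 (negbTE an) andbF.
Qed.

End Killing.

(** * The grading of g and its invariant form *)

Section DualBasis.
Variables (K : fieldType) (vT : vectType K).

Definition dual (c : 'I_(\dim {:vT}) -> K) : 'Hom(vT, K^o) :=
  \sum_i c i *: linfun (coord (vbasis {:vT}) i : vT -> K^o).

Lemma dualE c (i : 'I_(\dim {:vT})) : dual c (vbasis {:vT})`_i = c i.
Proof.
rewrite /dual sum_lfunE (bigD1 i) //= big1 => [|j ji].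
  rewrite scale_lfunE lfunE /= coord_free ?eqxx ?addr0; last exact: (basis_free (vbasisP _)).
  by rewrite /GRing.scale /= mulr1.
rewrite scale_lfunE lfunE /= coord_free; last exact: (basis_free (vbasisP _)).
by rewrite eq_sym (negbTE ji) scaler0.
Qed.

Lemma dual_separates (v : vT) : v != 0 -> exists a : 'Hom(vT, K^o), a v != 0.
Proof.
move=> vn; apply: contrapT => H; case/eqP: vn.
rewrite (coord_vbasis (memvf v)); apply: big1 => i _.
suff -> : coord (vbasis {:vT}) i v = 0 by rewrite scale0r.
apply: contrapT => c0; apply: H.
by exists (linfun (coord (vbasis {:vT}) i : vT -> K^o)); rewrite lfunE; apply/eqP.
Qed.

End DualBasis.

Lemma prim_expz1 (K : fieldType) (m : nat) (z : K) (k : int) :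
  m.-primitive_root z -> (z ^ k == 1) = (m %| k)%Z.
Proof.
move=> Hz; rewrite dvdzE /=; case: k => n.
  by rewrite -exprnP (prim_order_dvd Hz).
by rewrite NegzE -exprnN invr_eq1 (prim_order_dvd Hz) abszN.
Qed.

Section Graded.
Variables (K : numClosedFieldType) (D : datum K).
Hypothesis HD : standing_assumptions D.
Local Notation g := (gfin D).
Local Notation n := (nvar D).
Local Notation deg := 'rV[int]_n.+1.
Local Notation h0dual := 'Hom(subvs_of (h0 D), K^o).
Local Notation B := (@Defs.form K D).
Local Notation inG := (@in_Gamma K D).

Lemma m_gt0 i : (0 < @mord K D i)%N.
Proof. by case: (mP HD i). Qed.

Lemma xi_neq0 i : @xi K D i != 0.
Proof.
apply: contraTneq isT => E; have := prim_expr_order (xiP HD i).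
rewrite E expr0n; move: (m_gt0 i); case: (@mord K D i) => //= m _ /eqP.
by rewrite eq_sym oner_eq0.
Qed.

Lemma in_GammaD (r s : deg) : inG r -> inG s -> inG (r + s).
Proof. by move=> Hr Hs i; rewrite mxE; exact: (rpredD (Hr i) (Hs i)). Qed.

Lemma in_GammaN (r : deg) : inG r -> inG (- r).
Proof. by move=> Hr i; rewrite mxE; rewrite -mulN1r; exact: (dvdz_mull (-1) (Hr i)). Qed.

Lemma in_GammaB (r s : deg) : inG r -> inG s -> inG (r - s).
Proof. by move=> Hr Hs; apply: in_GammaD => //; apply: in_GammaN. Qed.

Lemma in_Gamma0 : inG 0.
Proof. by move=> i; rewrite mxE; exact: dvdz0. Qed.

Lemma gdegZ (k : deg) a x : x \in gdeg k -> a *: x \in gdeg k.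
Proof. exact: memvZ. Qed.

Lemma gdeg_shift (k r : deg) x : inG r -> x \in gdeg k -> x \in gdeg (k + r).
Proof.
move=> Hr /gdegP Hx; apply/gdegP => i; rewrite mxE Hx expfzDr ?xi_neq0 //.
have /eqP -> : xi i ^ r 0 i == 1 by rewrite (prim_expz1 _ (xiP HD i)); exact: Hr.
by rewrite mulr1.
Qed.

Lemma gdeg_lie (k l : deg) x y : x \in gdeg k -> y \in gdeg l -> {[x, y]} \in gdeg (k + l).
Proof.
move=> /gdegP Hx /gdegP Hy; apply/gdegP => i.
have [_ ->] := sigmaP HD i; rewrite Hx Hy lieZl lieZr scalerA mxE expfzDr //.
exact: xi_neq0.
Qed.

Lemma sigma_lin i : linear (@sigma K D i). Proof. by move=> a u v; rewrite linearP. Qed.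

(** The sigma_i commute and have finite order, so they are simultaneously
    diagonalizable. They are treated one after the other: the first t of them already
    act by scalars. *)
Lemma gdeg_ind (P : g -> Prop) : P 0 -> (forall x y, P x -> P y -> P (x + y)) ->
  (forall k x, x \in gdeg (k : deg) -> P x) -> forall x, P x.
Proof.
move=> P0 PD Pk.
suff H : forall u t, (t + u)%N = n.+1 -> forall (k : deg) x,
    (forall i : 'I_n.+1, (i < t)%N -> sigma i x = xi i ^ k 0 i *: x) -> P x.
  by move=> x; apply: (H n.+1 0%N _ 0).
elim=> [|u IH] t E k x Hx.
  by apply: (Pk k); apply/gdegP => i; apply: Hx; rewrite -[t]addn0 E.
have tn : (t < n.+1)%N by rewrite -E addnS ltnS leq_addr.
pose i0 := Ordinal tn; have ls := sigma_lin i0.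
pose S : set g := [set y | forall i : 'I_n.+1, (i < t)%N -> sigma i y = xi i ^ k 0 i *: y].
have HS : is_subspace S.
  split=> [i _|a y z Sy Sz i it]; first by rewrite linear0 scaler0.
  by rewrite (sigma_lin i a y z) Sy // Sz // scalerDr !scalerA mulrC.
apply: (@primary_ind _ _ _ ls S P [seq xi i0 ^+ j | j <- iota 0 (@mord K D i0)] 1 HS) => //.
- by move=> y Sy i it; rewrite (sigmaC HD) (Sy i it) (linZ ls).
- move=> c y /mapP [j _ ->] Sy; rewrite expr1 pactXsubC // => /eqP.
  rewrite subr_eq0 => /eqP Ey.
  pose k' : deg := \row_i (if i == i0 then j%:Z else k 0 i).
  apply: (IH t.+1 _ k'); first by rewrite addSnnS.
  move=> i; rewrite ltnS leq_eqVlt mxE => /orP[/eqP/(@val_inj _ _ _ i i0) ->|it].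
    by rewrite eqxx Ey.
  by rewrite -val_eqE /= (ltn_eqF it) Sy.
- rewrite map_inj_in_uniq ?iota_uniq // => a b; rewrite !mem_iota /= !add0n => Ha Hb.
  by move=> /eqP; rewrite (eq_prim_root_expr (xiP HD i0)) !modn_small // => /eqP.
- rewrite big_map; under eq_bigr do rewrite expr1.
  have -> : \prod_(j <- iota 0 (@mord K D i0)) ('X - (xi i0 ^+ j)%:P) = 'X^(@mord K D i0) - 1.
    by rewrite -(factor_Xn_sub_1 (xiP HD i0)) /index_iota subn0.
  rewrite pactD pactXn //; have -> : (-1 : {poly K}) = (-1)%:P by rewrite polyCN.
  rewrite pactC scaleN1r.
  have -> : iter (@mord K D i0) (pact (sigma i0) 'X) x = iter (@mord K D i0) (sigma i0) x.
    by apply: eq_iter => y; rewrite -['X]mul1r pactMX pact1.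
  by have [_ -> _] := mP HD i0; rewrite subrr.
Qed.

Lemma bformDl x y z : B (x + y) z = B x z + B y z.
Proof. by case: (formP HD) => /(_ 1 x y z); rewrite scale1r mul1r. Qed.
Lemma bform0l z : B 0 z = 0.
Proof. by case: (formP HD) => /(_ (-1) 0 0 z); rewrite scaler0 addr0 mulN1r addNr. Qed.
Lemma bformZl a x z : B (a *: x) z = a * B x z.
Proof. by case: (formP HD) => /(_ a x 0 z); rewrite addr0 bform0l addr0. Qed.
Lemma bformC x y : B x y = B y x. Proof. by case: (formP HD). Qed.
Lemma bformDr x y z : B x (y + z) = B x y + B x z.
Proof. by rewrite ![B x _]bformC bformDl. Qed.
Lemma bformZr a x z : B x (a *: z) = a * B x z.
Proof. by rewrite ![B x _]bformC bformZl. Qed.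
Lemma bform0r z : B z 0 = 0. Proof. by rewrite bformC bform0l. Qed.
Lemma form_inv x y z : B {[x, y]} z = B x {[y, z]}. Proof. by case: (formP HD). Qed.
Lemma form_nondeg x : (forall y, B x y = 0) -> x = 0.
Proof. by case: (formP HD) => _ _ _; apply. Qed.

Lemma h0_sub x : x \in h0 D -> x \in gdeg (0 : deg).
Proof. by case: (h0_cartan HD) => /subvP H _ _ _; exact: H. Qed.

Lemma h0_neq0 : exists h : subvs_of (h0 D), h != 0.
Proof.
apply: contrapT => N; have h00 x : x \in h0 D -> x = 0.
  move=> xh; apply/eqP; apply: contrapT => /negP xn; apply: N.
  exists (vsproj (h0 D) x); apply: contra_neq xn => E.
  by rewrite -(vsprojK xh) E linear0.
case: (h0_cartan HD) => _ _ _ Hc.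
case: (g00_simple HD) => _ [x [y [xS yS /eqP xy]]] _; apply: xy.
rewrite (h00 x) ?lie0l //; apply: Hc => // h /h00 ->; rewrite lie0r; exact: mem0v.
Qed.

Lemma exists_simple_root : exists i : 'I_(rank0 D), True.
Proof.
have [h hn] := h0_neq0; have [a ah] := dual_separates hn.
case: (simple_rootP HD) => bs _ _.
case: (posnP (rank0 D)) => [r0|r0]; last by exists (Ordinal r0).
have : a \in (fullv : {vspace h0dual}) by exact: memvf.
rewrite -(span_basis bs); have -> : (simple_root D : seq _) = [::].
  by apply: size0nil; rewrite size_tuple.
by rewrite span_nil memv0 => /eqP a0; rewrite a0 lfunE eqxx in ah.
Qed.

(** Lemma of Schur: some combination [killing - c B] is degenerate and its radical is an
    ideal. The Killing form is nonzero because a root vector is an eigenvector of some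
    ad h with a nonzero eigenvalue. *)
Lemma form_killing : exists2 c, c != 0 & forall x y, killing x y = c * B x y.
Proof.
have [i _] := exists_simple_root.
case: (simple_rootP HD) => _ /(_ i) + _; set a := tnth _ _ => -[an [x xn [_ wx]]].
have [h ah] : exists h, a h != 0.
  apply: contrapT => N; case/eqP: an; apply/lfunP => h; rewrite lfunE /=.
  by apply: contrapT => /eqP ah; apply: N; exists h.
have [u [v kuv]] := killing_neq0 (g_simple HD) xn ah (wx h).
pose b := vbasis (fullv : {vspace g}).
have sub_g : is_subspace (@setT g) by [].
have fg : findim (@setT g).
  exists b => x' _.
  exists (\dim {:g}), (fun i => coord b i x'), (fun i => b`_i).
  split=> [j|]; last by rewrite -coord_vbasis ?memvf.
  by rewrite /= mem_nth // size_tuple.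
pose d := \dim {:g}.
pose W := 'rV[K]_d.
pose fk (x : g) : W := \row_j killing x b`_j.
pose fb (x : g) : W := \row_j B x b`_j.
have lk : linear fk by move=> c y z; apply/rowP => j; rewrite !mxE killing_lin.
have lb : linear fb by move=> c y z; apply/rowP => j; rewrite !mxE bformDl bformZl.
have fbE x' w : B x' w = \sum_j coord b j w * fb x' 0 j.
  rewrite {1}(coord_vbasis (memvf w)) bformC; elim/big_rec2: _ => [|j p q _ <-].
    by rewrite bform0l.
  by rewrite bformDl bformZl mxE bformC.
have fkE x' w : killing x' w = \sum_j coord b j w * fk x' 0 j.
  rewrite {1}(coord_vbasis (memvf w)) killingC; elim/big_rec2: _ => [|j p q _ <-].
    by rewrite killing0l.
  by rewrite killing_lin mxE killingC.
have subW : is_subspace (@setT W) by [].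
have fW : findim (@setT W).
  exists [seq delta_mx 0 j | j <- enum 'I_d] => w _; rewrite [w]row_sum_delta.
  exists d, (fun j => w 0 j), (fun j => delta_mx 0 j); split=> // j.
  by apply/mapP; exists j; rewrite // mem_enum.
have injb w : fb w = 0 -> w = 0.
  move=> fw; apply: form_nondeg => y; rewrite fbE fw; apply: big1 => j _.
  by rewrite mxE mulr0.
pose rb (w : W) : g := \sum_j w 0 j *: b`_j.
have lrb : linear rb.
  move=> c y z; rewrite /rb scaler_sumr -big_split; apply: eq_bigr => j _ /=.
  by rewrite !mxE scalerDl scalerA.
have irb w : rb w = 0 -> w = 0.
  move=> w0; apply/rowP => j; rewrite mxE.
  have fb1 : free b by exact: (basis_free (vbasisP _)).
  by move/freeP: fb1 => /(_ (fun k => w 0 k) w0 j).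
have surb w : exists2 v, setT v & fb v = w.
  by apply: (@inj_inj_surj _ _ _ setT setT sub_g subW fg fW fb rb lb lrb _ _ _ _ w) => // y _;
    [exact: injb|exact: irb].
have [c [w [_ wn Ew]]] : exists c v, [/\ setT v, v != 0 & fk v = c *: fb v].
  apply: (@pencil_singular _ _ _ setT setT sub_g subW fg fW fk fb
    (linear_onW lk) (linear_onW lb)) => //.
  - by exists x.
  - by move=> y _; exact: injb.
have all_c y z : killing y z = c * B y z.
  move: z; apply: (@simple_ideal _ _ [set y | forall z, killing y z = c * B y z] (g_simple HD)).
  - split=> [z|e y1 y2 H1 H2 z].
      by rewrite bform0l mulr0 killing0l.
    by rewrite killing_lin bformDl bformZl H1 H2 mulrDr mulrCA.
  - move=> y1 y2 H z; rewrite lieC -scaleN1r bformZl killingZl.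
    by rewrite killing_inv H form_inv mulrCA.
  - exists w => // z; rewrite fkE fbE mulr_sumr; apply: eq_bigr => j _.
    by rewrite Ew mxE mulrCA.
exists c => //; apply: contra_neq kuv => c0; by rewrite all_c c0 mul0r.
Qed.

(** The Killing form is invariant under automorphisms, hence so is its multiple B. *)
Lemma form_sigma i x y : B (sigma i x) (sigma i y) = B x y.
Proof.
have [c cn E] := form_killing; apply: (mulfI cn); rewrite -!E.
have [[h sK hK] sM] := sigmaP HD i.
exact: (killing_aut (sigma_lin i) sK hK sM).
Qed.

Lemma form_graded (k l : deg) x y : x \in gdeg k -> y \in gdeg l -> B x y != 0 ->
  inG (k + l).
Proof.
move=> /gdegP Hx /gdegP Hy Bn i.
rewrite -[dvdz _ _]/(_ %| _)%Z -(prim_expz1 _ (xiP HD i)) mxE expfzDr ?xi_neq0 //.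
apply/eqP/(mulIf Bn); rewrite mul1r -[RHS](form_sigma i) Hx Hy bformZl bformZr.
by rewrite mulrA.
Qed.

End Graded.

(** * Semisimple operators and sl2 *)

Section Semisimple.
Variables (K : fieldType) (V : lmodType K) (A : V -> V).
Hypothesis lA : linear A.

Lemma prod_XsubC_uniq_dvd (s : seq K) (p : {poly K}) : uniq s ->
  {in s, forall c, root p c} -> \prod_(c <- s) ('X - c%:P) %| p.
Proof.
move=> us Hs; have [q ->] : exists q, p = q * \prod_(c <- s) ('X - c%:P).
  by apply: uniq_roots_prod_XsubC; [apply/allP|rewrite uniq_rootsE].
exact: dvdp_mulIr.
Qed.

Lemma eigensum_annih (Q : K -> Prop) v :
  lspan [set u | exists2 c, Q c & A u = c *: u] v ->
  exists s : seq K, [/\ uniq s, forall c, c \in s -> Q c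
    & pact A (\prod_(c <- s) ('X - c%:P)) v = 0].
Proof.
apply: (@lspan_ind _ _ _ (fun v => exists s : seq K, [/\ uniq s,
  forall c, c \in s -> Q c & pact A (\prod_(c <- s) ('X - c%:P)) v = 0])) => [|w [c Qc Ew]].
  split; first by exists [::]; split=> //; rewrite pactv0.
  move=> a u w [s [us Qs Hs]] [t [ut Qt Ht]]; exists (undup (s ++ t)); split.
  - exact: undup_uniq.
  - by move=> c; rewrite mem_undup mem_cat => /orP[/Qs|/Qt].
  rewrite (linD (pact_lin lA _)) (linZ (pact_lin lA _)).
  rewrite !(@pact_modp _ _ _ lA _ _ _ _ Hs) ?(@pact_modp _ _ _ lA _ _ _ _ Ht) ?scaler0 ?addr0 //.
    apply: prod_XsubC_uniq_dvd => // c cs.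
    by rewrite root_prod_XsubC mem_undup mem_cat cs orbT.
  apply: prod_XsubC_uniq_dvd => // c cs.
  by rewrite root_prod_XsubC mem_undup mem_cat cs.
exists [:: c]; split=> // [e|]; first by rewrite inE => /eqP ->.
by rewrite big_seq1 pactXsubC // Ew subrr.
Qed.

Lemma eigen_indep e v : lspan [set u | exists2 c, c != e & A u = c *: u] v ->
  A v = e *: v -> v = 0.
Proof.
move=> /eigensum_annih [s [_ Qs Hs]] Ev; move: Hs; rewrite (pact_eigen lA Ev).
move/eqP; rewrite scaler_eq0 => /orP[|/eqP //].
rewrite -[_ == 0]/(root _ e) root_prod_XsubC => /Qs; by rewrite eqxx.
Qed.

Hypothesis ssA : forall v, lspan [set u | exists c, A u = c *: u] v.

Lemma semisimple_annih v : exists2 s : seq K, uniq s &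
  pact A (\prod_(c <- s) ('X - c%:P)) v = 0.
Proof.
have [s [us _ Hs]] : exists s : seq K, [/\ uniq s, forall c, c \in s -> True
    & pact A (\prod_(c <- s) ('X - c%:P)) v = 0].
  apply: eigensum_annih; apply: lspan_mono (ssA v) => u [c Ec]; by exists c.
by exists s.
Qed.

(** The vector w is annihilated by a polynomial with simple roots. *)
Lemma semisimple_gen_eigen c N w : pact A (('X - c%:P) ^+ N) w = 0 -> A w = c *: w.
Proof.
move=> Hw; have [s us Hs] := semisimple_annih w.
pose s' := [seq e <- s | e != c].
have Hs' : pact A (\prod_(e <- s') ('X - e%:P)) (A w - c *: w) = 0.
  rewrite -pactXsubC // -pactM //; apply: (pact_modp lA) Hs.
  apply: prod_XsubC_uniq_dvd => // e es; rewrite rootM root_prod_XsubC root_XsubC.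
  by rewrite mem_filter es andbT; case: eqP.
apply/eqP; rewrite -subr_eq0; apply/eqP.
apply: (@pact_coprime0 _ _ _ lA _ (('X - c%:P) ^+ N) _ _ Hs').
  by apply: coprimep_expr; rewrite coprimep_XsubC root_prod_XsubC mem_filter eqxx.
by rewrite -pactXsubC // pactMC // Hw pactv0.
Qed.

Lemma eigen_ind (S : set V) (P : V -> Prop) : is_subspace S ->
  (forall v, S v -> S (A v)) -> P 0 -> (forall u v, P u -> P v -> P (u + v)) ->
  (forall c v, S v -> A v = c *: v -> P v) -> forall v, S v -> P v.
Proof.
move=> HS SA P0 PD Pc v Sv; have [s us Hs] := semisimple_annih v.
apply: (@primary_ind _ _ _ lA S P s 1 HS SA P0 PD _ us v Sv).
  by move=> c w _ Sw; rewrite expr1 pactXsubC // => /eqP; rewrite subr_eq0 => /eqP; apply: Pc.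
by under eq_bigr do rewrite expr1.
Qed.

End Semisimple.

(** For t = 1 these are the relations of sl2 with H the coroot. The case t = 0, where H
    commutes with e and f, has to be excluded for the root vectors of g(0,0). *)
Section SL2.
Variables (K : numFieldType) (V : lmodType K) (e f H : V -> V) (t : K).
Hypotheses (le : linear e) (lf : linear f) (lH : linear H).
Hypothesis ef : forall v, e (f v) = f (e v) + H v.
Hypothesis He : forall v, H (e v) = e (H v) + (2 * t) *: e v.
Hypothesis Hf : forall v, H (f v) = f (H v) - (2 * t) *: f v.

Lemma H_iter_e q c v : H v = c *: v -> H (iter q e v) = (c + 2 * t * q%:R) *: iter q e v.
Proof.
move=> Hv; elim: q => [|q IH] /=; first by rewrite mulr0 addr0.
by rewrite He IH (linZ le) -scalerDl -natr1; congr (_ *: _); ring.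
Qed.

Lemma H_iter_f q c v : H v = c *: v -> H (iter q f v) = (c - 2 * t * q%:R) *: iter q f v.
Proof.
move=> Hv; elim: q => [|q IH] /=; first by rewrite mulr0 subr0.
by rewrite Hf IH (linZ lf) -scalerBl -natr1; congr (_ *: _); ring.
Qed.

Lemma e_iter_f q c v : H v = c *: v -> 
  e (iter q.+1 f v) = iter q.+1 f (e v) + (q.+1%:R * (c - t * q%:R)) *: iter q f v.
Proof.
move=> Hv; elim: q => [|q IH].
  by rewrite /= ef Hv; congr (_ + _ *: _); ring.
rewrite [iter q.+2 f v]/= -/(iter q.+1 f v) ef IH (H_iter_f _ Hv) (linD lf) (linZ lf).
rewrite -addrA; congr (_ + _); rewrite -[f (iter q f v)]/(iter q.+1 f v) -scalerDl.
by congr (_ *: _); rewrite -!natr1; ring.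
Qed.

Hypothesis nf : forall v, exists N, iter N f v = 0.
Hypothesis ne : forall v, exists N, iter N e v = 0.

Lemma first_zero (k : V -> V) v : v != 0 -> (exists N, iter N k v = 0) ->
  exists2 N, iter N k v != 0 & iter N.+1 k v = 0.
Proof.
move=> vn [N0 HN0].
have exN : exists N, iter N k v == 0 by exists N0; rewrite HN0.
case: (ex_minnP exN) => [[|N]] HN Nmin; first by rewrite /= (negbTE vn) in HN.
exists N; last exact/eqP.
by apply: contraTneq isT => /eqP /Nmin; rewrite ltnn.
Qed.

(** If f^q w is the last nonzero power, then e f^(q+1) w = 0 gives c = t q. *)
Lemma highest_weight w c : w != 0 -> e w = 0 -> H w = c *: w ->
  exists q : nat, c = t * q%:R.
Proof.
move=> wn ew Hw; have [q qn q0] := first_zero wn (nf w).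
exists q; have := e_iter_f q Hw.
have z0 : iter q.+1 f 0 = 0 by rewrite (lin0 (lin_iter q.+1 lf)).
rewrite q0 ew (lin0 le) z0 add0r => /eqP.
rewrite eq_sym scaler_eq0 (negbTE qn) orbF mulf_eq0 pnatr_eq0 /= subr_eq0.
by move/eqP.
Qed.

(** The last nonzero vector e^p v is a highest weight vector. *)
Lemma weight_int v c : v != 0 -> H v = c *: v -> exists q p : nat, c = t * (q%:R - 2 * p%:R).
Proof.
move=> vn Hv; have [p pn p0] := first_zero vn (ne v).
have [q Eq] := highest_weight pn p0 (H_iter_e p Hv).
by exists q, p; apply: (addIr (2 * t * p%:R)); rewrite Eq; ring.
Qed.

Hypothesis t1 : t = 1.

(** Induction on the length of the chain v, e v, e^2 v, and so on. If f^N v = 0, the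
    vector e v has weight N + 2 and f^(N+2) e v = 0, so e v = 0 by induction; then e^N
    f^N v is a nonzero multiple of v. *)
Lemma f_iter_inj N v : H v = N%:R *: v -> iter N f v = 0 -> v = 0.
Proof.
have [p] := ne v; elim: p N v => [|p IH] N v //=; rewrite -iterS iterSr => pv Hv fv.
have ev0 : e v = 0.
  apply: (IH N.+2 (e v)) => //.
    rewrite He Hv (linZ le) -scalerDl t1 mulr1; congr (_ *: _).
    by rewrite -[N.+2]addn2 natrD.
  have := e_iter_f N.+1 Hv.
  have z2 : iter N.+2 f v = 0 by rewrite -[N.+2]addn2 addnC iterD fv (lin0 (lin_iter _ lf)).
  have z1 : iter N.+1 f v = 0 by rewrite iterS fv (lin0 lf).
  by rewrite z2 z1 scaler0 addr0 (lin0 le) => <-.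
have key j : (j <= N)%N ->
    exists2 b : K, b != 0 & iter j e (iter N f v) = b *: iter (N - j) f v.
  elim: j => [|j IHj] jN; first by exists 1; rewrite ?oner_eq0 // subn0 scale1r.
  have [b bn Eb] := IHj (ltnW jN).
  have E : (N - j = (N - j.+1).+1)%N by rewrite subnSK.
  have z0 : iter (N - j.+1).+1 f 0 = 0 by rewrite (lin0 (lin_iter _ lf)).
  exists (b * ((N - j.+1).+1%:R * (N%:R - t * (N - j.+1)%:R))).
    rewrite mulf_neq0 // mulf_neq0 ?pnatr_eq0 // t1 mul1r -natrB ?leq_subr //.
    by rewrite pnatr_eq0 subKn.
  by rewrite iterS Eb (linZ le) E (e_iter_f _ Hv) ev0 z0 add0r scalerA.
have [b bn Eb] := key N (leqnn N); move/eqP: Eb.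
rewrite fv (lin0 (lin_iter _ le)) subnn eq_sym scaler_eq0 (negbTE bn) /=.
by move/eqP.
Qed.

End SL2.

(** * The action of the loop algebra on V *)

(** Cayley-Hamilton for ad h. *)
Lemma primary_annih (K : numClosedFieldType) (g : finLieType K) (h : g) :
  exists s : seq K, exists N, uniq s /\
    forall x, pact (lie h) (\prod_(c <- s) ('X - c%:P) ^+ N) x = 0.
Proof.
have lA := lie_linear_r h; set A := lie h.
have [r Er] := closed_field_poly_normal (char_poly (opmx A)).
exists (undup r), (size r); split=> [|x]; first exact: undup_uniq.
apply: (@pact_modp _ _ _ lA _ (char_poly (opmx A))).
  rewrite Er (monicP (char_poly_monic _)) scale1r.
  by apply: prod_XsubC_dvd => c; rewrite mem_undup.
apply: (can_inj v2rK); rewrite [RHS]linear0.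
rewrite (@pact_transport _ _ _ A (fun v => v *m opmx A)); first exact: pact_char_poly.
  by move=> a u v; rewrite linearP.
exact: opmxE.
Qed.

Section Module.
Variables (K : numClosedFieldType) (D : datum K).
Variables (V : lmodType K) (rho : tau_sym D -> V -> V) (C0 : K).

(** The setting of the whole proof, over any numClosedFieldType. *)
Record level_module : Prop := {
  lm_std : standing_assumptions D;
  lm_mod : tau_module rho;
  lm_irr : irreducible_module (tau_ok D) rho setT;
  lm_int : integrable rho;
  lm_C0 : C0 != 0;
  lm_K0 : forall v, rho (tK 0 ord0) v = C0 *: v;
  lm_Ki : forall (i : 'I_(nvar D)) v, rho (tK 0 (lift ord0 i)) v = 0
}.

Hypothesis LM : level_module.
Let HD := lm_std LM.
Let HV := lm_mod LM.
Let Vint := lm_int LM.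
Let C0n := lm_C0 LM.
Let HK0 := lm_K0 LM.
Let HKi := lm_Ki LM.

Local Notation g := (gfin D).
Local Notation n := (nvar D).
Local Notation deg := 'rV[int]_n.+1.
Local Notation h0dual := 'Hom(subvs_of (h0 D), K^o).
Local Notation B := (@Defs.form K D).
Local Notation inG := (@in_Gamma K D).

Lemma rho_lin s : tau_ok D s -> linear (rho s). Proof. exact: tau_linear. Qed.
Lemma rhoX_lin k x : x \in gdeg (k : deg) -> linear (rho (tX k x)).
Proof. by move=> xk; apply: rho_lin. Qed.

Lemma rhoX0 (k : deg) v : rho (tX k 0) v = 0.
Proof.
have := tau_addX HV (-1) v (mem0v (gdeg k)) (mem0v (gdeg k)).
by rewrite scaler0 addr0 scaleN1r addNr.
Qed.

Lemma rhoXZ (k : deg) a x v : x \in gdeg k -> rho (tX k (a *: x)) v = a *: rho (tX k x) v.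
Proof.
move=> xk; have := tau_addX HV a v xk (mem0v (gdeg k)).
by rewrite addr0 rhoX0 addr0.
Qed.

Lemma rhoXD (k : deg) x y v : x \in gdeg k -> y \in gdeg k ->
  rho (tX k (x + y)) v = rho (tX k x) v + rho (tX k y) v.
Proof. by move=> xk yk; have := tau_addX HV 1 v xk yk; rewrite !scale1r. Qed.

Lemma rhoXX (k l : deg) x y v : x \in gdeg k -> y \in gdeg l ->
  rho (tX k x) (rho (tX l y) v) = rho (tX l y) (rho (tX k x) v)
    + (rho (tX (k + l) {[x, y]}) v + B x y *: rhoK rho k (k + l) v).
Proof.
move=> xk yl; rewrite -(tau_XX HV v xk yl) /bracket addrC subrK //.
Qed.

Lemma rhoK_at0 (k : deg) v : rhoK rho k 0 v = ((k 0 ord0)%:~R * C0) *: v.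
Proof.
rewrite /rhoK big_ord_recl HK0 scalerA big1 ?addr0 // => i _.
by rewrite HKi scaler0.
Qed.

Lemma rhoK_0 (k : deg) v : rhoK rho 0 k v = 0.
Proof. by rewrite /rhoK big1 // => i _; rewrite mxE scale0r. Qed.

(** For y in g(l) with B x y nonzero, the brackets of x(k + r) with y(- k - r) share the
    component [x, y](0), while their central part is (k_0 + r_0) B x y C_0. If the x(k +
    r) act as zero, the sums of both terms vanish, which is impossible for two values of
    r_0. *)
Lemma faithful (k : deg) x : x \in gdeg k ->
  (forall r, inG r -> forall v, rho (tX (k + r) x) v = 0) -> x = 0.
Proof.
have [v0 v0n] : exists v0 : V, v0 != 0.
  apply: contrapT => N; case: (lm_irr LM) => + _; apply; apply/seteqP; split=> // v _ /=.
  by apply/eqP; apply: contrapT => /negP vn; apply: N; exists v.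
move=> xk Hx; apply: (form_nondeg HD); apply: (gdeg_ind HD).
- exact: (bform0r HD).
- by move=> y z Hy Hz; rewrite (bformDr HD) Hy Hz addr0.
move=> l y yl; apply: contrapT => /eqP Bn.
have Gkl := form_graded HD xk yl Bn.
have key r : inG r -> rho (tX 0 {[x, y]}) v0 + (B x y * (((k + r) 0 ord0)%:~R * C0)) *: v0 = 0.
  move=> Gr; have yr : y \in gdeg (- (k + r) : deg).
    have -> : - (k + r) = l + (- (k + l) - r).
      by rewrite !opprD addrA [- k - l]addrC addrA subrr add0r.
    by apply: (gdeg_shift HD) => //; apply: in_GammaB => //; apply: in_GammaN.
  have xr : x \in gdeg (k + r) by apply: gdeg_shift.
  have := rhoXX v0 xr yr; rewrite !Hx // (lin0 (rhoX_lin yr)) subrr add0r.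
  by rewrite rhoK_at0 scalerA => <-.
pose r0 : deg := (@mord K D ord0)%:Z *: delta_mx 0 ord0.
have Gr0 : inG r0.
  move=> i; rewrite !mxE /=; have [->|_] := eqVneq i ord0.
    by rewrite mulr1; exact: dvdzz.
  by rewrite mulr0; exact: dvdz0.
have := key r0 Gr0; rewrite -[in RHS](key 0 (@in_Gamma0 _ D)) => /addrI /eqP.
rewrite -subr_eq0 -scalerBl scaler_eq0 (negbTE v0n) orbF -mulrBr -mulrBl.
rewrite !mulf_eq0 (negbTE Bn) (negbTE C0n) orbF /= !mxE /= mulr1 addr0.
rewrite intrD addrAC subrr add0r intr_eq0 eqz_nat.
by apply/negP; rewrite -lt0n; exact: (m_gt0 HD).
Qed.

Lemma H_lin (h : subvs_of (h0 D)) : linear (rho (tX 0 (vsval h))).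
Proof. by apply: rhoX_lin; apply: (h0_sub HD); exact: subvsP. Qed.

Lemma H_semisimple (h : subvs_of (h0 D)) v :
  lspan [set u | exists c, rho (tX 0 (vsval h)) u = c *: u] v.
Proof.
have : lspan [set v | exists lam, weight_space rho lam v] v by rewrite (weight_sum Vint).
by apply: lspan_mono => u [lam [Hh _ _]]; exists (lam.1.1 h).
Qed.

Lemma vsval0 (h : subvs_of (h0 D)) : vsval h \in gdeg (0 : deg).
Proof. by apply: (h0_sub HD); exact: subvsP. Qed.

Lemma rhoHX (h : subvs_of (h0 D)) (k : deg) x v : x \in gdeg k ->
  rho (tX 0 (vsval h)) (rho (tX k x) v) =
  rho (tX k x) (rho (tX 0 (vsval h)) v) + rho (tX k {[vsval h, x]}) v.
Proof.
by move=> xk; rewrite (rhoXX v (vsval0 h) xk) rhoK_0 scaler0 addr0 add0r.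
Qed.

Lemma gdeg_lieh (h : subvs_of (h0 D)) (k : deg) x : x \in gdeg k -> {[vsval h, x]} \in gdeg k.
Proof. by move=> xk; rewrite -[k]add0r; apply: (gdeg_lie HD) => //; exact: vsval0. Qed.

(** As h is diagonalizable on V, x(k) sends eigenvectors of h to generalised
    eigenvectors, which are again eigenvectors. Hence [h, x] - c x acts as zero on V,
    and [faithful] applies. *)
Lemma adh_gen_eigen (h : subvs_of (h0 D)) (k : deg) c N x : x \in gdeg k ->
  pact (lie (vsval h)) (('X - c%:P) ^+ N) x = 0 -> {[vsval h, x]} = c *: x.
Proof.
move=> xk Hx; have lh := H_lin h; have la := lie_linear_r (vsval h).
apply/eqP; rewrite -subr_eq0; apply/eqP.
have zk : {[vsval h, x]} - c *: x \in gdeg k.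
  by apply: memvB; [exact: gdeg_lieh|exact: memvZ].
apply: (faithful zk) => r Gr v; move: v (H_semisimple h v).
have xr : x \in gdeg (k + r) by exact: (gdeg_shift HD).
have zr : {[vsval h, x]} - c *: x \in gdeg (k + r) by exact: (gdeg_shift HD).
apply: (lspan_lin_sub (S := [set 0]) (rhoX_lin zr)).
  by split=> // a _ _ -> ->; rewrite scaler0 addr0.
move=> v [b Hv] /=.
have E y M : y \in gdeg (k + r) ->
    pact (rho (tX 0 (vsval h))) (('X - (c + b)%:P) ^+ M) (rho (tX (k + r) y) v) =
    rho (tX (k + r) (pact (lie (vsval h)) (('X - c%:P) ^+ M) y)) v.
  elim: M y => [|M IH] y yk; first by rewrite !expr0 !pact1.
  have yk' : {[vsval h, y]} - c *: y \in gdeg (k + r).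
    by apply: memvB; [exact: gdeg_lieh|exact: memvZ].
  rewrite !exprSr !pactM // !pactXsubC // -IH //; congr (pact _ _ _).
  rewrite rhoHX // Hv (linZ (rhoX_lin yk)) -!scaleNr addrC.
  rewrite (rhoXD v (gdeg_lieh h yk) (gdegZ (- c) yk)) (rhoXZ (- c) v yk).
  by rewrite addrA -scalerDl addrC opprD addrNK.
have := E x N xr; rewrite Hx rhoX0.
move/(semisimple_gen_eigen lh (H_semisimple h)).
rewrite rhoHX // Hv (linZ (rhoX_lin xr)) addrC scalerDl => /addIr Ex.
rewrite -scaleNr (rhoXD v (gdeg_lieh h xr) (gdegZ (- c) xr)) (rhoXZ (- c) v xr).
by rewrite Ex scaleNr subrr.
Qed.

(** A Cartan subalgebra is nilpotent, so ad h is nilpotent on it, hence zero by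
    [adh_gen_eigen]. *)
Lemma h0_abelian (h h' : subvs_of (h0 D)) : {[vsval h, vsval h']} = 0.
Proof.
case: (h0_cartan HD) => _ _ [N HN] _.
rewrite (@adh_gen_eigen h 0 0 N) ?scale0r ?vsval0 //.
have -> : ('X - 0%:P : {poly K}) = 'X by rewrite subr0.
rewrite pactXn; last exact: lie_linear_r.
rewrite -[RHS](HN (nseq N (vsval h)) (vsval h')) ?size_nseq //; last exact: subvsP.
  elim: (N) => //= M ->; rewrite -['X]mul1r pactMX ?pact1 //; exact: lie_linear_r.
by move=> y /nseqP [-> _]; exact: subvsP.
Qed.

(** Simultaneous diagonalization of h(0), one basis vector at a time. *)
Lemma gw_ind (k : deg) (P : g -> Prop) : P 0 -> (forall x y, P x -> P y -> P (x + y)) ->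
  (forall a x, gweight k a x -> P x) -> forall x, x \in gdeg k -> P x.
Proof.
move=> P0 PD Pa; pose b := vbasis {: subvs_of (h0 D)}; pose d := \dim {: subvs_of (h0 D)}.
suff H : forall u t, (t + u)%N = d -> forall (c : 'I_d -> K) x, x \in gdeg k ->
    (forall i : 'I_d, (i < t)%N -> {[vsval b`_i, x]} = c i *: x) -> P x.
  by move=> x xk; apply: (H d 0%N _ (fun=> 0)).
elim=> [|u IH] t E c x xk Hx.
  apply: (Pa (dual c)); split=> // h.
  have Hb (i : 'I_d) : {[vsval b`_i, x]} = c i *: x by apply: Hx; rewrite -[t]addn0 E.
  rewrite [in LHS](coord_vbasis (memvf h)) [in RHS](coord_vbasis (memvf h)).
  rewrite !linear_sum /= scaler_suml.
  rewrite (lin_sum (lie_linear_l x)); apply: eq_bigr => i _.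
  by rewrite !linearZ /= dualE lieZl Hb scalerA.
have td : (t < d)%N by rewrite -E addnS ltnS leq_addr.
pose i0 := Ordinal td; pose h := b`_i0; have lh := lie_linear_r (vsval h).
pose S : set g := [set y | y \in gdeg k /\
   forall i : 'I_d, (i < t)%N -> {[vsval b`_i, y]} = c i *: y].
have HS : is_subspace S.
  split=> [|a y z [yk Sy] [zk Sz]].
    by split=> [|i _]; rewrite ?mem0v // lie0r scaler0.
  split=> [|i it]; first by apply: memvD => //; exact: memvZ.
  by rewrite lieDr lieZr Sy // Sz // scalerDr !scalerA mulrC.
have [s [N [us Hs]]] := primary_annih (vsval h).
apply: (@primary_ind _ _ _ lh S P s N HS _ P0 PD _ us x) => //.
- move=> y [yk Sy]; split=> [|i it]; first exact: gdeg_lieh.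
  by rewrite lie_der h0_abelian lie0l add0r Sy // lieZr.
- move=> e y _ [yk Sy] /(adh_gen_eigen yk) Ey.
  pose c' (i : 'I_d) := if i == i0 then e else c i.
  apply: (IH t.+1 _ c') => //; first by rewrite addSnnS.
  move=> i; rewrite ltnS leq_eqVlt /c' => /orP[/eqP/(@val_inj _ _ _ i i0) ->|it].
    by rewrite eqxx.
  by rewrite -val_eqE /= (ltn_eqF it) Sy.
Qed.

Definition h0_eigen (a : h0dual) (x : g) :=
  forall h : subvs_of (h0 D), {[vsval h, x]} = a h *: x.

Lemma form_weight (a b : h0dual) x y :
  h0_eigen a x -> h0_eigen b y -> B x y != 0 -> b = - a.
Proof.
move=> Hx Hy Bn; apply/lfunP => h; rewrite opp_lfunE; apply/eqP.
have Ha : a h * B x y = B {[vsval h, x]} y by rewrite Hx (bformZl HD).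
have Hb : b h * B x y = B x {[vsval h, y]} by rewrite Hy (bformZr HD).
rewrite -addr_eq0; apply/eqP/(mulIf Bn); rewrite mul0r mulrDl Ha Hb.
by rewrite -(form_inv HD) -(bformDl HD) [{[x, _]}]lieC addNr (bform0l HD).
Qed.

(** The form is nondegenerate and pairs weights with their opposites. *)
Lemma form_pair (a : h0dual) x : h0_eigen a x -> x != 0 ->
  exists l y, gweight l (- a) y /\ B x y != 0.
Proof.
move=> wx xn; apply: contrapT => N; case/eqP: xn.
apply: (form_nondeg HD); apply: (gdeg_ind HD); first exact: (bform0r HD).
  by move=> y z Hy Hz; rewrite (bformDr HD) Hy Hz addr0.
move=> l; apply: gw_ind; first exact: (bform0r HD).
  by move=> y z Hy Hz; rewrite (bformDr HD) Hy Hz addr0.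
move=> b y wy; apply: contrapT => /eqP Bn; apply: N; exists l, y.
by rewrite -(form_weight wx (proj2 wy) Bn).
Qed.

Lemma centralizer_h0 x : x \in gdeg (0 : deg) ->
  (forall h : subvs_of (h0 D), {[vsval h, x]} = 0) -> x \in h0 D.
Proof.
move=> x0 Hx; case: (h0_cartan HD) => _ _ _; apply=> // h hh.
by rewrite lieC -(vsprojK hh) Hx oppr0 mem0v.
Qed.

(** A root vector e for a simple root a pairs with some f of weight - a, and h = [e, f]
    lies in h(0). If a h = 0, the integrability of the degenerate triple e, f, h forces
    h to act as zero on V. Then h is central in g by [faithful], although B h is
    nonzero. *)
Lemma sl2_exists : exists (a : h0dual) (e f : g) (h : subvs_of (h0 D)),
  [/\ gweight 0 a e, gweight 0 (- a) f, a != 0, {[e, f]} = vsval h & a h = 2 /\ B e f != 0].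
Proof.
have [i _] := exists_simple_root HD.
case: (simple_rootP HD) => _ /(_ i) + _; set a := tnth _ _ => -[an [e en we]].
have [l [f [[fl wf] Bn]]] := form_pair (proj2 we) en.
have Gl := form_graded HD (proj1 we) fl Bn.
have f0 : f \in gdeg (0 : deg).
  by rewrite -(subrr l) (gdeg_shift HD) //; apply: in_GammaN; rewrite add0r in Gl.
have e0 : e \in gdeg (0 : deg) by case: we.
have ha : {[e, f]} \in h0 D.
  apply: centralizer_h0 => [|h]; first by rewrite -[0]addr0; apply: (gdeg_lie HD).
  rewrite lie_der; case: we => _ ->; rewrite wf lieZl lieZr opp_lfunE.
  by rewrite scaleNr addrN.
pose h := vsproj (h0 D) {[e, f]}; have hE : vsval h = {[e, f]} by rewrite /h vsprojK.
suff ahn : a h != 0.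
  exists a, e, ((2 / a h) *: f), ((2 / a h) *: h); split=> //.
  - by split=> [|h']; [exact: memvZ|rewrite lieZr wf !scalerA mulrC].
  - by rewrite lieZr linearZ /= hE.
  - rewrite linearZ /= (bformZr HD) mulf_neq0 ?mulf_neq0 ?invr_eq0 ?pnatr_eq0 //.
    by split=> //; rewrite /GRing.scale /= divfK.
apply/eqP => ah0.
have le := rhoX_lin e0; have lf := rhoX_lin f0; have lh := H_lin h.
have an' : - a != 0 by rewrite oppr_eq0.
have ef v : rho (tX 0 e) (rho (tX 0 f) v) = rho (tX 0 f) (rho (tX 0 e) v) + rho (tX 0 (vsval h)) v.
  by rewrite (rhoXX v e0 f0) rhoK_0 scaler0 addr0 addr0 hE.
have He v : rho (tX 0 (vsval h)) (rho (tX 0 e) v) =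
    rho (tX 0 e) (rho (tX 0 (vsval h)) v) + (2 * 0) *: rho (tX 0 e) v.
  by rewrite rhoHX //; case: (we) => _ ->; rewrite ah0 scale0r rhoX0 mulr0 scale0r.
have Hf v : rho (tX 0 (vsval h)) (rho (tX 0 f) v) =
    rho (tX 0 f) (rho (tX 0 (vsval h)) v) - (2 * 0) *: rho (tX 0 f) v.
  by rewrite rhoHX // wf opp_lfunE ah0 oppr0 scale0r rhoX0 mulr0 scale0r subr0 addr0.
have ne v : exists N, iter N (rho (tX 0 e)) v = 0 by exact: (real_nilpotent Vint an we).
have nf v : exists N, iter N (rho (tX 0 f)) v = 0.
  by apply: (real_nilpotent Vint an') => //; split.
have H0 v : rho (tX 0 (vsval h)) v = 0.
  move: v (H_semisimple h v); apply: (lspan_lin_sub (S := [set 0]) lh).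
    by split=> // c _ _ -> ->; rewrite scaler0 addr0.
  move=> v [c Hv] /=; have [->|vn] := eqVneq v 0; first exact: (lin0 lh).
  have [q [p Ec]] := weight_int le lf ef He Hf nf ne vn Hv.
  by rewrite Hv Ec mul0r scale0r.
have hc x : {[vsval h, x]} = 0.
  move: x; apply: (gdeg_ind HD); first exact: lie0r.
    by move=> x y Hx Hy; rewrite lieDr Hx Hy addr0.
  move=> k x xk; apply: (faithful (gdeg_lieh h xk)) => r Gr v.
  have xr : x \in gdeg (k + r) by exact: (gdeg_shift HD).
  by have := rhoHX h v xr; rewrite !H0 (lin0 (rhoX_lin xr)) add0r => <-.
have [h' ah'] : exists h', a h' != 0.
  apply: contrapT => N; case/eqP: an; apply/lfunP => h'; rewrite lfunE /=.
  by apply: contrapT => /eqP ah'; apply: N; exists h'.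
have : B (vsval h) (vsval h') = a h' * B e f.
  rewrite hE (form_inv HD) lieC wf opp_lfunE scaleNr opprK (bformZr HD) //.
have -> : B (vsval h) (vsval h') = 0.
  apply: (@lspan_ind _ _ _ (fun y => B (vsval h) y = 0)) (simple_perfect (g_simple HD) (vsval h')).
    split=> [|c u w Hu Hw]; first exact: (bform0r HD).
    by rewrite (bformDr HD) (bformZr HD) Hu Hw mulr0 addr0.
  by move=> _ [y [z ->]]; rewrite -(form_inv HD) hc (bform0l HD).
by move/eqP; rewrite eq_sym mulf_eq0 (negbTE ah') (negbTE Bn).
Qed.

End Module.

(** * The height grading of tau *)

Section Grading.
Variables (K : numClosedFieldType) (D : datum K).
Variables (V : lmodType K) (rho : tau_sym D -> V -> V) (C0 : K).
Hypothesis LM : level_module rho C0.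
Let HD := lm_std LM.
Let C0n := lm_C0 LM.

Local Notation n := (nvar D).
Local Notation deg := 'rV[int]_n.+1.
Local Notation h0dual := 'Hom(subvs_of (h0 D), K^o).
Local Notation inG := (@in_Gamma K D).
Local Notation comb := (@simple_comb K D).

(** The simple roots are independent, so their values at h1 can be prescribed. *)
Lemma height_element : exists h1 : subvs_of (h0 D),
  forall i, tnth (simple_root D) i h1 = 1.
Proof.
case: (simple_rootP HD) => bs _ _; have fs := basis_free bs.
pose b := vbasis {: subvs_of (h0 D)}; pose d := \dim {: subvs_of (h0 D)}.
pose M : 'M[K]_(rank0 D, d) := \matrix_(i, j) (tnth (simple_root D) i b`_j).
have fM : row_free M.
  apply/inj_row_free => u uM; apply/rowP => i; rewrite mxE.
  have S0 : \sum_i u 0 i *: (simple_root D)`_i = 0.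
    apply/lfunP => h; rewrite [RHS]lfunE /= (coord_vbasis (memvf h)) linear_sum /=.
    apply: big1 => j _; rewrite linearZ /=.
    have -> : (\sum_i u 0 i *: (simple_root D)`_i) b`_j = (u *m M) 0 j.
      rewrite sum_lfunE mxE; apply: eq_bigr => k _; rewrite scale_lfunE mxE.
      by rewrite (tnth_nth 0).
    by rewrite uM mxE scaler0.
  by move/freeP: fs => /(_ (fun i => u 0 i) S0 i).
have [N MN] := row_freeP fM.
pose w : 'cV_d := N *m const_mx 1.
exists (\sum_j w j 0 *: b`_j) => i.
rewrite linear_sum /=; transitivity ((M *m w) i 0).
  rewrite mxE; apply: eq_bigr => j _; rewrite linearZ /= [M i j]mxE mulrC; by [].
by rewrite /w mulmxA MN mul1mx mxE.
Qed.

Variable h1 : subvs_of (h0 D).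
Hypothesis Hh1 : forall i, tnth (simple_root D) i h1 = 1.

Lemma comb_height c : comb c h1 = (\sum_i c i)%:R.
Proof.
rewrite /simple_comb sum_lfunE natr_sum; apply: eq_bigr => i _.
by rewrite scale_lfunE Hh1 /GRing.scale /= mulr1.
Qed.

Lemma comb0 c : (\sum_i c i)%N = 0%N -> comb c = 0.
Proof.
move=> /eqP; rewrite sum_nat_eq0 => /forallP H; apply: big1 => i _.
by rewrite (eqP (H i)) scale0r.
Qed.

Lemma combD c c' : comb c + comb c' = comb (fun i => (c i + c' i)%N).
Proof. by rewrite -big_split; apply: eq_bigr => i _ /=; rewrite natrD scalerDl. Qed.

Lemma combM j c : j%:R *: comb c = comb (fun i => (j * c i)%N).
Proof. by rewrite scaler_sumr; apply: eq_bigr => i _; rewrite scalerA natrM. Qed.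

Lemma en_comb (a : h0dual) : root0_en a -> exists c, a = comb c \/ a = - comb c.
Proof.
case: (simple_rootP HD) => _ _ Hc [/Hc //|[_ [b [/Hc [c [->|->]] _] ->]]].
  by exists (fun i => (2 * c i)%N); left; rewrite -combM.
by exists (fun i => (2 * c i)%N); right; rewrite -combM scalerN.
Qed.

Lemma weight_en (k : deg) (a : h0dual) x : gweight k a x -> x != 0 -> weight0_en a.
Proof. by move=> [_ wx] xn; apply/(h0_weights HD); exists x. Qed.

Lemma weight_en_opp (a : h0dual) : weight0_en a -> weight0_en (- a).
Proof.
move=> /(h0_weights HD) [x xn wx]; apply/(h0_weights HD).
have [l [y [[_ wy] Bn]]] := form_pair LM wx xn; exists y => //.
by apply: contra_neq Bn => ->; exact: (bform0r HD).
Qed.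

(** If the maximal root were negative, its difference with its opposite would have
    negative height. *)
Lemma beta0_comb : exists c, beta0 D = comb c.
Proof.
have [rb mb] := beta0P HD; have [c [|E]] := en_comb rb; first by exists c.
have [c' E'] : exists c', beta0 D - - beta0 D = comb c'.
  have [r|E0] : weight0_en (- beta0 D) by apply: weight_en_opp; left.
    exact: mb.
  have b0 : beta0 D = 0 by rewrite -[beta0 D]opprK E0 oppr0.
  exists (fun=> 0%N); rewrite E0 b0 subr0 comb0 //; by rewrite big1.
have := congr1 (fun f : h0dual => f h1) E'.
rewrite opprK add_lfunE E opp_lfunE !comb_height => Es.
have /comb0 c0 : (\sum_i c i)%N = 0%N.
  move/eqP: Es; rewrite -opprD -natrD eq_sym -addr_eq0 -natrD pnatr_eq0 !addn_eq0.
  by move=> /andP[_ /andP[/eqP]].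
by exists (fun=> 0%N); rewrite c0 oppr0 comb0 // big1.
Qed.

Lemma beta0_sub (a : h0dual) : weight0_en a -> exists c, beta0 D - a = comb c.
Proof.
move=> [r|->]; last by rewrite subr0; exact: beta0_comb.
by have [_ mb] := beta0P HD; exact: mb.
Qed.

(** Let E = h1 + cE d_0. Then alpha_0 = - beta_0 + delta_0 takes the value 1 on E, like
    the other simple roots, so ad E measures the height of roots. *)
Definition cE : K := 1 + beta0 D h1.

Lemma c1_nat : exists b : nat, cE = b.+1%:R.
Proof.
have [c E] := beta0_comb; exists (\sum_i c i)%N.
by rewrite /cE E comb_height -add1n natrD.
Qed.

(** The symbol s is an eigenvector of ad E for e. *)
Definition homog (s : tau_sym D) (e : K) : Prop :=
  match s with
  | tX k x => exists2 a, gweight k a x & e = a h1 + cE * (k 0 ord0)%:~R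
  | tK r _ | td r _ => inG r /\ e = cE * (r 0 ord0)%:~R
  end.

Lemma homog_ok s e : homog s e -> tau_ok D s.
Proof. by case: s => [k x [a []]|r i []|r i []]. Qed.

(** The symbols of height 0: by [weight_trichotomy], a nonzero weight vector of height 0
    has the weight 0 for h(0) and the degree 0 in t_0. *)
Definition tau_zero (s : tau_sym D) : Prop :=
  match s with
  | tX k x => gweight k 0 x /\ k 0 ord0 = 0
  | tK r _ | td r _ => inG r /\ r 0 ord0 = 0
  end.

Lemma tau_zero_homog s : tau_zero s -> homog s 0.
Proof.
case: s => [k x|r i|r i] [Hw Hd] /=; rewrite Hd mulr0 //; exists 0 => //.
by rewrite lfunE add0r.
Qed.

Lemma QplusE (a : h0dual) (z : int) c0 c :
  (ext_h0 a + z%:~R *: @Defs.delta K D ord0 = c0%:R *: @alpha0 K D + ext_h0 (comb c)) <->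
  (a = comb c - c0%:R *: beta0 D /\ z = c0%:Z).
Proof.
rewrite /ext_h0 /delta /alpha0 /ext_h0 /delta.
have -> : (a, 0, 0) + z%:~R *: (0, 0, delta_mx 0 ord0) =
    (a + z%:~R *: 0, 0 + z%:~R *: 0, 0 + z%:~R *: delta_mx 0 ord0) :> Hdual D by [].
have -> : c0%:R *: ((- beta0 D, 0, 0) + (0, 0, delta_mx 0 ord0)) + (comb c, 0, 0) =
    (c0%:R *: (- beta0 D + 0) + comb c, c0%:R *: (0 + 0) + 0,
     c0%:R *: (0 + delta_mx 0 ord0) + 0) :> Hdual D by [].
rewrite !scaler0 !addr0 !add0r scaler0 scalerN; split=> [[-> E]|[-> ->]]; last first.
  by rewrite [comb c - _]addrC.
split; first by rewrite addrC.
have := congr1 (fun M : 'rV_n.+1 => M 0 ord0) E; rewrite !mxE !mulr1.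
by rewrite -[c0%:R]/(c0%:Z%:~R) => /intr_inj.
Qed.

(** A weight a + k_0 delta_0 is a combination of the simple roots with coefficients of
    the same sign. Indeed beta_0 - a and beta_0 + a are nonnegative combinations, as
    beta_0 is maximal, and k_0 delta_0 = k_0 alpha_0 + k_0 beta_0. *)
Lemma weight_trichotomy (k : deg) (a : h0dual) x : gweight k a x -> x != 0 ->
  exists z : int, [/\ a h1 + cE * (k 0 ord0)%:~R = z%:~R,
    0 < z -> tau_plus (tX k x) & z = 0 -> a = 0 /\ k 0 ord0 = 0].
Proof.
move=> wx xn; have wa := weight_en wx xn; have [cb Eb] := beta0_comb.
have posE z : a h1 + cE * (k 0 ord0)%:~R = z%:~R -> 0 < z ->
    (exists c0 c, a = comb c - c0%:R *: beta0 D /\ k 0 ord0 = c0%:Z) ->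
    tau_plus (tX k x).
  move=> Ez z0 [c0 [c Ec]]; exists a; split=> //; split.
    by exists c0, c; apply/QplusE.
  apply: contraTneq z0 => E0.
  have [|a0 k0] := (QplusE a (k 0 ord0) 0 (fun=> 0%N)).1.
    by rewrite E0 scale0r add0r comb0 ?big1.
  move: Ez; rewrite a0 k0 scale0r subr0 comb0 ?big1 // lfunE add0r mulr0 => /eqP.
  by rewrite eq_sym intr_eq0 => /eqP ->.
case Ek : (k 0 ord0) => [[|j]|j].
- rewrite mulr0 addr0; have [a0|an] := eqVneq a 0.
    by exists 0; split=> //; rewrite a0 lfunE.
  have [|c [Ea|Ea]] := @en_comb a; first by case: wa => // a0; rewrite a0 eqxx in an.
    exists (\sum_i c i)%N%:Z; split.
    + by rewrite Ea comb_height.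
    + move=> z0; apply: (posE _ _ z0); first by rewrite Ek mulr0 addr0 Ea comb_height.
      by exists 0%N, c; rewrite scale0r subr0 Ek.
    + by move=> /eqP; rewrite eqz_nat => /eqP/comb0 E0; rewrite Ea E0 eqxx in an.
  exists (- (\sum_i c i)%N%:Z); split.
  + by rewrite Ea opp_lfunE comb_height rmorphN.
  + by rewrite oppr_gt0 ltNge lez_nat.
  + by move=> /eqP; rewrite oppr_eq0 eqz_nat => /eqP/comb0 E0; rewrite Ea E0 oppr0 eqxx in an.
- have [c Ec] := beta0_sub (weight_en_opp wa); rewrite opprK in Ec.
  have Ea : a = comb (fun i => (c i + j * cb i)%N) - j.+1%:R *: beta0 D.
    rewrite -combD -combM -Eb -Ec -addn1 natrD scalerDl scale1r.
    by apply/eqP; rewrite eq_sym subr_eq -addrA addrC -addrA.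
  have Ez : a h1 + cE * j.+1%:R = (j.+1 + \sum_i (c i + j * cb i))%N%:Z%:~R.
    rewrite Ea add_lfunE opp_lfunE scale_lfunE comb_height /cE mulrDl mul1r.
    rewrite -[_ *: _]/(j.+1%:R * beta0 D h1) [beta0 D h1 * _]mulrC.
    by rewrite addrCA addrNK -natrD.
  exists (j.+1 + \sum_i (c i + j * cb i))%N%:Z; split=> //.
  + by move=> z0; apply: (posE _ _ z0);
      [rewrite Ek | exists j.+1, (fun i => (c i + j * cb i)%N); rewrite Ek].
- have [c Ec] := beta0_sub wa.
  have Ea : a = - comb (fun i => (c i + j * cb i)%N) + j.+1%:R *: beta0 D.
    rewrite -combD -combM -Eb -Ec -addn1 natrD scalerDl scale1r opprD addrA addrNK.
    by rewrite opprB subrK.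
  have Ez : a h1 + cE * (Negz j)%:~R = (- (j.+1 + \sum_i (c i + j * cb i))%N%:Z)%:~R.
    rewrite Ea add_lfunE opp_lfunE scale_lfunE comb_height /cE NegzE rmorphN mulrN mulrDl mul1r.
    rewrite -[_ *: _]/(j.+1%:R * beta0 D h1) [beta0 D h1 * _]mulrC.
    by rewrite opprD addrACA subrr addr0 addrC -opprD rmorphN -natrD.
  exists (- (j.+1 + \sum_i (c i + j * cb i))%N%:Z); split=> //.
Qed.

End Grading.

(** * The highest eigenspace of the height operator *)

Section Top.
Variables (K : numClosedFieldType) (D : datum K).
Variables (V : lmodType K) (rho : tau_sym D -> V -> V) (C0 : K).
Hypothesis LM : level_module rho C0.
Let HD := lm_std LM.
Let HV := lm_mod LM.
Let Vint := lm_int LM.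

Local Notation n := (nvar D).
Local Notation deg := 'rV[int]_n.+1.
Local Notation B := (@Defs.form K D).
Local Notation inG := (@in_Gamma K D).

Variable h1 : subvs_of (h0 D).
Hypothesis Hh1 : forall i, tnth (simple_root D) i h1 = 1.
Local Notation homog := (homog h1).
Local Notation c1 := (cE h1).

Definition Eop (v : V) : V := rho (tX 0 (vsval h1)) v + c1 *: rho (td 0 ord0) v.

Lemma Eop_lin : linear Eop.
Proof.
move=> a u v; rewrite /Eop (H_lin LM) (tau_linear HV); last exact: in_Gamma0.
by rewrite !scalerDr !scalerA addrACA [c1 * a]mulrC.
Qed.

Lemma weight_Eop lam v : weight_space rho lam v ->
  Eop v = (lam.1.1 h1 + c1 * lam.2 0 ord0) *: v.
Proof. by case=> Hh _ Hd; rewrite /Eop Hh Hd scalerA -scalerDl. Qed.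

Lemma Eop_semisimple v : lspan [set u | exists c, Eop u = c *: u] v.
Proof.
have : lspan [set v | exists lam, weight_space rho lam v] v by rewrite (weight_sum Vint).
by apply: lspan_mono => u [lam /weight_Eop E]; eexists; exact: E.
Qed.

Lemma commute_br (p q : V -> V) v w : bracket p q v = w -> p (q v) = q (p v) + w.
Proof. by move=> <-; rewrite addrC subrK. Qed.

Lemma br_swap (p q : V -> V) v : bracket p q v = - bracket q p v.
Proof. by rewrite /bracket opprB. Qed.

Lemma Eop_hom s e v : homog s e -> Eop (rho s v) = rho s (Eop v) + e *: rho s v.
Proof.
have G0 := @in_Gamma0 _ D.
move=> hs; have ls := rho_lin LM (homog_ok hs); rewrite /Eop (linD ls) (linZ ls).
case: s hs {ls} => [k x [a [kx wx] ->]|r i [Gr ->]|r i [Gr ->]].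
- rewrite (rhoHX LM h1 v kx) wx (rhoXZ LM _ _ kx).
  rewrite (commute_br (tau_dX HV ord0 v G0 kx)) addr0 scalerDr scalerA
    [(a h1 + _) *: _]scalerDl.
  by rewrite addrACA.
- have := tau_KX HV i v Gr (vsval0 LM h1); move/eqP; rewrite subr_eq0 => /eqP <-.
  rewrite (commute_br (tau_dK HV ord0 i v G0 Gr)) add0r (rhoK_0 _) scaler0 addr0.
  by rewrite scalerDr scalerA addrA.
- have := tau_dX HV i v Gr (vsval0 LM h1); rewrite mxE scale0r => /eqP; rewrite subr_eq0 => /eqP <-.
  rewrite (commute_br (tau_dd HV ord0 i v G0 Gr)) add0r (rhoK_0 _) scaler0 addr0.
  have -> : ((0 : deg) 0 i)%:~R = 0 :> K by rewrite mxE.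
  by rewrite scale0r subr0 scalerDr scalerA addrA.
Qed.

Definition hspan (e : K) (v : V) : set V :=
  lspan [set w | exists2 s, homog s e & w = rho s v].

Lemma hspan_in s e v : homog s e -> hspan e v (rho s v).
Proof. by move=> hs; apply: lspan_in; exists s. Qed.

Lemma hspan_sub e v : is_subspace (hspan e v). Proof. exact: lspan_subspace. Qed.

Lemma hspan_rhoK e k r v : inG r -> e = c1 * (r 0 ord0)%:~R -> hspan e v (rhoK rho k r v).
Proof.
move=> Gr He; apply: (subsp_sum (hspan_sub e v)) => i _; apply: (subspZ (hspan_sub e v)).
by apply: hspan_in.
Qed.

Lemma homog_bracket s s' e e' v : homog s e -> homog s' e' ->
  hspan (e + e') v (bracket (rho s) (rho s') v).
Proof.
have HS f := hspan_sub f v.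
have HDg (k r : deg) : (k + r) 0 ord0 = k 0 ord0 + r 0 ord0 by rewrite mxE.
have dX r i k x f f' : homog (td r i) f -> homog (tX k x) f' ->
    hspan (f + f') v (bracket (rho (td r i)) (rho (tX k x)) v).
  move=> [Gr Ef] [a [kx wx] Ef']; rewrite (tau_dX HV i v Gr kx).
  apply: (subspZ (HS _)); apply: hspan_in; exists a.
    by split=> //; exact: (gdeg_shift HD).
  by rewrite Ef Ef' HDg rmorphD mulrDr addrC addrA.
have KX r i k x f f' : homog (tK r i) f -> homog (tX k x) f' ->
    hspan (f + f') v (bracket (rho (tK r i)) (rho (tX k x)) v).
  by move=> [Gr Ef] [a [kx wx] Ef']; rewrite (tau_KX HV i v Gr kx); exact: subsp0.
have dK r i r' j f f' : homog (td r i) f -> homog (tK r' j) f' ->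
    hspan (f + f') v (bracket (rho (td r i)) (rho (tK r' j)) v).
  move=> [Gr Ef] [Gr' Ef']; rewrite (tau_dK HV i j v Gr Gr').
  have Ge : inG (r + r') by exact: in_GammaD.
  have Ee : f + f' = c1 * ((r + r') 0 ord0)%:~R by rewrite Ef Ef' HDg rmorphD mulrDr.
  apply: (subspD (HS _)); apply: (subspZ (HS _)); last exact: hspan_rhoK.
  exact: hspan_in.
case: s s' => [k x|r i|r i] [k' x'|r' i'|r' i'] hs hs'.
- case: hs hs' => [a [kx wx] Ee] [a' [kx' wx'] Ee'].
  rewrite (tau_XX HV v kx kx'); apply: (subspD (HS _)).
    apply: hspan_in; exists (a + a').
      split=> [|h]; first exact: (gdeg_lie HD).
      by rewrite lie_der wx wx' lieZl lieZr -scalerDl add_lfunE.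
    by rewrite add_lfunE Ee Ee' HDg rmorphD mulrDr addrACA.
  have [->|Bn] := eqVneq (B x x') 0; first by rewrite scale0r; exact: subsp0.
  apply: (subspZ (HS _)); apply: hspan_rhoK; first exact: (form_graded HD kx kx').
  have Ea := form_weight LM wx wx' Bn.
  by rewrite Ee Ee' Ea opp_lfunE HDg rmorphD mulrDr addrACA subrr add0r.
- by rewrite br_swap addrC; apply: (subspN (HS _)); exact: KX.
- by rewrite br_swap addrC; apply: (subspN (HS _)); exact: dX.
- exact: KX.
- by case: hs hs' => [Gr _] [Gr' _]; rewrite (tau_KK HV i i' v Gr Gr'); exact: subsp0.
- by rewrite br_swap addrC; apply: (subspN (HS _)); exact: dK.
- exact: dX.
- exact: dK.
- case: hs hs' => [Gr Ee] [Gr' Ee']; rewrite (tau_dd HV i i' v Gr Gr').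
  have Ge : inG (r + r') by exact: in_GammaD.
  have E2 : e + e' = c1 * ((r + r') 0 ord0)%:~R by rewrite Ee Ee' HDg rmorphD mulrDr.
  apply: (subspD (HS _)); last by apply: (subspZ (HS _)); exact: hspan_rhoK.
  by apply: (subspB (HS _)); apply: (subspZ (HS _)); apply: hspan_in.
Qed.

Lemma homog_decomp s v : tau_ok D s -> 
  lspan [set w | exists s' e, homog s' e /\ w = rho s' v] (rho s v).
Proof.
case: s => [k x xk|r i Gr|r i Gr]; last 2 first.
- by apply: lspan_in; exists (tK r i), (c1 * (r 0 ord0)%:~R).
- by apply: lspan_in; exists (td r i), (c1 * (r 0 ord0)%:~R).
set S := lspan _; have HS : is_subspace S by exact: lspan_subspace.
suff [] : x \in gdeg k /\ S (rho (tX k x) v) by [].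
apply: (gw_ind LM (P := fun x => x \in gdeg k /\ S (rho (tX k x) v))) xk.
- by split; [exact: mem0v|rewrite (rhoX0 LM); exact: subsp0].
- move=> y z [yk Sy] [zk Sz]; split; first exact: memvD.
  by rewrite (rhoXD LM) //; exact: subspD.
- move=> a y [yk wy]; split=> //; apply: lspan_in.
  exists (tX k y), (a h1 + c1 * (k 0 ord0)%:~R); split=> //; by exists a.
Qed.

Lemma homog_int s e : homog s e -> (forall v, rho s v = 0) \/ exists z : int, e = z%:~R.
Proof.
have [b Eb] := c1_nat LM Hh1.
case: s => [k x [a wx ->]|r i [_ ->]|r i [_ ->]]; last 2 first.
- by right; exists (b.+1%:Z * r 0 ord0); rewrite Eb rmorphM.
- by right; exists (b.+1%:Z * r 0 ord0); rewrite Eb rmorphM.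
have [->|xn] := eqVneq x 0; first by left=> v; exact: (rhoX0 LM).
by right; have [z [-> _ _]] := weight_trichotomy LM Hh1 wx xn; exists z.
Qed.

(** A space of E-eigenvectors that is stable under height 0 and killed by positive heights
    generates V by operators of negative height, as V is irreducible; it is then the
    highest eigenspace of E. *)
Section Generate.
Variables (T' : set V) (e : K).
Hypotheses (HT : is_subspace T') (Te : forall v, T' v -> Eop v = e *: v).
Hypothesis Tn : exists2 v, T' v & v != 0.
Hypothesis Tzero : forall s v, homog s 0 -> T' v -> T' (rho s v).
Hypothesis Tpos : forall s (z : nat) v, homog s z.+1%:R -> T' v -> rho s v = 0.

Inductive Gen : nat -> V -> Prop :=
| Gen0 v : T' v -> Gen 0%N v
| GenS N v s z : Gen N v -> homog s (- z.+1%:R) -> Gen (N + z.+1)%N (rho s v).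

Lemma Gen_eigen N v : Gen N v -> Eop v = (e - N%:R) *: v.
Proof.
elim=> [u Tu|M u s z _ IH hs]; first by rewrite subr0; exact: Te.
rewrite (Eop_hom _ hs) IH (linZ (rho_lin LM (homog_ok hs))) -scalerDl natrD opprD.
by rewrite addrA.
Qed.

(** An operator of height at least 0 is commuted to the right until it reaches T'. *)
Lemma Gen_stable N v : Gen N v -> forall s e', homog s e' ->
  lspan [set u | exists M, Gen M u] (rho s v).
Proof.
set S := lspan _; have HS : is_subspace S by exact: lspan_subspace.
elim=> [u Tu|M u s1 z Gu IH hs1] s e' hs.
  case: (homog_int hs) => [->|[[[|m]|m] Ez]]; first exact: subsp0.
  - by apply: lspan_in; exists 0%N; apply: Gen0; apply: Tzero => //; rewrite Ez in hs.
  - by rewrite (@Tpos s m) //; [exact: subsp0|rewrite Ez in hs].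
  - apply: lspan_in; exists (0 + m.+1)%N; apply: GenS; first exact: Gen0.
    by rewrite Ez NegzE rmorphN in hs.
rewrite (commute_br (erefl _)); apply: (subspD HS).
  move: (IH s e' hs); apply: (lspan_lin_sub (rho_lin LM (homog_ok hs1)) HS) => w [M' Gw].
  by apply: lspan_in; exists (M' + z.+1)%N; apply: GenS.
move: (homog_bracket u hs hs1); apply: (lspan_sub HS) => w [s2 hs2 ->].
exact: IH hs2.
Qed.

Lemma Gen_span v : lspan [set u | exists M, Gen M u] v.
Proof.
set S := lspan _; have HS : is_subspace S by exact: lspan_subspace.
suff [S0|->//] : S = [set 0] \/ S = setT.
  have [u Tu un] := Tn; have : S u by apply: lspan_in; exists 0%N; apply: Gen0.
  by rewrite S0 /= => u0; rewrite u0 eqxx in un.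
case: (lm_irr LM) => _; apply; split=> // s os w.
apply: (lspan_lin_sub (rho_lin LM os) HS) => {}w [M Gw].
move: (homog_decomp w os); apply: (lspan_sub HS) => _ [s' [e' [hs ->]]].
exact: Gen_stable Gw _ _ hs.
Qed.

(** The elements of [Gen N] with N > 0 have eigenvalues different from e. *)
Lemma top_eigenspace v : Eop v = e *: v -> T' v.
Proof.
move=> Ev.
have [t Tt Lt] : exists2 t, T' t & lspan [set u | exists2 c, c != e & Eop u = c *: u] (v - t).
  set Q := lspan _; have HQ : is_subspace Q by exact: lspan_subspace.
  apply: (@lspan_ind _ _ _ (fun v => exists2 t, T' t & Q (v - t))) (Gen_span v).
    split; first by exists 0; [exact: subsp0|rewrite subr0; exact: subsp0].
    move=> a u w [t1 T1 Q1] [t2 T2 Q2]; exists (a *: t1 + t2); first exact: subspL.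
    by rewrite opprD addrACA -scalerBr; exact: subspL.
  move=> u [M]; case=> [w Tw|M' w s z Gw hs].
    by exists w => //; rewrite subrr; exact: subsp0.
  exists 0; first exact: subsp0.
  rewrite subr0; apply: lspan_in; exists (e - (M' + z.+1)%:R).
    by rewrite -subr_eq0 addrAC subrr add0r oppr_eq0 pnatr_eq0 addnS.
  by apply: Gen_eigen; apply: GenS.
have := eigen_indep Eop_lin Lt; rewrite (linB Eop_lin) Ev (Te Tt) -scalerBr.
by move=> /(_ (erefl _)) /eqP; rewrite subr_eq0 => /eqP ->.
Qed.

Lemma eigenvalues_below v e' : v != 0 -> Eop v = e' *: v -> exists N : nat, e' = e - N%:R.
Proof.
move=> vn Ev; apply: contrapT => Ne; case/eqP: vn.
apply: (eigen_indep Eop_lin _ Ev).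
apply: lspan_mono (Gen_span v) => u [M Gu]; exists (e - M%:R); last exact: Gen_eigen.
by apply/eqP => E; apply: Ne; exists M.
Qed.

End Generate.

(** The symbols of tau^+ are those of positive height. *)
Lemma TspaceP v : Tspace rho v <-> forall s (z : nat), homog s z.+1%:R -> rho s v = 0.
Proof.
have [b Eb] := c1_nat LM Hh1.
split=> [Tv s z hs|Tv s].
  have dpos (r : deg) : z.+1%:R = c1 * (r 0 ord0)%:~R -> 0 < r 0 ord0.
    rewrite Eb => E; have : (0 : K) < b.+1%:R * (r 0 ord0)%:~R by rewrite -E ltr0Sn.
    by rewrite pmulr_rgt0 ?ltr0Sn // ltr0z.
  case: s hs => [k x [a wx Ez]|r i [Gr Ez]|r i [Gr Ez]]; last 2 first.
  - by apply: Tv; split=> //; exact: dpos.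
  - by apply: Tv; split=> //; exact: dpos.
  have [->|xn] := eqVneq x 0; first exact: (rhoX0 LM).
  have [y [Ey Py _]] := weight_trichotomy LM Hh1 wx xn.
  by apply: Tv; apply: Py; rewrite -(ltr0z K) -Ey -Ez ltr0Sn.
have dnat (r : deg) : 0 < r 0 ord0 -> exists z : nat, c1 * (r 0 ord0)%:~R = z.+1%:R.
  case: (r 0 ord0) => [[|z]|] // _; exists (b.+1 * z + b)%N.
  by rewrite Eb -natrM; congr (_%:R); lia.
case: s => [k x [a [wx [[c0 [c /QplusE [Ea Ek]]] nz]]]|r i [Gr r0]|r i [Gr r0]]; last 2 first.
- by have [z Ez] := dnat r r0; apply: (Tv _ z); split.
- by have [z Ez] := dnat r r0; apply: (Tv _ z); split.
have Ez : a h1 + c1 * (k 0 ord0)%:~R = (c0 + \sum_i c i)%N%:R.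
  rewrite Ek Ea add_lfunE opp_lfunE scale_lfunE (comb_height Hh1) /cE.
  rewrite -[_ *: _]/(c0%:R * beta0 D h1) mulrDl mul1r [beta0 D h1 * _]mulrC.
  by rewrite addrCA addrNK -natrD.
case Es : (c0 + \sum_i c i)%N => [|z].
  case/eqP: nz; move/eqP: Es; rewrite addn_eq0 => /andP[/eqP c00 /eqP /comb0 E0].
  by rewrite Ek Ea E0 c00 scale0r subr0 scale0r addr0.
by apply: (Tv _ z); exists a => //; rewrite Ez Es.
Qed.

End Top.

(** * The space T *)

Section Top_of_V.
Variables (K : numClosedFieldType) (D : datum K).
Variables (V : lmodType K) (rho : tau_sym D -> V -> V) (C0 : K).
Hypothesis LM : level_module rho C0.
Let HD := lm_std LM.
Let HV := lm_mod LM.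
Let Vint := lm_int LM.

Local Notation g := (gfin D).
Local Notation n := (nvar D).
Local Notation deg := 'rV[int]_n.+1.
Local Notation deg' := 'rV[int]_n.
Local Notation h0dual := 'Hom(subvs_of (h0 D), K^o).
Local Notation B := (@Defs.form K D).
Local Notation inG := (@in_Gamma K D).
Local Notation T := (Tspace rho).

Variable lam : Hdual D.
Hypothesis Hlam : exists v : V, [/\ v != 0, T v & weight_space rho lam v].

Lemma tau_plus_ok s : tau_plus s -> tau_ok D s.
Proof. by case: s => [k x [a [[]]]|r i []|r i []]. Qed.

Lemma T_subspace : is_subspace T.
Proof.
split=> [s /tau_plus_ok os|a u v Tu Tv s ps].
  exact: (lin0 (rho_lin LM os)).
by rewrite (rho_lin LM (tau_plus_ok ps)) Tu // Tv // scaler0 addr0.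
Qed.

Lemma tau_zero_ok s : tau_zero s -> tau_ok D s.
Proof. by case: s => [k x [[]]|r i []|r i []]. Qed.

Definition sdeg (s : tau_sym D) : deg := match s with tX k _ | tK k _ | td k _ => k end.

Lemma td_sdeg i s v : tau_ok D s ->
  rho (td 0 i) (rho s v) = rho s (rho (td 0 i) v) + (sdeg s 0 i)%:~R *: rho s v.
Proof.
have G0 := @in_Gamma0 _ D.
case: s => [k x xk|r j Gr|r j Gr] /=.
- by rewrite (commute_br (tau_dX HV i v G0 xk)) addr0.
- by rewrite (commute_br (tau_dK HV i j v G0 Gr)) add0r (rhoK_0 _) scaler0 addr0.
- rewrite (commute_br (tau_dd HV i j v G0 Gr)) add0r (rhoK_0 _) scaler0 addr0.
  have -> : ((0 : deg) 0 j)%:~R = 0 :> K by rewrite mxE.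
  by rewrite scale0r subr0.
Qed.

Section Fixed_height.
Variable h1 : subvs_of (h0 D).
Hypothesis Hh1 : forall i, tnth (simple_root D) i h1 = 1.
Let e0 := lam.1.1 h1 + cE h1 * lam.2 0 ord0.

Lemma homog0_T s v : homog h1 s 0 -> T v -> T (rho s v).
Proof.
move=> hs /(TspaceP LM Hh1) Tv; apply/(TspaceP LM Hh1) => s' z hs'.
rewrite (commute_br (erefl _)) (Tv _ _ hs') (lin0 (rho_lin LM (homog_ok hs))) add0r.
have := homog_bracket LM v hs' hs; rewrite addr0.
have S0 : is_subspace [set 0 : V] by split=> // a _ _ -> ->; rewrite scaler0 addr0.
by move/(lspan_sub S0); apply=> _ [s2 h2 ->] /=; exact: Tv h2.
Qed.

Lemma T_sub_pos (T' : set V) s (z : nat) v : T' `<=` T -> homog h1 s z.+1%:R -> T' v -> rho s v = 0.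
Proof. by move=> T'T hs /T'T /(TspaceP LM Hh1); apply; exact: hs. Qed.

Lemma T_eigen_stable e s v : homog h1 s 0 -> T v /\ Eop rho h1 v = e *: v ->
  T (rho s v) /\ Eop rho h1 (rho s v) = e *: rho s v.
Proof.
move=> hs [Tv Ev]; split; first exact: homog0_T.
rewrite (Eop_hom LM v hs) Ev (linZ (rho_lin LM (homog_ok hs))) scale0r addr0 //.
Qed.

Lemma T_eigen_subspace e : is_subspace [set v | T v /\ Eop rho h1 v = e *: v].
Proof.
split; first by split; [exact: (subsp0 T_subspace)|rewrite (lin0 (Eop_lin LM h1)) scaler0].
move=> a u v [Tu Eu] [Tv Ev]; split; first exact: (subspL T_subspace).
by rewrite (Eop_lin LM h1) Eu Ev scalerDr !scalerA mulrC.
Qed.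

(** An eigenvector of E in T for c generates V, so all eigenvalues of E are of the form
    c - N. Two such eigenvalues c therefore coincide, and T contains the whole
    eigenspace. *)
Lemma T_top v : T v <-> Eop rho h1 v = e0 *: v.
Proof.
pose TE e := [set v | T v /\ Eop rho h1 v = e *: v].
have top e : (exists2 v, TE e v & v != 0) ->
    (forall v, Eop rho h1 v = e *: v -> TE e v) /\
    forall v e', v != 0 -> Eop rho h1 v = e' *: v -> exists N : nat, e' = e - N%:R.
  move=> ex; have HTE := T_eigen_subspace e.
  have TEe u : TE e u -> Eop rho h1 u = e *: u by case.
  have TEs s u : homog h1 s 0 -> TE e u -> TE e (rho s u) by exact: T_eigen_stable.
  have TEp s (z : nat) u : homog h1 s z.+1%:R -> TE e u -> rho s u = 0.
    by apply: T_sub_pos => w [].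
  split=> [u|u e'].
    exact: (top_eigenspace LM Hh1 HTE TEe ex TEs TEp).
  exact: (eigenvalues_below LM Hh1 TEe ex TEs TEp).
have ex0 : exists2 v, TE e0 v & v != 0.
  have [w [wn Tw ww]] := Hlam; exists w => //; split=> //.
  exact: (weight_Eop h1 ww).
have [top0 below0] := top _ ex0; split=> [Tv|Ev]; last by case: (top0 _ Ev).
have [s0 Es0] : exists s, Eop rho h1 v = s by exists (Eop rho h1 v).
apply: (eigen_ind (Eop_lin LM h1) (Eop_semisimple LM h1) (S := T)
  (P := fun v => Eop rho h1 v = e0 *: v)) Tv.
- exact: T_subspace.
- move=> u Tu; rewrite /Eop; apply: (subspD T_subspace).
    apply: homog0_T => //; exists 0; last by rewrite lfunE add0r mxE mulr0.
    split=> [|h]; first exact: (vsval0 LM).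
    by rewrite (h0_abelian LM) lfunE scale0r.
  apply: (subspZ T_subspace); apply: homog0_T => //; split; first exact: in_Gamma0.
  by rewrite mxE mulr0.
- by rewrite (lin0 (Eop_lin LM h1)) scaler0.
- by move=> u w Eu Ew; rewrite (linD (Eop_lin LM h1)) Eu Ew scalerDr.
move=> c u Tu Eu; have [->|un] := eqVneq u 0; first by rewrite (lin0 (Eop_lin LM h1)) scaler0.
have [N EN] := below0 _ _ un Eu.
have [_ belowc] : _ := top c (ex_intro2 _ _ u (conj Tu Eu) un).
have [w [Tw Ew] wn] := ex0.
have [N' EN'] := belowc _ _ wn Ew.
have : (N + N')%N%:R = 0 :> K.
  move: EN'; rewrite EN -addrA -opprD => /eqP.
  by rewrite eq_sym -subr_eq0 addrAC subrr add0r oppr_eq0 -natrD => /eqP.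
move/eqP; rewrite pnatr_eq0 addn_eq0 => /andP[/eqP N0 _].
by rewrite Eu EN N0 subr0.
Qed.

Lemma homog0_zero s v : homog h1 s 0 -> rho s v = 0 \/ tau_zero s.
Proof.
have [b Eb] := c1_nat LM Hh1.
have r0 (r : deg) : 0 = cE h1 * (r 0 ord0)%:~R -> r 0 ord0 = 0.
  move/eqP; rewrite eq_sym mulf_eq0 Eb pnatr_eq0 /= intr_eq0; exact: eqP.
case: s => [k x [a wx Ez]|r i [Gr Ez]|r i [Gr Ez]]; last 2 first.
- by right; split=> //; exact: r0.
- by right; split=> //; exact: r0.
have [->|xn] := eqVneq x 0; first by left; exact: (rhoX0 LM).
right; have [z [Ey _ Hz]] := weight_trichotomy LM Hh1 wx xn.
move: Ey; rewrite -Ez => /eqP; rewrite eq_sym intr_eq0 => /eqP /Hz [a0 k0].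
by split=> //; rewrite -a0.
Qed.

(** By [top_eigenspace] a nonzero stable subspace of T is the highest eigenspace of
    E. *)
Lemma T_irr_aux (T' : set V) : is_subspace T' -> T' `<=` T -> (exists2 v, T' v & v != 0) ->
  (forall s v, tau_zero s -> T' v -> T' (rho s v)) -> T `<=` T'.
Proof.
move=> HT' T'T ex Ts v /T_top Ev.
apply: (top_eigenspace LM Hh1 HT' _ ex _ _ Ev).
- by move=> u /T'T /T_top.
- move=> s u hs T'u; have [->|zs] := homog0_zero u hs; first exact: subsp0.
  exact: Ts.
- by move=> s z u; exact: T_sub_pos.
Qed.

Lemma T_zero_aux s v : tau_zero s -> T v -> T (rho s v).
Proof. by move=> zs; apply: homog0_T; exact: tau_zero_homog. Qed.

End Fixed_height.

Lemma T_irr (T' : set V) : is_subspace T' -> T' `<=` T -> (exists2 v, T' v & v != 0) ->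
  (forall s v, tau_zero s -> T' v -> T' (rho s v)) -> T `<=` T'.
Proof. by have [h1 Hh1] := height_element LM; exact: (T_irr_aux Hh1). Qed.

Lemma T_zero s v : tau_zero s -> T v -> T (rho s v).
Proof. by have [h1 Hh1] := height_element LM; exact: (T_zero_aux Hh1). Qed.

Lemma tau_zero_td i : tau_zero (td (0 : deg) i : tau_sym D).
Proof. by split; [exact: in_Gamma0|rewrite mxE]. Qed.

Lemma h_tau_zero (h : subvs_of (h0 D)) s v : tau_zero s ->
  rho (tX 0 (vsval h)) (rho s v) = rho s (rho (tX 0 (vsval h)) v).
Proof.
case: s => [k x [[kx wx] _]|r i [Gr r0]|r i [Gr r0]].
- by rewrite (rhoHX LM h v kx) wx lfunE scale0r (rhoX0 LM) addr0.
- by have := tau_KX HV i v Gr (vsval0 LM h); move/eqP; rewrite subr_eq0 => /eqP ->.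
- have := tau_dX HV i v Gr (vsval0 LM h); rewrite mxE scale0r => /eqP.
  by rewrite subr_eq0 => /eqP ->.
Qed.

Lemma sdeg_zero s : tau_zero s -> sdeg s 0 ord0 = 0.
Proof. by case: s => [k x []|r i []|r i []]. Qed.

(** The elements of h(0) and d_0 commute with the symbols of [tau_zero], so they act on
    the irreducible T by scalars. *)
Lemma T_char v : T v <-> (forall h : subvs_of (h0 D), rho (tX 0 (vsval h)) v = lam.1.1 h *: v)
  /\ rho (td 0 ord0) v = lam.2 0 ord0 *: v.
Proof.
have ld := rho_lin LM (tau_zero_ok (tau_zero_td ord0)).
split=> [Tv|[Hh Hd]]; last first.
  have [h1 Hh1] := height_element LM; apply/(T_top Hh1).
  by rewrite /Eop Hh Hd scalerA -scalerDl.
pose T' := [set v | T v /\ ((forall h : subvs_of (h0 D),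
  rho (tX 0 (vsval h)) v = lam.1.1 h *: v) /\ rho (td 0 ord0) v = lam.2 0 ord0 *: v)].
suff : T' v by case.
apply: T_irr Tv; [|by move=> u []| |].
- split.
    split; first exact: (subsp0 T_subspace).
    by split=> [h|]; rewrite ?(lin0 (H_lin LM h)) ?(lin0 ld) scaler0.
  move=> a u w [Tu [Hu du]] [Tw [Hw dw]]; split; first exact: (subspL T_subspace).
  split=> [h|].
    by rewrite (H_lin LM h) Hu Hw scalerDr !scalerA mulrC.
  by rewrite ld du dw scalerDr !scalerA mulrC.
- have [w [wn Tw [Hw _ dw]]] := Hlam; by exists w.
- move=> s u zs [Tu [Hu du]]; split; first exact: T_zero.
  have ls := rho_lin LM (tau_zero_ok zs).
  split=> [h|]; first by rewrite h_tau_zero // Hu (linZ ls).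
  by rewrite (td_sdeg _ _ (tau_zero_ok zs)) sdeg_zero // scale0r addr0 du (linZ ls).
Qed.

Local Notation Tk := (T_deg rho lam).

Lemma Tk_T k v : Tk k v -> T v. Proof. by case. Qed.

Lemma td_lin i : linear (rho (td 0 i)).
Proof. exact: (rho_lin LM (tau_zero_ok (tau_zero_td i))). Qed.

Lemma Tk_subspace k : is_subspace (Tk k).
Proof.
split.
  by split; [exact: (subsp0 T_subspace)|move=> i; rewrite (lin0 (td_lin _)) scaler0].
move=> a u v [Tu Hu] [Tv Hv]; split=> [|i]; first exact: (subspL T_subspace).
by rewrite td_lin Hu Hv scalerDr !scalerA mulrC.
Qed.

Lemma lam_K i : lam.1.2 0 i = if i == ord0 then C0 else 0.
Proof.
have [v [vn _ [_ Hk _]]] := Hlam; have := Hk i.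
have [->|/negP i0] := eqVneq i ord0.
  rewrite (lm_K0 LM) => /eqP; rewrite -subr_eq0 -scalerBl scaler_eq0 (negbTE vn) orbF.
  by rewrite subr_eq0 => /eqP.
case: (unliftP ord0 i) i0 => [j ->|-> //] _.
by rewrite (lm_Ki LM) => /eqP; rewrite eq_sym scaler_eq0 (negbTE vn) orbF => /eqP.
Qed.

(** The weight of T_k. *)
Definition lam_shift (k : deg') : Hdual D := (lam.1.1, lam.1.2, lam.2 + map_mx intr (deg0 k)).

Lemma deg0_0 (k : deg') : deg0 k 0 ord0 = 0.
Proof.
rewrite /deg0 mxE; case: splitP => [j|j /= E]; first by rewrite mxE.
by have := ltn_ord j; move: E; case: (nat_of_ord j).
Qed.

Lemma deg0_lift (k : deg') i : deg0 k 0 (lift ord0 i) = k 0 i.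
Proof.
rewrite /deg0 mxE; case: splitP => [j /= E|j /= E].
  by have := ltn_ord j; rewrite -E.
by congr (k 0 _); apply: val_inj; move: E; rewrite /= /bump /= !add1n => -[].
Qed.

Lemma deg0D (k l : deg') : deg0 (k + l) = deg0 k + deg0 l.
Proof.
have := add_row_mx (0 : 'rV[int]_1) k 0 l; rewrite addr0 => E; exact: esym E.
Qed.

Lemma lam_shiftE k i : (lam_shift k).2 0 i = lam.2 0 i + (deg0 k 0 i)%:~R.
Proof. by rewrite [LHS]mxE [map_mx _ _ _ _]mxE. Qed.

Lemma Tk_weight k v : Tk k v <-> weight_space rho (lam_shift k) v.
Proof.
split=> [[Tv Hv]|[Hh Hk Hd]].
  have [Hh Hd0] := (T_char v).1 Tv; split=> // i.
    rewrite lam_K; case: (unliftP ord0 i) => [j ->|->] /=; first by rewrite (lm_Ki LM) scale0r.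
    by rewrite (lm_K0 LM).
  rewrite lam_shiftE; case: (unliftP ord0 i) => [j ->|->].
    by rewrite deg0_lift Hv.
  by rewrite deg0_0 Hd0 addr0.
split=> [|i]; last by rewrite Hd lam_shiftE deg0_lift.
by apply/T_char; split=> //; rewrite Hd lam_shiftE deg0_0 addr0.
Qed.

Lemma Tk_findim k : findim (Tk k).
Proof.
have [s Hs] := weight_findim Vint (lam_shift k); exists s => v /Tk_weight; exact: Hs.
Qed.

Lemma Tk_rho k l s v : tau_zero s -> sdeg s = deg0 l -> Tk k v -> Tk (k + l) (rho s v).
Proof.
move=> zs Es [Tv Hv]; split=> [|i]; first exact: T_zero.
have ls := rho_lin LM (tau_zero_ok zs).
rewrite (td_sdeg _ _ (tau_zero_ok zs)) Hv (linZ ls) -scalerDl Es deg0_lift mxE rmorphD.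
by rewrite addrA.
Qed.

Lemma Tk0_neq0 : exists2 v, Tk 0 v & v != 0.
Proof.
have [v [vn Tv wv]] := Hlam; exists v => //; split=> // i.
by case: wv => _ _ ->; rewrite mxE addr0.
Qed.

Lemma sdeg_deg0 s : tau_zero s -> sdeg s = deg0 (\row_i sdeg s 0 (lift ord0 i)).
Proof.
move=> /sdeg_zero Hs; apply/rowP => i; case: (unliftP ord0 i) => [j ->|->].
  by rewrite deg0_lift mxE.
by rewrite deg0_0.
Qed.

Lemma T_span v : T v -> lspan [set u | exists k, Tk k u] v.
Proof.
apply: (T_irr (T' := lspan [set u | exists k, Tk k u])).
- exact: lspan_subspace.
- by apply: (lspan_sub T_subspace) => u [k /Tk_T].
- by have [w Tw wn] := Tk0_neq0; exists w => //; apply: lspan_in; exists 0.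
- move=> s u zs; apply: (lspan_lin_sub (rho_lin LM (tau_zero_ok zs)) (lspan_subspace _)).
  by move=> {}u [k Tu]; apply: lspan_in; eexists; exact: (Tk_rho zs (sdeg_deg0 zs) Tu).
Qed.

Lemma iter_wt (a : h0dual) (k : deg) x M v : gweight k a x ->
  (forall (h : subvs_of (h0 D)) c, rho (tX 0 (vsval h)) v = c *: v ->
     rho (tX 0 (vsval h)) (iter M (rho (tX k x)) v) =
       (c + M%:R * a h) *: iter M (rho (tX k x)) v) /\
  (forall i c, rho (td 0 i) v = c *: v ->
     rho (td 0 i) (iter M (rho (tX k x)) v) =
       (c + M%:R * (k 0 i)%:~R) *: iter M (rho (tX k x)) v).
Proof.
move=> [kx wx]; have lx := rhoX_lin LM kx.
split=> [h|i] c Hv; elim: M => [|M IH]; rewrite ?mul0r ?addr0 //=.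
  rewrite (rhoHX LM h _ kx) IH wx (linZ lx) (rhoXZ LM _ _ kx) -scalerDl.
  by congr (_ *: _); rewrite -natr1; ring.
rewrite (td_sdeg i _ (_ : tau_ok D (tX k x))) // IH (linZ lx) -scalerDl.
by congr (_ *: _); rewrite -natr1 /=; ring.
Qed.

Lemma sl2_relations (a : h0dual) (e f : g) (h : subvs_of (h0 D)) (k : deg) :
  gweight 0 a e -> gweight 0 (- a) f -> {[e, f]} = vsval h -> a h = 2 -> inG k ->
  let H v := rho (tX 0 (vsval h)) v + (B e f * ((k 0 ord0)%:~R * C0)) *: v in
  [/\ forall v, rho (tX k e) (rho (tX (- k) f) v) = rho (tX (- k) f) (rho (tX k e) v) + H v,
      forall v, H (rho (tX k e) v) = rho (tX k e) (H v) + (2 * 1) *: rho (tX k e) v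
    & forall v, H (rho (tX (- k) f) v) = rho (tX (- k) f) (H v) - (2 * 1) *: rho (tX (- k) f) v].
Proof.
move=> [e0 we] [f0 wf] Eh ah Gk H.
have ek : e \in gdeg k by rewrite -[k]add0r; exact: (gdeg_shift HD).
have fk : f \in gdeg (- k : deg).
  by rewrite -[- k]add0r; apply: (gdeg_shift HD) => //; exact: in_GammaN.
have le := rhoX_lin LM ek; have lf := rhoX_lin LM fk.
split=> v.
- by rewrite (rhoXX LM v ek fk) subrr Eh (rhoK_at0 LM) scalerA.
- rewrite /H (rhoHX LM h v ek) we ah (rhoXZ LM _ _ ek) (linD le) (linZ le) mulr1.
  by rewrite -!addrA; congr (_ + _); rewrite addrC.
- rewrite /H (rhoHX LM h v fk) wf opp_lfunE ah (rhoXZ LM _ _ fk) (linD lf) (linZ lf) mulr1.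
  by rewrite -scaleNr -!addrA; congr (_ + _); rewrite addrC.
Qed.

(** The operator e(k + r)^M f(- k)^M is a product of two reflections for the sl2-triples
    of degrees k and k + r, which have the weight M and, after f(- k)^M, the weight - M.
    Both factors are injective by [f_iter_inj], and the degrees add up to M r. *)
Lemma shift_aux (a : h0dual) (e f : g) (h : subvs_of (h0 D)) (k : deg) (M : nat) (r : deg') :
  gweight 0 a e -> gweight 0 (- a) f -> a != 0 -> {[e, f]} = vsval h -> a h = 2 -> inG k ->
  lam.1.1 h + B e f * ((k 0 ord0)%:~R * C0) = M%:R -> inG (deg0 r) ->
  exists Th : V -> V, linear Th /\
    forall l v, Tk l v -> Tk (l + M%:Z *: r) (Th v) /\ (Th v = 0 -> v = 0).
Proof.
move=> we wf an Eh ah Gk EM Gr.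
pose H (v : V) := rho (tX 0 (vsval h)) v + (B e f * ((k 0 ord0)%:~R * C0)) *: v.
have [ef He Hf] := sl2_relations we wf Eh ah Gk.
have Gkr : inG (k + deg0 r) by exact: in_GammaD.
have kr0 : (k + deg0 r) 0 ord0 = k 0 ord0 by rewrite mxE deg0_0 addr0.
have := sl2_relations we wf Eh ah Gkr; rewrite kr0 => -[ef' He' Hf'].
set kr := k + deg0 r in Gkr kr0 ef' He' Hf'.
have shiftw (b : h0dual) (x : g) (q : deg) : inG q -> gweight 0 b x -> gweight q b x.
  by move=> Gq [x0 wx]; split=> //; rewrite -[q]add0r; exact: (gdeg_shift HD).
have wek := shiftw _ _ _ Gkr we.
have wfk := shiftw _ _ _ (in_GammaN Gk) wf.
have wfk' := shiftw _ _ _ (in_GammaN Gkr) wf.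
have wek' := shiftw _ _ _ Gk we.
have an' : - a != 0 by rewrite oppr_eq0.
have ne v := real_nilpotent Vint an wek' v.
have ne' v := real_nilpotent Vint an wek v.
have nf v := real_nilpotent Vint an' wfk v.
have nf' v := real_nilpotent Vint an' wfk' v.
have le := rhoX_lin LM (proj1 wek'); have le' := rhoX_lin LM (proj1 wek).
have lf := rhoX_lin LM (proj1 wfk); have lf' := rhoX_lin LM (proj1 wfk').
exists (iter M (rho (tX kr e)) \o iter M (rho (tX (- k) f))); split.
  by apply: lin_comp; apply: lin_iter.
move=> l v Tv; have [Hh _ Hd] := (Tk_weight l v).1 Tv.
have [fh fd] := iter_wt M v wfk; set u := iter M (rho (tX (- k) f)) v in fh fd *.
have [eh ed] := iter_wt M u wek.
have Hv : H v = M%:R *: v by rewrite /H Hh -scalerDl EM.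
split=> [|/=]; last rewrite -/u.
  apply/Tk_weight; split=> [h'|i|i] /=; rewrite -/u.
  - have /= := eh h' _ (fh h' _ (Hh h')); rewrite opp_lfunE mulrN addrNK; exact.
  - rewrite lam_K; case: (unliftP ord0 i) => [j ->|->] /=; first by rewrite (lm_Ki LM) scale0r.
    by rewrite (lm_K0 LM).
  - rewrite (ed i _ (fd i _ (Hd i))) /=; congr (_ *: _).
    rewrite !lam_shiftE [(- k) 0 i]mxE [kr 0 i]mxE rmorphN rmorphD /= -!addrA; congr (_ + _).
    have -> : deg0 (l + M%:Z *: r) 0 i = deg0 l 0 i + M%:Z * deg0 r 0 i.
      case: (unliftP ord0 i) => [j ->|->]; last by rewrite !deg0_0 mulr0.
      by rewrite !deg0_lift !mxE.
    by rewrite rmorphD rmorphM /=; ring.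
move=> Eu; suff u0 : u = 0.
  exact: (@f_iter_inj _ _ (rho (tX k e)) (rho (tX (- k) f)) H 1
    le lf ef He Hf ne (erefl 1) M v Hv u0).
(* u has weight - M for the second triple, so the roles of e and f are exchanged *)
have Hu : - H u = M%:R *: u.
  have -> : H u = (M%:R - 2 * 1 * M%:R) *: u.
    exact: (@H_iter_f _ _ (rho (tX (- k) f)) H 1 lf Hf M _ v Hv).
  by rewrite -scaleNr; congr (_ *: _); ring.
apply: (@f_iter_inj _ _ (rho (tX (- kr) f)) (rho (tX kr e)) (fun v => - H v) 1
   lf' le' _ _ _ nf' (erefl 1) M u Hu Eu).
- by move=> w; rewrite ef' addrK.
- by move=> w; rewrite [H (rho _ w)]Hf' opprB (linN lf') addrC.
- by move=> w; rewrite [H (rho _ w)]He' opprD (linN le').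
Qed.

(** The coroot of the triple e(k), f(- k) acts on T_0 by lam(h) + B e f k_0 C_0, which
    is an integer by integrability and is nonzero for a suitable k. If it is negative, e
    and f are exchanged. *)
Lemma shift_exists : exists2 M : nat, (0 < M)%N & forall r : deg', inG (deg0 r) ->
  exists Th : V -> V, linear Th /\
    forall l v, Tk l v -> Tk (l + M%:Z *: r) (Th v) /\ (Th v = 0 -> v = 0).
Proof.
have [a [e [f [h [we wf an Eh [ah Bn]]]]]] := sl2_exists LM.
pose k1 : deg := (@mord K D ord0)%:Z *: delta_mx 0 ord0.
have Gk1 : inG k1.
  move=> i; rewrite !mxE /=; have [->|_] := eqVneq i ord0.
    by rewrite mulr1; exact: dvdzz.
  by rewrite mulr0; exact: dvdz0.
(* the degree k = 0 works unless lam(h) = 0, and then k_0 = m_0 does *)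
have [k [Gk Nn]] : exists k, inG k /\ lam.1.1 h + B e f * ((k 0 ord0)%:~R * C0) != 0.
  have [E0|Nn] := eqVneq (lam.1.1 h) 0; last first.
    by exists 0; split; [exact: in_Gamma0|rewrite mxE mul0r mulr0 addr0].
  exists k1; split=> //; rewrite E0 add0r !mulf_neq0 // ?(lm_C0 LM) // !mxE eqxx mulr1.
  by rewrite intr_eq0 eqz_nat -lt0n (m_gt0 HD).
have [v Tv vn] := Tk0_neq0.
have [Hh _ _] := (Tk_weight 0 v).1 Tv.
have [ef He Hf] := sl2_relations we wf Eh ah Gk.
have wek : gweight k a e.
  by case: we => e0 we; split=> //; rewrite -[k]add0r; exact: (gdeg_shift HD).
have wfk : gweight (- k) (- a) f.
  case: wf => f0 wf; split=> //; rewrite -[- k]add0r; apply: (gdeg_shift HD) => //.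
  exact: in_GammaN.
have an' : - a != 0 by rewrite oppr_eq0.
pose H (v : V) := rho (tX 0 (vsval h)) v + (B e f * ((k 0 ord0)%:~R * C0)) *: v.
have Hv : H v = (lam.1.1 h + B e f * ((k 0 ord0)%:~R * C0)) *: v.
  by rewrite /H Hh -scalerDl.
have [q [p Epq]] := @weight_int _ _ (rho (tX k e)) (rho (tX (- k) f)) H 1
  (rhoX_lin LM (proj1 wek)) (rhoX_lin LM (proj1 wfk)) ef He Hf
  (fun v => real_nilpotent Vint an' wfk v) (fun v => real_nilpotent Vint an wek v) v _ vn Hv.
rewrite mul1r in Epq.
have [z Ez] : exists z : int, lam.1.1 h + B e f * ((k 0 ord0)%:~R * C0) = z%:~R.
  by exists (q%:Z - 2 * p%:Z); rewrite Epq rmorphB rmorphM.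
rewrite Ez intr_eq0 in Nn.
case: z Ez Nn => [[|M]|M] Ez // _.
  exists M.+1 => // r Gr; exact: (shift_aux we wf an Eh ah Gk Ez Gr).
exists M.+1 => // r Gr.
apply: (@shift_aux (- a) f e (- h) (- k) M.+1 r) => //.
- by rewrite opprK.
- by rewrite lieC Eh linearN.
- by rewrite opp_lfunE linearN /= opprK.
- exact: in_GammaN.
rewrite linearN /= mxE rmorphN mulNr mulrN (bformC HD) -opprD Ez NegzE rmorphN opprK //.
Qed.

(** * Bijectivity of t^r on T *)

Let C0n := lm_C0 LM.

Local Notation G r := (inG (deg0 r)).

Lemma deg0N (r : deg') : deg0 (- r) = - deg0 r.
Proof.
apply/eqP; rewrite -addr_eq0 -deg0D addNr; apply/eqP/rowP => i.
case: (unliftP ord0 i) => [j ->|->]; rewrite ?deg0_lift ?deg0_0 !mxE //.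
Qed.

Lemma deg0_zero : deg0 (0 : deg') = 0 :> deg.
Proof. by rewrite -{1}(subrr (0 : deg')) deg0D deg0N subrr. Qed.

Lemma G0 : G (0 : deg'). Proof. by rewrite deg0_zero; exact: in_Gamma0. Qed.
Lemma GD (r s : deg') : G r -> G s -> G (r + s).
Proof. by rewrite deg0D; exact: in_GammaD. Qed.
Lemma GN (r : deg') : G r -> G (- r).
Proof. by rewrite deg0N; exact: in_GammaN. Qed.

(** [kk r] is t^r in A(m) and [dz r] is t^r d_0, while [kp j r] and [dd j r] are t^r K_i
    and t^r d_i for i = [lift ord0 j]. *)
Definition kk (r : deg') (v : V) : V := C0^-1 *: rho (tK (deg0 r) ord0) v.
Definition kp (j : 'I_n) (r : deg') : V -> V := rho (tK (deg0 r) (lift ord0 j)).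
Definition dd (j : 'I_n) (r : deg') : V -> V := rho (td (deg0 r) (lift ord0 j)).
Definition dz (r : deg') : V -> V := rho (td (deg0 r) ord0).

Lemma tz_K r i : G r -> tau_zero (tK (deg0 r) i : tau_sym D).
Proof. by move=> Gr; split=> //; exact: deg0_0. Qed.
Lemma tz_d r i : G r -> tau_zero (td (deg0 r) i : tau_sym D).
Proof. by move=> Gr; split=> //; exact: deg0_0. Qed.

Lemma rtK_lin r i : G r -> linear (rho (tK (deg0 r) i)).
Proof. by move=> Gr; exact: (rho_lin LM (tau_zero_ok (tz_K i Gr))). Qed.
Lemma kk_lin r : G r -> linear (kk r).
Proof. by move=> Gr; apply: lin_scale; exact: rtK_lin. Qed.

Lemma kk_T r v : G r -> T v -> T (kk r v).
Proof.
move=> Gr Tv; apply: (subspZ T_subspace).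
exact: (T_zero (tz_K _ Gr)).
Qed.

Lemma kk_Tk r l v : G r -> Tk l v -> Tk (l + r) (kk r v).
Proof.
move=> Gr Tv; apply: (subspZ (Tk_subspace _)).
exact: (Tk_rho (tz_K _ Gr)).
Qed.

Lemma kk0 v : kk 0 v = v.
Proof. by rewrite /kk deg0_zero (lm_K0 LM) scalerA mulVf // scale1r. Qed.

Lemma kp0 j v : kp j 0 v = 0.
Proof. by rewrite /kp deg0_zero (lm_Ki LM). Qed.

Lemma tK_comm r i s j v : G r -> G s ->
  rho (tK (deg0 r) i) (rho (tK (deg0 s) j) v) = rho (tK (deg0 s) j) (rho (tK (deg0 r) i) v).
Proof.
by move=> Gr Gs; have /eqP := tau_KK HV i j v Gr Gs; rewrite subr_eq0 => /eqP.
Qed.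

Lemma kk_comm r s v : G r -> G s -> kk r (kk s v) = kk s (kk r v).
Proof.
move=> Gr Gs; rewrite /kk !(linZ (rtK_lin _ _)) //.
by rewrite tK_comm.
Qed.

Lemma rhoK_deg0 q r v : rhoK rho (deg0 q) r v =
  \sum_(p < n) (q 0 p)%:~R *: rho (tK r (lift ord0 p)) v.
Proof.
rewrite /rhoK big_ord_recl deg0_0 scale0r add0r.
by apply: eq_bigr => p _; rewrite deg0_lift.
Qed.

Lemma d_tK q i r b v : G q -> G r ->
  rho (td (deg0 q) i) (rho (tK (deg0 r) b) v) = rho (tK (deg0 r) b) (rho (td (deg0 q) i) v) +
  ((deg0 r 0 i)%:~R *: rho (tK (deg0 (q + r)) b) v
   + (i == b)%:R *: \sum_(p < n) (q 0 p)%:~R *: kp p (q + r) v).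
Proof.
move=> Gq Gr; rewrite (commute_br (tau_dK HV i b v Gq Gr)) rhoK_deg0 -deg0D.
by [].
Qed.

Lemma d_kk q i r v : G q -> G r ->
  dd i q (kk r v) = kk r (dd i q v) + (r 0 i)%:~R *: kk (q + r) v.
Proof.
move=> Gq Gr; rewrite /kk /dd (linZ (rho_lin LM (tau_zero_ok (tz_d _ Gq)))) d_tK //.
by rewrite deg0_lift scale0r addr0 scalerDr !scalerA [_ * C0^-1]mulrC.
Qed.

(** The algebra generated by the central symbols that preserve T: its members commute
    with each other, and with their derivatives by [Zop_der]. *)
Inductive Zop : (V -> V) -> Prop :=
| Zop0 : Zop (fun=> 0)
| ZopK r i : G r -> Zop (rho (tK (deg0 r) i))
| ZopL a y z : Zop y -> Zop z -> Zop (fun v => a *: y v + z v)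
| ZopC y z : Zop y -> Zop z -> Zop (y \o z).

Lemma Zop_lin y : Zop y -> linear y.
Proof.
elim=> [|r i Gr|a z w _ lz _ lw|z w _ lz _ lw].
- by move=> a u v; rewrite scaler0 addr0.
- exact: rtK_lin.
- have := lin_addf a 1 lz lw.
  by under eq_fun do rewrite scale1r.
- exact: lin_comp.
Qed.

Lemma Zop_T y v : Zop y -> T v -> T (y v).
Proof.
move=> Zy; elim: Zy v => [|r i Gr|a z w _ IHz _ IHw|z w _ IHz _ IHw] v Tv.
- exact: (subsp0 T_subspace).
- exact: (T_zero (tz_K _ Gr)).
- by apply: (subspL T_subspace); [exact: IHz|exact: IHw].
- by apply: IHz; exact: IHw.
Qed.

Lemma ZopK_comm r i y v : G r -> Zop y -> 
  rho (tK (deg0 r) i) (y v) = y (rho (tK (deg0 r) i) v).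
Proof.
move=> Gr Zy; have lr := rtK_lin i Gr.
elim: Zy v => [|s j Gs|a z w _ IHz _ IHw|z w _ IHz _ IHw] v.
- exact: (lin0 lr).
- exact: tK_comm.
- by rewrite lr IHz IHw.
- by rewrite /= IHz IHw.
Qed.

Lemma Zop_comm y z v : Zop y -> Zop z -> y (z v) = z (y v).
Proof.
move=> Zy Zz; elim: Zy v => [|s j Gs|a y1 w _ IHz _ IHw|y1 w _ IHz _ IHw] v.
- by rewrite (lin0 (Zop_lin Zz)).
- exact: ZopK_comm.
- by rewrite (Zop_lin Zz) IHz IHw.
- by rewrite /= IHw IHz.
Qed.

Lemma Zop_scale a y : Zop y -> Zop (fun v => a *: y v).
Proof.
move=> Zy; have := ZopL a Zy Zop0; congr Zop.
by apply/funext => v; rewrite addr0.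
Qed.

Lemma Zop_sum I (r : seq I) (F : I -> V -> V) : (forall i, Zop (F i)) ->
  Zop (fun v => \sum_(i <- r) F i v).
Proof.
move=> ZF; elim: r => [|i r IH].
  by have := Zop0; congr Zop; apply/funext => v; rewrite big_nil.
have := ZopL 1 (ZF i) IH; congr Zop; apply/funext => v.
by rewrite big_cons scale1r.
Qed.

Lemma Zop_kk r : G r -> Zop (kk r).
Proof. by move=> Gr; apply: Zop_scale; exact: ZopK. Qed.

Lemma Zop_sub y z : Zop y -> Zop z -> Zop (fun v => y v - z v).
Proof.
move=> Zy Zz; have := ZopL (-1) Zz Zy; congr Zop.
by apply/funext => v; rewrite scaleN1r addrC.
Qed.

Definition derives s (y w : V -> V) := forall v, T v ->
  rho s (y v) = y (rho s v) + w v /\ y (w v) = w (y v).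

Lemma Zop_der s y : tau_zero s -> Zop y -> exists2 w, Zop w & 
  forall v, rho s (y v) = y (rho s v) + w v.
Proof.
move=> zs; have ls := rho_lin LM (tau_zero_ok zs).
elim=> [|r i Gr|a z w Zz [z' Zz' Ez] Zw [w' Zw' Ew]|z w Zz [z' Zz' Ez] Zw [w' Zw' Ew]].
- by exists (fun=> 0) => [|v]; [exact: Zop0|rewrite (lin0 ls) addr0].
- case: s zs {ls} => [k x [[kx wx] k0]|r' i' [Gr' r0]|r' i' zs].
  + exists (fun=> 0) => [|v]; first exact: Zop0.
    by rewrite addr0; have /eqP := tau_KX HV i v Gr kx; rewrite subr_eq0 => /eqP.
  + exists (fun=> 0) => [|v]; first exact: Zop0.
    by rewrite addr0; have /eqP := tau_KK HV i' i v Gr' Gr; rewrite subr_eq0 => /eqP.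
  + have Er' := sdeg_deg0 zs; rewrite /= in Er'; move: zs; rewrite Er'.
    set q := \row_j _ => -[Gq _].
    exists (fun v => (deg0 r 0 i')%:~R *: rho (tK (deg0 (q + r)) i) v
     + (i' == i)%:R *: \sum_(p < n) (q 0 p)%:~R *: kp p (q + r) v) => [|v].
      have Gqr := GD Gq Gr.
      apply: ZopL; first exact: ZopK.
      apply: Zop_scale; apply: Zop_sum => p; apply: Zop_scale; exact: ZopK.
    exact: d_tK.
- exists (fun v => a *: z' v + w' v) => [|v]; first exact: ZopL.
  by rewrite ls Ez Ew scalerDr addrACA.
- exists (fun v => z (w' v) + z' (w v)) => [|v].
    have := ZopL 1 (ZopC Zz Zw') (ZopC Zz' Zw); congr Zop.
    by apply/funext => v; rewrite scale1r.
  by rewrite /= Ez Ew (linD (Zop_lin Zz)) addrA.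
Qed.

Lemma iter_T y N v : (forall u, T u -> T (y u)) -> T v -> T (iter N y v).
Proof. by move=> Ty Tv; elim: N => //= N; exact: Ty. Qed.

(** The commutator of s and y^(N+1) is (N + 1) y^N w, as y commutes with w = [s, y]. *)
Lemma derives_iter s y w N v : tau_zero s -> linear y -> (forall u, T u -> T (y u)) ->
  derives s y w -> T v ->
  iter N.+1 y (rho s v) = rho s (iter N.+1 y v) - N.+1%:R *: w (iter N y v).
Proof.
move=> zs ly Ty dy Tv; elim: N => [|N IH] /=.
  by have [-> _] := dy v Tv; rewrite scale1r addrK.
have TN := iter_T N Ty Tv; have TN1 : T (y (iter N y v)) := iter_T N.+1 Ty Tv.
rewrite -[y (iter N y (rho s v))]/(iter N.+1 y (rho s v)).
rewrite IH (linB ly) (linZ ly).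
have [_ ->] := dy _ TN; have [-> _] := dy _ TN1.
rewrite -[N.+2]addn1 natrD scalerDl scale1r /=.
by rewrite opprD addrACA subrr addr0.
Qed.

Definition nilT (y : V -> V) := forall v, T v -> exists N, iter N y v = 0.

(** The vectors killed by some power of y form a subspace, which is stable under the
    symbols of [tau_zero] by [derives_iter]. *)
Lemma inj_or_nil y : linear y -> (forall u, T u -> T (y u)) ->
  (forall s, tau_zero s -> exists w, derives s y w) ->
  (exists v, [/\ T v, v != 0 & y v = 0]) -> nilT y.
Proof.
move=> ly Ty dy [u [Tu un yu]].
pose T' := [set v | T v /\ exists N, iter N y v = 0].
suff H : T `<=` T' by move=> v /H [].
have lN N := lin_iter N ly.
have more v N M : iter N y v = 0 -> iter (M + N) y v = 0.
  by move=> Nv; rewrite iterD Nv (lin0 (lN M)).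
apply: T_irr.
- split; first by split; [exact: (subsp0 T_subspace)|exists 0%N].
  move=> a v1 v2 [T1 [N1 E1]] [T2 [N2 E2]]; split; first exact: (subspL T_subspace).
  by exists (N1 + N2)%N; rewrite lN (more _ _ N1 E2) addnC (more _ _ N2 E1) scaler0 addr0.
- by move=> v [].
- by exists u => //; split=> //; exists 1%N.
- move=> s v zs [Tv [N EN]]; split; first exact: T_zero.
  exists N.+1; have [w dw] := dy s zs.
  rewrite (derives_iter N zs ly Ty dw Tv) /= EN (lin0 ly).
  have ls := rho_lin LM (tau_zero_ok zs).
  have [E0 _] := dw 0 (subsp0 T_subspace).
  have -> : w 0 = 0 by move: E0; rewrite (lin0 ly) (lin0 ls) (lin0 ly) add0r.
  by rewrite (lin0 ls) scaler0 subr0.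
Qed.

Lemma Zop_derives s y : tau_zero s -> Zop y -> exists w, derives s y w.
Proof.
move=> zs Zy; have [w Zw Ew] := Zop_der zs Zy.
by exists w => v Tv; split=> //; exact: (Zop_comm v Zy Zw).
Qed.

Lemma Zop_inj_or_nil y : Zop y -> (exists v, [/\ T v, v != 0 & y v = 0]) -> nilT y.
Proof.
move=> Zy; apply: inj_or_nil; first exact: Zop_lin.
  by move=> u; exact: Zop_T.
by move=> s zs; exact: Zop_derives.
Qed.

Lemma dd_lin i r : G r -> linear (dd i r).
Proof. by move=> Gr; exact: (rho_lin LM (tau_zero_ok (tz_d _ Gr))). Qed.

Lemma dd_Tk i r l v : G r -> Tk l v -> Tk (l + r) (dd i r v).
Proof. by move=> Gr; exact: (Tk_rho (tz_d _ Gr)). Qed.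

Lemma row_nz (r : deg') : r != 0 -> exists i, r 0 i != 0.
Proof.
move=> rn; apply: contrapT => N; case/eqP: rn; apply/rowP => i; rewrite mxE.
by apply: contrapT => /eqP ri; apply: N; exists i.
Qed.

Lemma kk_iter_Tk r l N v : G r -> Tk l v -> Tk (l + N%:Z *: r) (iter N (kk r) v).
Proof.
move=> Gr Tv; elim: N => [|N IH]; first by rewrite scale0r addr0.
have := kk_Tk Gr IH; rewrite /= -addrA -{2}[r]scale1r -scalerDl.
by rewrite -[N.+1]addn1 PoszD.
Qed.

(** The commutator of t^(-r) d_i and t^r is the nonzero scalar r_i, as in the Weyl
    algebra, and this makes a locally nilpotent t^r surjective. *)
Lemma kk_surj_nil r : G r -> nilT (kk r) -> r != 0 -> forall l v, Tk (l + r) v ->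
  exists2 u, Tk l u & kk r u = v.
Proof.
move=> Gr nk /row_nz [i ri].
have Gr' := GN Gr; have lk := kk_lin Gr.
pose ri' : K := (r 0 i)%:~R; have rn : ri' != 0 by rewrite /ri' intr_eq0.
have der : derives (td (deg0 (- r)) (lift ord0 i)) (kk r) (fun v => ri' *: v).
  move=> v Tv; split; last by rewrite (linZ lk).
  by rewrite -/(dd i (- r)) d_kk // addNr kk0.
move=> l v Tv; have [N EN] := nk v (Tk_T Tv).
elim: N v Tv EN => [|N IH] v Tv EN.
  by exists 0; [exact: (subsp0 (Tk_subspace _))|rewrite (lin0 lk) -EN].
have E := derives_iter N (tz_d (lift ord0 i) Gr') lk (fun u => @kk_T r u Gr) der (Tk_T Tv).
rewrite EN (lin0 (rho_lin LM (tau_zero_ok (tz_d _ Gr')))) sub0r in E.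
have Td : Tk l (dd i (- r) v).
  by have := dd_Tk i Gr' Tv; rewrite addrK.
pose c : K := N.+1%:R * ri'; have cn : c != 0 by rewrite mulf_neq0 // pnatr_eq0.
pose v' := kk r (dd i (- r) v) + c *: v.
have Tv' : Tk (l + r) v'.
  apply: (subspD (Tk_subspace _)); first exact: kk_Tk.
  exact: (subspZ (Tk_subspace _)).
have [||u Tu Eu] := IH v' => //.
  rewrite (linD (lin_iter N lk)) (linZ (lin_iter N lk) c v) -iterSr /dd E.
  by rewrite scalerA addNr.
exists (c^-1 *: (u - dd i (- r) v)).
  by apply: (subspZ (Tk_subspace _)); exact: (subspB (Tk_subspace _)).
by rewrite (linZ lk c^-1 _) (linB lk) Eu /v' addrAC subrr add0r scalerA mulVf // scale1r.
Qed.

Lemma kk_iter_surj r : G r -> nilT (kk r) -> r != 0 -> forall N l v, Tk (l + N%:Z *: r) v ->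
  exists2 u, Tk l u & iter N (kk r) u = v.
Proof.
move=> Gr nk rn; elim=> [|N IH] l v; first by rewrite scale0r addr0; exists v.
have -> : l + N.+1%:Z *: r = (l + N%:Z *: r) + r.
  by rewrite -addrA -{3}[r]scale1r -scalerDl -[N.+1]addn1 PoszD.
move=> /(kk_surj_nil Gr nk rn) [u Tu Eu]; have [w Tw Ew] := IH l u Tu.
by exists w => //; rewrite /= Ew.
Qed.

(** A t^r with a kernel is locally nilpotent, hence surjective between weight spaces. In
    the presence of the injections of [shift_exists] between these spaces of finite
    dimension it is also injective, and thus not nilpotent. *)
Lemma kk_inj r v : G r -> T v -> kk r v = 0 -> v = 0.
Proof.
move=> Gr Tv kv; have [r0|rn] := eqVneq r 0; first by rewrite r0 kk0 in kv.
apply: contrapT => /eqP vn.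
have nk : nilT (kk r) by apply: Zop_inj_or_nil; [exact: Zop_kk|exists v].
have [M M0 HM] := shift_exists; have [Th [lTh HTh]] := HM r Gr.
have lk := kk_lin Gr.
have inj l u : Tk l u -> kk r u = 0 -> u = 0.
  move=> Tu ku.
  apply: (@surj_inj_inj _ _ _ (Tk l) (Tk (l + M%:Z *: r)) (Tk_subspace l)
    (Tk_subspace _) (Tk_findim l) (Tk_findim _) (iter M (kk r)) Th
    (lin_iter M lk) lTh _ _ _ _ u Tu).
  - by move=> w; exact: kk_iter_Tk.
  - by move=> w /HTh [].
  - by move=> w; exact: kk_iter_surj.
  - by move=> w /HTh [].
  - by rewrite -(prednK M0) iterSr ku (lin0 (lin_iter _ lk)).
have [u Tu un] := Tk0_neq0.
have [N Nn N0] := first_zero un (nk u (Tk_T Tu)).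
by case/eqP: Nn; apply: (inj _ _ (kk_iter_Tk N Gr Tu)).
Qed.

(** A power of t^r and [shift_exists] for - r give an injection in the other
    direction. *)
Lemma kk_surj r l v : G r -> Tk (l + r) v -> exists2 u, Tk l u & kk r u = v.
Proof.
move=> Gr Tv; have Gr' := GN Gr; have lk := kk_lin Gr.
have [M M0 HM] := shift_exists; have [Th [lTh HTh]] := HM (- r) Gr'.
pose h := Th \o iter M.-1 (kk r).
have hT w : Tk (l + r) w -> Tk l (h w) /\ (h w = 0 -> w = 0).
  move=> Tw; have T1 := kk_iter_Tk M.-1 Gr Tw; have [T2 i2] := HTh _ _ T1.
  split.
    have E : l + r + M.-1%:Z *: r + M%:Z *: (- r) = l.
      have -> : M%:Z = M.-1%:Z + 1 by rewrite -PoszD addn1 prednK.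
      rewrite scalerN scalerDl scale1r.
      by rewrite -[l + r + _]addrA [r + _]addrC addrK.
    by rewrite E in T2.
  move=> /i2; elim: (M.-1) => //= N IH E; apply: IH; apply: (kk_inj Gr) E.
  by apply: iter_T (Tk_T Tw) => u; exact: kk_T.
have lh : linear h by apply: lin_comp => //; exact: lin_iter.
apply: (@inj_inj_surj _ _ _ (Tk l) (Tk (l + r)) (Tk_subspace l)
    (Tk_subspace _) (Tk_findim l) (Tk_findim _) (kk r) h
    lk lh _ _ _ _ v Tv).
- by move=> w; exact: kk_Tk.
- by move=> w /hT [].
- by move=> w /Tk_T; exact: kk_inj.
- by move=> w /hT [].
Qed.

(** An eigenvector on T_0 of y followed by the inverse of t^q. *)
Lemma pencil_Tk (y : V -> V) q : G q -> linear y ->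
  (forall l v, Tk l v -> Tk (l + q) (y v)) ->
  exists c v, [/\ T v, v != 0 & y v = c *: kk q v].
Proof.
move=> Gq ly yT; have yq v : Tk 0 v -> Tk q (y v) by move/yT; rewrite add0r.
have [||||c [v [Tv vn Ev]]] := @pencil_singular K V V (Tk 0) (Tk q) (Tk_subspace 0)
  (Tk_subspace q) (Tk_findim 0) (Tk_findim q) y (kk q)
  (linear_onW ly) (linear_onW (kk_lin Gq)) yq.
- by move=> v Tv; have := kk_Tk Gq Tv; rewrite add0r.
- exact: Tk0_neq0.
- by move=> v /Tk_T; exact: kk_inj.
- by move=> w Tw; apply: kk_surj => //; rewrite add0r.
by exists c, v; split=> //; exact: Tk_T Tv.
Qed.

(** Finite dimension and the bijections t^s give a least P with y^P = 0 on all T_s with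
    s in Gamma. By [derives_iter] the derivative w kills y^(P-1) on these spaces. *)
Lemma nil_der_not_inj (y w : V -> V) q i r : linear y -> G q ->
  (forall l v, Tk l v -> Tk (l + q) (y v)) -> nilT y ->
  (forall s v, G s -> T v -> y (kk s v) = kk s (y v)) -> G r ->
  derives (td (deg0 r) (lift ord0 i)) y w ->
  exists v, [/\ T v, v != 0 & w v = 0].
Proof.
move=> ly Gq yT ny yk Gr dw; apply: contrapT => N.
have yTT u : T u -> T (y u).
  move=> Tu; move: (T_span Tu).
  by apply: (lspan_lin_sub ly T_subspace) => u' [l Tu']; exact: Tk_T (yT _ _ Tu').
have winj v : T v -> w v = 0 -> v = 0.
  by move=> Tv wv; apply: contrapT => /eqP vn; apply: N; exists v.
pose Q p := forall s v, G s -> Tk s v -> iter p y v = 0.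
have exQ : exists p, `[< Q p >].
  have [p Hp] := findim_nilp (Tk_subspace 0) (Tk_findim 0) ly
    (fun v Tv => ny v (Tk_T Tv)).
  exists p; apply/asboolP => s v Gs Tv.
  have [u Tu <-] : exists2 u, Tk 0 u & kk s u = v by apply: kk_surj; rewrite ?add0r.
  have -> : iter p y (kk s u) = kk s (iter p y u).
    elim: (p) => //= p' ->; apply: yk => //.
    by apply: iter_T (Tk_T Tu).
  by rewrite Hp // (lin0 (kk_lin Gs)).
case: (ex_minnP exQ) => [[|p]] /asboolP Qp Pmin.
  have [u Tu un] := Tk0_neq0; case/eqP: un; exact: (Qp _ _ G0 Tu).
suff /asboolP /Pmin : Q p by rewrite ltnn.
move=> s v Gs Tv; apply: winj; first exact: iter_T (Tk_T Tv).
have := derives_iter p (tz_d (lift ord0 i) Gr) ly yTT dw (Tk_T Tv).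
rewrite (Qp s v) // (lin0 (rho_lin LM (tau_zero_ok (tz_d _ Gr)))) sub0r.
rewrite (Qp (s + r)) //; [|exact: GD|exact: dd_Tk].
by move/eqP; rewrite eq_sym oppr_eq0 scaler_eq0 pnatr_eq0 => /eqP.
Qed.

(** * Multiplicativity of t^r on T *)

Lemma Zop_nil_der y w q i r : Zop y -> G q -> (forall l v, Tk l v -> Tk (l + q) (y v)) ->
  nilT y -> G r -> Zop w -> (forall v, dd i r (y v) = y (dd i r v) + w v) ->
  exists v, [/\ T v, v != 0 & w v = 0].
Proof.
move=> Zy Gq yT ny Gr Zw dw.
apply: (nil_der_not_inj (Zop_lin Zy) Gq yT ny _ Gr (i := i)).
- by move=> s v Gs _; exact: (Zop_comm v Zy (Zop_kk Gs)).
- by move=> v _; split; [exact: dw|exact: (Zop_comm v Zy Zw)].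
Qed.

Lemma nilT0 y : (forall v, T v -> y v = 0) -> nilT y.
Proof. by move=> y0 v Tv; exists 1%N; exact: y0. Qed.

(** Some t^r t^r - c t^(2r) is nilpotent. Its commutator with t^(-r) d_i is 2 r_i (1 -
    c) t^r, which must have a kernel, so c = 1. *)
Lemma kk_sq_nil r : G r -> r != 0 -> nilT (fun v => kk r (kk r v) - kk (r + r) v).
Proof.
move=> Gr rn; have Grr := GD Gr Gr; have lr := kk_lin Gr; have lrr := kk_lin Grr.
have sqT l v : Tk l v -> Tk (l + (r + r)) ((kk r \o kk r) v).
  by move=> Tv; rewrite addrA; apply: kk_Tk => //; exact: kk_Tk.
have [c [u [Tu un Eu]]] := pencil_Tk Grr (lin_comp lr lr) sqT.
pose y v := kk r (kk r v) - c *: kk (r + r) v.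
have Zy : Zop y.
  apply: (Zop_sub (ZopC (Zop_kk Gr) (Zop_kk Gr))).
  exact: Zop_scale (Zop_kk Grr).
have yT l v : Tk l v -> Tk (l + (r + r)) (y v).
  move=> Tv; apply: (subspB (Tk_subspace _)); first exact: sqT.
  by apply: (subspZ (Tk_subspace _)); exact: kk_Tk.
have ny : nilT y.
  apply: (Zop_inj_or_nil Zy); exists u; split=> //.
  by rewrite /y -[kk r (kk r u)]/((kk r \o kk r) u) Eu subrr.
have [i ri] := row_nz rn; have Gr' := GN Gr.
pose w v := (2 * (r 0 i)%:~R * (1 - c)) *: kk r v.
have [v [Tv vn /eqP]] : exists v, [/\ T v, v != 0 & w v = 0].
  apply: (Zop_nil_der (i := i) Zy Grr yT ny Gr' (Zop_scale _ (Zop_kk Gr))) => v.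
  have lx : linear (dd i (- r)) := dd_lin i Gr'.
  rewrite /y (linB lx) (linZ lx c (kk _ _)) !d_kk // addNr !kk0.
  rewrite (linD lr) (linZ lr _ v) addrA addNr add0r mxE scalerDr scalerA.
  rewrite -[kk r (kk r _) + _ + _]addrA opprD addrACA; congr (_ + _).
  by rewrite -scalerDl -scalerBl rmorphD /=; congr (_ *: _); ring.
rewrite scaler_eq0 => /orP[|/eqP /(kk_inj Gr Tv) v0]; last by rewrite v0 eqxx in vn.
rewrite !mulf_eq0 pnatr_eq0 intr_eq0 (negbTE ri) /= subr_eq0 => /eqP c1.
by move: ny; rewrite /y -c1; congr nilT; apply/funext => z; rewrite scale1r.
Qed.

(** The commutator of the nilpotent t^r t^r - t^(2r) with t^(q-r) d_i is the multiple by
    2 r_i of the operator in question, which therefore has a kernel. *)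
Lemma kk_mul_nil q r : G q -> G r -> nilT (fun v => kk q (kk r v) - kk (q + r) v).
Proof.
move=> Gq Gr; have [->|rn] := eqVneq r 0.
  by apply: nilT0 => v _; rewrite addr0 kk0 subrr.
have Grr := GD Gr Gr; have Gqr := GD Gq Gr; have lr := kk_lin Gr.
have [i ri] := row_nz rn; have Gq' := GD Gq (GN Gr).
pose y v := kk r (kk r v) - kk (r + r) v.
have Zy : Zop y.
  by apply: (Zop_sub (ZopC (Zop_kk Gr) (Zop_kk Gr))); exact: Zop_kk.
have yT l v : Tk l v -> Tk (l + (r + r)) (y v).
  move=> Tv; apply: (subspB (Tk_subspace _)); last exact: kk_Tk.
  by rewrite addrA; apply: kk_Tk => //; exact: kk_Tk.
pose w v := kk q (kk r v) - kk (q + r) v.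
have Zw : Zop w.
  by apply: (Zop_sub (ZopC (Zop_kk Gq) (Zop_kk Gr))); exact: Zop_kk.
have [v [Tv vn /eqP]] : exists v, [/\ T v, v != 0 & (2 * (r 0 i)%:~R) *: w v = 0].
  apply: (Zop_nil_der (i := i) Zy Grr yT (kk_sq_nil Gr rn) Gq' (Zop_scale _ Zw)) => v.
  have lx : linear (dd i (q - r)) := dd_lin i Gq'.
  rewrite /y (linB lx) !d_kk // subrK (linD lr) (linZ lr _ (kk _ v)).
  rewrite (kk_comm v Gr Gq) addrA subrK mxE.
  rewrite -[kk r (kk r _) + _ + _]addrA opprD addrACA; congr (_ + _).
  by rewrite -scalerDl /w scalerBr rmorphD /=; congr (_ *: _ - _ *: _); ring.
rewrite scaler_eq0 mulf_eq0 pnatr_eq0 intr_eq0 (negbTE ri) /= => /eqP wv.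
by apply: (Zop_inj_or_nil Zw); exists v.
Qed.

(** Some t^r K_j - c t^r is nilpotent. Its commutator with t^(-r) d_i is the scalar - c
    r_i, so c = 0. *)
Lemma kp_nil j r : G r -> nilT (kp j r).
Proof.
move=> Gr; have [->|rn] := eqVneq r 0.
  by apply: nilT0 => v _; exact: kp0.
have lp : linear (kp j r) := rtK_lin _ Gr.
have pT l v : Tk l v -> Tk (l + r) (kp j r v).
  by move=> Tv; exact: (Tk_rho (tz_K _ Gr)).
have [c [u [Tu un Eu]]] := pencil_Tk Gr lp pT.
pose y v := kp j r v - c *: kk r v.
have Zy : Zop y.
  by apply: Zop_sub; [exact: ZopK|exact: Zop_scale (Zop_kk Gr)].
have yT l v : Tk l v -> Tk (l + r) (y v).
  move=> Tv; apply: (subspB (Tk_subspace _)); first exact: pT.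
  by apply: (subspZ (Tk_subspace _)); exact: kk_Tk.
have ny : nilT y.
  by apply: (Zop_inj_or_nil Zy); exists u; split=> //; rewrite /y Eu subrr.
have [i ri] := row_nz rn; have Gr' := GN Gr.
have [v [Tv vn /eqP]] : exists v, [/\ T v, v != 0 & (- (c * (r 0 i)%:~R)) *: kk 0 v = 0].
  apply: (Zop_nil_der (i := i) Zy Gr yT ny Gr' (Zop_scale _ (Zop_kk G0))) => v.
  have lx : linear (dd i (- r)) := dd_lin i Gr'.
  rewrite /y (linB lx) (linZ lx c (kk _ _)) d_kk // /dd /kp d_tK //.
  rewrite addNr -/(kp j 0 v) kp0 scaler0 add0r.
  rewrite big1 => [|p _]; last by rewrite kp0 scaler0.
  by rewrite scaler0 addr0 kk0 scalerDr scalerA opprD addrA scaleNr.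
rewrite kk0 scaler_eq0 (negbTE vn) orbF oppr_eq0 mulf_eq0 intr_eq0 (negbTE ri) orbF.
move=> /eqP c0; move: ny; rewrite /y c0; congr nilT; apply/funext => z.
by rewrite scale0r subr0.
Qed.

(** After composition with t^(- q i), the operators act on T_0, which has finite
    dimension. *)
Lemma common_T (I : Type) (ok : I -> Prop) (y : I -> V -> V) (q : I -> deg') :
  (forall i, ok i -> [/\ G (q i), linear (y i), nilT (y i),
     forall l v, Tk l v -> Tk (l + q i) (y i v)
   & forall s v, G s -> T v -> y i (kk s v) = kk s (y i v)]) ->
  (forall i j, ok i -> ok j -> forall v, T v -> y i (y j v) = y j (y i v)) ->
  exists v, [/\ T v, v != 0 & forall i, ok i -> y i v = 0].
Proof.
move=> Hy yC; pose z i v := kk (- q i) (y i v).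
have yTT i : ok i -> forall u, T u -> T (y i u).
  move=> oi u Tu; have [_ ly _ yT _] := Hy i oi; move: (T_span Tu).
  by apply: (lspan_lin_sub ly T_subspace) => u' [l Tu']; exact: Tk_T (yT _ _ Tu').
have [|i oi|i oi v Tv|i j oi oj v Tv|i oi v Tv|v [Tv vn zv]] :=
  @common_kernel _ _ _ ok z (Tk 0) (Tk_subspace 0) (Tk_findim 0).
- exact: Tk0_neq0.
- by have [Gq ly _ _ _] := Hy i oi; apply: lin_comp => //; exact: (kk_lin (GN Gq)).
- have [Gq _ _ yT _] := Hy i oi.
  by have := kk_Tk (GN Gq) (yT _ _ Tv); rewrite addrK.
- have [Gi _ _ _ ci] := Hy i oi; have [Gj _ _ _ cj] := Hy j oj.
  have Ti := yTT i oi v (Tk_T Tv); have Tj := yTT j oj v (Tk_T Tv).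
  rewrite /z (ci _ _ (GN Gj) Tj) (cj _ _ (GN Gi) Ti) (yC j i oj oi v (Tk_T Tv)).
  exact: (kk_comm _ (GN Gi) (GN Gj)).
- have [Gi ly ni _ ci] := Hy i oi; have [N EN] := ni v (Tk_T Tv); exists N.
  have Gi' := GN Gi.
  have comm M u : T u -> iter M (y i) (kk (- q i) u) = kk (- q i) (iter M (y i) u).
    move=> Tu; elim: M => //= M ->; apply: ci => //.
    by apply: iter_T Tu => u'; exact: yTT.
  have E M u : T u -> iter M (z i) u = iter M (kk (- q i)) (iter M (y i) u).
    elim: M u => // M IH u Tu; have Tyu := yTT i oi u Tu.
    by rewrite iterSr IH ?comm ?[in RHS]iterSr ?[in RHS]iterSr //; exact: kk_T.
  by rewrite (E N v (Tk_T Tv)) EN (lin0 (lin_iter N (kk_lin Gi'))).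
exists v; split=> //; first exact: Tk_T Tv.
move=> i oi; have [Gi _ _ _ _] := Hy i oi.
by apply: (kk_inj (GN Gi)) (zv i oi); apply: yTT => //; exact: Tk_T Tv.
Qed.

Lemma tau_zero_cases s : tau_zero s ->
  (exists i q, G q /\ s = td (deg0 q) i) \/
  (forall r i v, G r -> rho s (rho (tK (deg0 r) i) v) = rho (tK (deg0 r) i) (rho s v)).
Proof.
case: s => [k x [[kx _] _]|k j [Gk _]|k j zs]; last first.
- left; have Er := sdeg_deg0 zs; rewrite /= in Er; exists j; eexists; split; last by rewrite {1}Er.
  by rewrite -Er; case: zs.
- by right=> r i v Gr; have /eqP := tau_KK HV j i v Gk Gr; rewrite subr_eq0 => /eqP.
- by right=> r i v Gr; have /eqP := tau_KX HV i v Gr kx; rewrite subr_eq0 => /eqP.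
Qed.

(** The relations t^r t^s = t^(r+s) and t^r K_j = 0. *)
Definition rel (i : (deg' * deg') + ('I_n * deg')) : V -> V :=
  match i with
  | inl (r, s) => fun v => kk r (kk s v) - kk (r + s) v
  | inr (j, r) => kp j r
  end.

Definition rel_ok (i : (deg' * deg') + ('I_n * deg')) : Prop :=
  match i with inl (r, s) => G r /\ G s | inr (j, r) => G r end.

Definition rel_deg (i : (deg' * deg') + ('I_n * deg')) : deg' :=
  match i with inl (r, s) => r + s | inr (j, r) => r end.

Lemma rel_Zop i : rel_ok i -> Zop (rel i).
Proof.
case: i => [[r s] [Gr Gs]|[j r] Gr]; last exact: ZopK.
apply: (Zop_sub (ZopC (Zop_kk Gr) (Zop_kk Gs))); exact: (Zop_kk (GD Gr Gs)).
Qed.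

(** The common kernel of the nilpotent operators [rel i] is nonzero and stable under
    [tau_zero]. *)
Lemma T_relations v : T v -> forall i, rel_ok i -> rel i v = 0.
Proof.
pose T' := [set v | T v /\ forall i, rel_ok i -> rel i v = 0].
suff H : T `<=` T' by move=> /H [].
apply: T_irr.
- split.
    by split=> [|i oi]; [exact: (subsp0 T_subspace)|exact: (lin0 (Zop_lin (rel_Zop oi)))].
  move=> a u w [Tu Hu] [Tw Hw]; split=> [|i oi]; first exact: (subspL T_subspace).
  by rewrite (Zop_lin (rel_Zop oi)) Hu // Hw // scaler0 addr0.
- by move=> u [].
- have [i oi|i j oi oj u Tu|u [Tu un Hu]] := @common_T _ rel_ok rel rel_deg; last by exists u.
    split.
    + by case: i oi => [[r s] [Gr Gs]|[j r] //]; exact: GD.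
    + exact: (Zop_lin (rel_Zop oi)).
    + by case: i oi => [[r s] [Gr Gs]|[j r] Gr]; [exact: kk_mul_nil|exact: kp_nil].
    + case: i oi => [[r s] [Gr Gs]|[j r] Gr] l u Tu; last exact: (Tk_rho (tz_K _ Gr)).
      apply: (subspB (Tk_subspace _)); last exact: (kk_Tk (GD Gr Gs)).
      by rewrite /= addrA addrAC; apply: kk_Tk => //; exact: kk_Tk.
    + by move=> s u Gs _; exact: (Zop_comm u (rel_Zop oi) (Zop_kk Gs)).
  exact: (Zop_comm u (rel_Zop oi) (rel_Zop oj)).
move=> s u zs [Tu Hu]; split; first exact: T_zero.
have ls := rho_lin LM (tau_zero_ok zs).
have Hk r t : G r -> G t -> kk r (kk t u) = kk (r + t) u.
  by move=> Gr Gt; have := Hu (inl (r, t)) (conj Gr Gt) => /eqP; rewrite subr_eq0 => /eqP.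
have Hp j r : G r -> kp j r u = 0 by move=> Gr; exact: (Hu (inr (j, r))).
case: (tau_zero_cases zs) => [[i0 [q [Gq Es]]]|Cs]; last first.
  have Ck r w : G r -> rho s (kk r w) = kk r (rho s w).
    by move=> Gr; rewrite /kk (linZ ls) Cs.
  case=> [[r t] [Gr Gt]|[j r] Gr] /=.
    by rewrite -(Ck t) // -(Ck r) // -(Ck (r + t)) ?Hk ?subrr //; exact: GD.
  by rewrite -[kp j r _]Cs // -/(kp j r u) Hp // (lin0 ls).
have sum0 r : G r -> \sum_(p < n) (q 0 p)%:~R *: kp p r u = 0.
  by move=> Gr; apply: big1 => p _; rewrite Hp // scaler0.
case=> [[r t] [Gr Gt]|[j r] Gr] /=; last first.
  have Gqr := GD Gq Gr.
  have := d_tK i0 (lift ord0 j) u Gq Gr; rewrite -Es -/(kp j r u) Hp // (lin0 ls).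
  rewrite -/(kp j (q + r) u) Hp // sum0 // !scaler0 !addr0.
  by move=> E; exact: esym E.
have Grt := GD Gr Gt; have lr := kk_lin Gr.
case: (unliftP ord0 i0) Es => [i ->|->] Es.
  rewrite Es -/(dd i q u).
  have := d_kk i (kk t u) Gq Gr.
  rewrite Hk // d_kk // d_kk // (linD lr) (linZ lr _ (kk _ u)) (Hk r) //; last exact: GD.
  rewrite Hk //; last exact: GD.
  have -> : r + (q + t) = q + (r + t) by rewrite addrCA.
  rewrite -[q + r + t]addrA -[in RHS]addrA -scalerDl -rmorphD mxE [t 0 i + _]addrC.
  by move=> /addIr ->; rewrite subrr.
have Ck p w : G p -> T' w -> rho s (kk p w) = kk p (rho s w).
  move=> Gp [_ Hw]; rewrite /kk (linZ ls) Es d_tK // deg0_0 scale0r add0r.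
  rewrite big1 ?scaler0 ?addr0 // => p' _.
  by rewrite [kp _ _ _](Hw (inr (p', q + p))) ?scaler0 //; exact: GD.
have T'u : T' u by [].
have T'k : T' (kk t u).
  split; first exact: kk_T.
  move=> i oi; rewrite (Zop_comm u (rel_Zop oi) (Zop_kk Gt)) Hu //.
  exact: (lin0 (kk_lin Gt)).
by rewrite -(Ck t u Gt T'u) -(Ck r _ Gr T'k) Hk // (Ck _ _ Grt T'u) subrr.
Qed.

Lemma kk_mul r s v : G r -> G s -> T v -> kk r (kk s v) = kk (r + s) v.
Proof.
move=> Gr Gs Tv; have := T_relations Tv (i := inl (r, s)) (conj Gr Gs).
by move/eqP; rewrite subr_eq0 => /eqP.
Qed.

Lemma kp_zero j r v : G r -> T v -> kp j r v = 0.
Proof. by move=> Gr Tv; exact: (T_relations Tv (i := inr (j, r)) Gr). Qed.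

(** * The action of t^r d_0 on T *)

Local Notation lam0 := (lam.2 0 ord0).

Definition defect (r : deg') (v : V) : V := dz r v - lam0 *: kk r v.

Lemma dz_lin r : G r -> linear (dz r).
Proof. by move=> Gr; exact: (rho_lin LM (tau_zero_ok (tz_d _ Gr))). Qed.

Lemma defect_lin r : G r -> linear (defect r).
Proof.
move=> Gr; apply: lin_sub; first exact: dz_lin.
by apply: lin_scale; exact: kk_lin.
Qed.

Lemma dz_kk q r v : G q -> G r -> T v -> dz q (kk r v) = kk r (dz q v).
Proof.
move=> Gq Gr Tv; rewrite /kk (linZ (dz_lin Gq)) /dz d_tK // deg0_0 scale0r add0r.
rewrite big1 ?scaler0 ?addr0 // => p _.
by rewrite kp_zero ?scaler0 //; exact: GD.
Qed.

Lemma dz_dz q r v : G q -> G r -> dz q (dz r v) = dz r (dz q v).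
Proof.
move=> Gq Gr; have := tau_dd HV ord0 ord0 v Gq Gr.
rewrite !deg0_0 mul0r oppr0 !mulr0 addr0 !scale0r subrr add0r => /eqP.
by rewrite subr_eq0 => /eqP.
Qed.

Lemma dd_dz i q r v : G q -> G r ->
  dd i q (dz r v) = dz r (dd i q v) + (r 0 i)%:~R *: dz (q + r) v.
Proof.
move=> Gq Gr; have := commute_br (tau_dd HV (lift ord0 i) ord0 v Gq Gr).
rewrite !deg0_0 deg0_lift !mulr0 oppr0 !mulr0 addr0 !scale0r subr0 addr0 -deg0D.
by [].
Qed.

Lemma dd_defect i q r v : G q -> G r ->
  dd i q (defect r v) = defect r (dd i q v) + (r 0 i)%:~R *: defect (q + r) v.
Proof.
move=> Gq Gr; have ld := dd_lin i Gq.
rewrite /defect (linB ld) (linZ ld _ (kk _ _)) dd_dz // d_kk // scalerDr opprD addrACA.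
by rewrite scalerBr !scalerA [_ * lam0]mulrC.
Qed.

Lemma dz_T r v : G r -> T v -> T (dz r v).
Proof. by move=> Gr Tv; exact: (T_zero (tz_d _ Gr)). Qed.

Lemma defect_Tk r l v : G r -> Tk l v -> Tk (l + r) (defect r v).
Proof.
move=> Gr Tv; apply: (subspB (Tk_subspace _)).
  exact: (Tk_rho (tz_d _ Gr)).
by apply: (subspZ (Tk_subspace _)); exact: kk_Tk.
Qed.

Lemma defect_T r v : G r -> T v -> T (defect r v).
Proof.
move=> Gr Tv; apply: (subspB T_subspace); first exact: dz_T.
by apply: (subspZ T_subspace); exact: kk_T.
Qed.

Lemma defect0 v : T v -> defect 0 v = 0.
Proof.
move=> Tv; rewrite /defect kk0 /dz deg0_zero.
by have [_ ->] := (T_char v).1 Tv; rewrite subrr.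
Qed.

Lemma defect_kk q r v : G q -> G r -> T v -> defect q (kk r v) = kk r (defect q v).
Proof.
move=> Gq Gr Tv; rewrite /defect dz_kk // (linB (kk_lin Gr)) (linZ (kk_lin Gr) _ (kk _ _)).
by rewrite (kk_comm v Gq Gr).
Qed.

Lemma defect_dz q r v : G q -> G r -> T v -> defect q (dz r v) = dz r (defect q v).
Proof.
move=> Gq Gr Tv; rewrite /defect (linB (dz_lin Gr)) (linZ (dz_lin Gr) _ (kk _ _)).
by rewrite (dz_kk Gr Gq Tv) dz_dz.
Qed.

Lemma defect_comm q r v : G q -> G r -> T v -> defect q (defect r v) = defect r (defect q v).
Proof.
move=> Gq Gr Tv; rewrite {2}/defect (linB (defect_lin Gq)) (linZ (defect_lin Gq) _ (kk _ _)).
by rewrite defect_dz // defect_kk.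
Qed.

Lemma tau_zero_gen (s : tau_sym D) : tau_zero s ->
  [\/ exists k x, gring k x /\ s = tX (deg0 k) x,
      exists r, G r /\ (s = tK (deg0 r) ord0 \/ exists j, s = tK (deg0 r) (lift ord0 j)),
      exists i r, G r /\ s = td (deg0 r) (lift ord0 i)
    | exists r, G r /\ s = td (deg0 r) ord0].
Proof.
case: s => [k x|k j|k j] zs; have Er := sdeg_deg0 zs; rewrite /= in Er; move: zs;
  rewrite Er; set q := \row_j _.
- case=> -[/gdegP xq wx] _; apply: Or41; exists q, x; split=> //; split.
  + by rewrite xq deg0_0 expr0z scale1r.
  + by move=> h; rewrite wx lfunE scale0r.
  + by move=> i; rewrite xq deg0_lift.
- case=> Gq _; apply: Or42; exists q; split=> //.
  by case: (unliftP ord0 j) => [i ->|->]; [right; exists i|left].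
- case=> Gq _; case: (unliftP ord0 j) => [i ->|->]; [apply: Or43|apply: Or44].
    by exists i, q.
  by exists q.
Qed.

Lemma gring_gw k (x : g) : gring k x -> gweight (deg0 k) (0 : 'Hom(subvs_of (h0 D), K^o)) x.
Proof.
case=> s0 wx si; split; last by move=> h; rewrite wx lfunE scale0r.
apply/gdegP => i; case: (unliftP ord0 i) => [j ->|->]; first by rewrite deg0_lift.
by rewrite deg0_0 s0 expr0z scale1r.
Qed.

Lemma gring_tz k (x : g) : gring k x -> tau_zero (tX (deg0 k) x : tau_sym D).
Proof. by move=> /gring_gw gx; split=> //; exact: deg0_0. Qed.

Lemma X_d k x r i v : gring k x -> G r ->
  rho (td (deg0 r) i) (rho (tX (deg0 k) x) v) =
  rho (tX (deg0 k) x) (rho (td (deg0 r) i) v) +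
   (deg0 k 0 i)%:~R *: rho (tX (deg0 (k + r)) x) v.
Proof.
move=> /gring_gw [kx _] Gr; rewrite (commute_br (tau_dX HV i v Gr kx)) -deg0D.
by [].
Qed.

Lemma X_K k x r i v : gring k x -> G r ->
  rho (tK (deg0 r) i) (rho (tX (deg0 k) x) v) = rho (tX (deg0 k) x) (rho (tK (deg0 r) i) v).
Proof.
by move=> /gring_gw [kx _] Gr; have /eqP := tau_KX HV i v Gr kx; rewrite subr_eq0 => /eqP.
Qed.

Lemma X_lin k x : gring k x -> linear (rho (tX (deg0 k) x)).
Proof. by move=> gx; exact: (rho_lin LM (tau_zero_ok (gring_tz gx))). Qed.

Lemma X_defect k x r v : gring k x -> G r ->
  defect r (rho (tX (deg0 k) x) v) = rho (tX (deg0 k) x) (defect r v).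
Proof.
move=> gx Gr; rewrite /defect /dz X_d // deg0_0 scale0r addr0 /kk X_K //.
by rewrite (linB (X_lin gx)) !(linZ (X_lin gx)).
Qed.

Lemma defect_K q r i v : G q -> G r -> T v ->
  defect q (rho (tK (deg0 r) i) v) = rho (tK (deg0 r) i) (defect q v).
Proof.
move=> Gq Gr Tv; case: (unliftP ord0 i) => [j ->|->].
  rewrite -!/(kp j r _) !kp_zero //; last exact: defect_T.
  exact: (lin0 (defect_lin Gq)).
have E w : rho (tK (deg0 r) ord0) w = C0 *: kk r w.
  by rewrite /kk scalerA mulfV // scale1r.
by rewrite !E (linZ (defect_lin Gq) _ (kk _ _)) defect_kk.
Qed.

(** As in [kp_nil], a nilpotent [defect r] - c t^r has the scalar commutator - c r_i
    with t^(-r) d_i. *)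
Lemma defect_nil r : G r -> nilT (defect r).
Proof.
move=> Gr; have [->|rn] := eqVneq r 0; first by apply: nilT0 => v; exact: defect0.
have [c [u [Tu un Eu]]] := pencil_Tk Gr (defect_lin Gr) (fun l v => @defect_Tk r l v Gr).
pose y p v := defect p v - c *: kk p v.
have ly p : G p -> linear (y p).
  by move=> Gp; apply: lin_sub; [exact: defect_lin|apply: lin_scale; exact: kk_lin].
have yT p l v : G p -> Tk l v -> Tk (l + p) (y p v).
  move=> Gp Tv; apply: (subspB (Tk_subspace _)); first exact: defect_Tk.
  by apply: (subspZ (Tk_subspace _)); exact: kk_Tk.
have yTT p v : G p -> T v -> T (y p v).
  move=> Gp Tv; apply: (subspB T_subspace); first exact: defect_T.
  by apply: (subspZ T_subspace); exact: kk_T.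
have ykk p s v : G p -> G s -> T v -> y p (kk s v) = kk s (y p v).
  move=> Gp Gs Tv; rewrite /y (defect_kk Gp Gs Tv) [RHS](linB (kk_lin Gs)).
  by rewrite (linZ (kk_lin Gs) c (kk p v)) (kk_comm v Gp Gs).
have defect_y p s v : G p -> G s -> T v -> defect s (y p v) = y p (defect s v).
  move=> Gp Gs Tv; rewrite /y (linB (defect_lin Gs) (defect p v)) (linZ (defect_lin Gs) c (kk p v)).
  by rewrite (defect_comm Gs Gp Tv) (defect_kk Gs Gp Tv).
have yC p s v : G p -> G s -> T v -> y p (y s v) = y s (y p v).
  move=> Gp Gs Tv; rewrite {2}/y (linB (ly p Gp) (defect s v)) (linZ (ly p Gp) c (kk s v)).
  by rewrite -(defect_y p s v Gp Gs Tv) (ykk p s v Gp Gs Tv).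
have dy i q v : G q -> dd i q (y r v) = y r (dd i q v) + (r 0 i)%:~R *: y (q + r) v.
  move=> Gq; have ld := dd_lin i Gq.
  rewrite /y (linB ld (defect r v)) (linZ ld c (kk r v)) (dd_defect i v Gq Gr) (d_kk i v Gq Gr).
  rewrite [c *: (_ + _)]scalerDr opprD addrACA.
  by rewrite scalerBr !scalerA [_ * c]mulrC.
have ny : nilT (y r).
  apply: (inj_or_nil (ly r Gr)) => [v Tv|s zs|]; first exact: yTT.
    case: (tau_zero_gen zs) => [[k [x [gx ->]]]|[q [Gq Es]]|[i [q [Gq ->]]]|[q [Gq ->]]].
    - exists (fun=> 0) => v Tv; rewrite addr0 (lin0 (ly r Gr)); split=> //.
      rewrite /y (linB (X_lin gx) (defect r v)) (linZ (X_lin gx) c (kk r v)) (X_defect v gx Gr).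
      by rewrite /kk (X_K ord0 v gx Gr) (linZ (X_lin gx)).
    - exists (fun=> 0) => v Tv; rewrite addr0 (lin0 (ly r Gr)); split=> //.
      have [i ->] : exists i, s = tK (deg0 q) i by case: Es => [->|[j ->]]; eexists.
      have lq := rtK_lin i Gq.
      rewrite /y (defect_K i Gr Gq Tv) (linB lq (defect r v)) (linZ lq c (kk r v)).
      by rewrite /kk (linZ lq) tK_comm.
    - exists (fun v => (r 0 i)%:~R *: y (q + r) v) => v Tv; split; first exact: dy.
      by rewrite (linZ (ly r Gr)) yC //; exact: GD.
    - exists (fun=> 0) => v Tv; rewrite addr0 (lin0 (ly r Gr)); split=> //.
      rewrite -!/(dz q _) /y (linB (dz_lin Gq) (defect r v)) (linZ (dz_lin Gq) c (kk r v)).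
      by rewrite -(defect_dz Gr Gq Tv) (dz_kk Gq Gr Tv).
  by exists u; split=> //; rewrite /y Eu subrr.
have [i ri] := row_nz rn; have Gr' := GN Gr.
have [v [Tv vn]] : exists v, [/\ T v, v != 0 & (r 0 i)%:~R *: y (- r + r) v = 0].
  apply: (nil_der_not_inj (ly r Gr) Gr (fun l v => @yT r l v Gr) ny _ Gr' (i := i)).
    by move=> s v Gs Tv; exact: ykk.
  move=> v Tv; split; first exact: dy.
  by rewrite (linZ (ly r Gr)) yC //; rewrite addNr; exact: G0.
rewrite addNr /y defect0 // kk0 sub0r => /eqP.
rewrite scaler_eq0 intr_eq0 (negbTE ri) oppr_eq0 scaler_eq0 (negbTE vn) orbF => /eqP c0.
by move: ny; rewrite /y c0; congr nilT; apply/funext => z; rewrite scale0r subr0.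
Qed.

Lemma defect_zero r v : G r -> T v -> defect r v = 0.
Proof.
move=> Gr Tv; move: r Gr.
pose T' := [set v | T v /\ forall r, G r -> defect r v = 0].
suff H : T `<=` T' by have [_] := H v Tv.
apply: T_irr.
- split; first by split=> [|r Gr]; [exact: (subsp0 T_subspace)|exact: (lin0 (defect_lin Gr))].
  move=> a u w [Tu Hu] [Tw Hw]; split=> [|r Gr]; first exact: (subspL T_subspace).
  by rewrite (defect_lin Gr) Hu // Hw // scaler0 addr0.
- by move=> u [].
- have [r Gr|r s Gr Gs u Tu|u [Tu un Hu]] :=
    @common_T deg' (fun r => G r) defect id; last by exists u.
    split=> //; [exact: defect_lin|exact: defect_nil|by move=> l u; exact: defect_Tk|].
    by move=> s u Gs Tu; exact: defect_kk.
  exact: defect_comm.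
move=> s u zs [Tu Hu]; split=> [|r Gr]; first exact: T_zero.
case: (tau_zero_gen zs) => [[k [x [gx ->]]]|[q [Gq Es]]|[i [q [Gq ->]]]|[q [Gq ->]]].
- by rewrite X_defect // Hu // (lin0 (X_lin gx)).
- have [i ->] : exists i, s = tK (deg0 q) i by case: Es => [->|[j ->]]; eexists.
  by rewrite defect_K // Hu // (lin0 (rtK_lin i Gq)).
- have := dd_defect i u Gq Gr; rewrite !Hu //; last exact: GD.
  rewrite scaler0 addr0 (lin0 (dd_lin i Gq)) => E; exact: esym E.
- by rewrite -/(dz q u) defect_dz // Hu // (lin0 (dz_lin Gq)).
Qed.

Lemma dz_scalar r v : G r -> T v -> dz r v = lam0 *: kk r v.
Proof. by move=> Gr Tv; have /eqP := defect_zero Gr Tv; rewrite subr_eq0 => /eqP. Qed.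

(** The other symbols of [tau_zero] act on T as zero or as multiples of t^r. *)
Lemma T_irr_L (T' : set V) : is_subspace T' -> T' `<=` T -> (exists2 v, T' v & v != 0) ->
  (forall k x v, gring k x -> T' v -> T' (rho (tX (deg0 k) x) v)) ->
  (forall i r v, G r -> T' v -> T' (dd i r v)) ->
  (forall r v, G r -> T' v -> T' (kk r v)) -> T `<=` T'.
Proof.
move=> HT' T'T ex HX Hd Hk; apply: T_irr => // s v zs Tv.
case: (tau_zero_gen zs) => [[k [x [gx ->]]]|[q [Gq [->|[j ->]]]]|[i [q [Gq ->]]]|[q [Gq ->]]].
- exact: HX.
- have -> : rho (tK (deg0 q) ord0) v = C0 *: kk q v by rewrite /kk scalerA mulfV // scale1r.
  by apply: subspZ => //; exact: Hk.
- by rewrite -/(kp j q v) kp_zero //; [exact: subsp0|exact: T'T].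
- exact: Hd.
- rewrite -/(dz q v) dz_scalar //; last exact: T'T.
  by apply: subspZ => //; exact: Hk.
Qed.

(** * Components of the elements of T *)

Lemma Tk_indep (s : seq deg') (f : deg' -> V) : uniq s -> (forall l, l \in s -> Tk l (f l)) ->
  \sum_(l <- s) f l = 0 -> forall l, l \in s -> f l = 0.
Proof.
elim: s f => // l0 s IH f /= /andP[l0s us] Hf; rewrite big_cons => E.
have Hfs l : l \in s -> Tk l (f l) by move=> ls; apply: Hf; rewrite inE ls orbT.
have Hf0 : Tk l0 (f l0) by apply: Hf; rewrite inE eqxx.
have fs0 l : l \in s -> f l = 0.
  move=> ls; have l0l : l - l0 != 0.
    by rewrite subr_eq0; apply: contraNneq l0s => <-.
  have [i li] := row_nz l0l.
  pose c (l : deg') : K := (l 0 i)%:~R - (l0 0 i)%:~R.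
  have : (fun l => c l *: f l) l = 0.
    apply: (IH (fun l => c l *: f l)) => // [j js|].
      exact: (subspZ (Tk_subspace j) _ (Hfs j js)).
    have lt := td_lin (lift ord0 i).
    have := congr1 (fun v => rho (td 0 (lift ord0 i)) v -
      (lam.2 0 (lift ord0 i) + (l0 0 i)%:~R) *: v) E.
    rewrite /= (lin0 lt) scaler0 subr0 (linD lt) (lin_sum lt).
    have [_ ->] := Hf0; rewrite scalerDr opprD addrACA subrr add0r => E2.
    rewrite -[RHS]E2 scaler_sumr -sumrB big_seq [in RHS]big_seq; apply: eq_bigr => j js.
    have [_ ->] := Hfs j js; rewrite -scalerBl /c; congr (_ *: _); ring.
  move=> /eqP; rewrite scaler_eq0 /c -rmorphB intr_eq0.
  by move: li; rewrite !mxE => /negbTE -> /= /eqP.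
move=> l; rewrite inE => /orP[/eqP ->|]; last exact: fs0.
by move: E; rewrite big_seq big1 ?addr0 // => j; exact: fs0.
Qed.

(** T is the direct sum of the T_l. *)
Lemma T_extend (W : lmodType K) (phi : deg' -> V -> W) :
  (forall l a u v, Tk l u -> Tk l v -> phi l (a *: u + v) = a *: phi l u + phi l v) ->
  exists Phi : V -> W, linear_on T Phi /\
    forall l v, Tk l v -> Phi v = phi l v.
Proof.
move=> lphi.
have phi0 l : phi l 0 = 0.
  have T0 := subsp0 (Tk_subspace l).
  by have := lphi l (-1) 0 0 T0 T0; rewrite scaler0 addr0 scaleN1r addNr.
pose R (v : V) (w : W) := exists (s : seq deg') (f : deg' -> V),
  [/\ uniq s, forall l, Tk l (f l), v = \sum_(l <- s) f l & w = \sum_(l <- s) phi l (f l)].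
have T0 l := subsp0 (Tk_subspace l).
have enlarge v w s f s' : uniq s -> uniq s' -> {subset s <= s'} -> (forall l, Tk l (f l)) ->
    v = \sum_(l <- s) f l -> w = \sum_(l <- s) phi l (f l) ->
    let f' := fun l => if l \in s then f l else 0 in
    [/\ forall l, Tk l (f' l), v = \sum_(l <- s') f' l & w = \sum_(l <- s') phi l (f' l)].
  move=> us us' ss' Tf -> -> f'.
  have Es : perm_eq s [seq l <- s' | l \in s].
    apply: uniq_perm => //; first exact: filter_uniq.
    by move=> l; rewrite mem_filter; case ls : (l \in s) => //; rewrite (ss' l ls).
  split=> [l||]; first by rewrite /f'; case: ifP.
  - rewrite (perm_big _ Es) big_filter big_mkcond; apply: eq_bigr => l _.
    by rewrite /f'; case: ifP.
  - rewrite (perm_big _ Es) big_filter big_mkcond; apply: eq_bigr => l _.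
    by rewrite /f'; case: ifP => // _; rewrite phi0.
have RL a u w u' w' : R u w -> R u' w' -> R (a *: u + u') (a *: w + w').
  move=> [s [f [us Tf Eu Ew]]] [s' [f' [us' Tf' Eu' Ew']]].
  pose t := undup (s ++ s').
  have ut : uniq t := undup_uniq _.
  have st : {subset s <= t} by move=> l ls; rewrite mem_undup mem_cat ls.
  have st' : {subset s' <= t} by move=> l ls; rewrite mem_undup mem_cat ls orbT.
  have [T1 E1 E1'] := enlarge _ _ _ _ _ us ut st Tf Eu Ew.
  have [T2 E2 E2'] := enlarge _ _ _ _ _ us' ut st' Tf' Eu' Ew'.
  pose f1 (l : deg') := if l \in s then f l else 0.
  pose f2 (l : deg') := if l \in s' then f' l else 0.
  exists t, (fun l => a *: f1 l + f2 l); split=> // [l||].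
  - exact: (subspL (Tk_subspace l)).
  - by rewrite [in LHS]E1 [in LHS]E2 big_split scaler_sumr.
  - rewrite E1' E2' scaler_sumr -big_split; apply: eq_bigr => l _ /=.
    by rewrite lphi.
have R0 w : R 0 w -> w = 0.
  move=> [s [f [us Tf E ->]]]; rewrite big_seq big1 // => l ls.
  by rewrite (Tk_indep us _ (esym E) ls).
have Rk l v : Tk l v -> R v (phi l v).
  move=> Tv; exists [:: l], (fun j => if j == l then v else 0); split=> //.
  - by move=> j; case: eqP => [->|].
  - by rewrite big_seq1 eqxx.
  - by rewrite big_seq1 eqxx.
have Rfun v w w' : R v w -> R v w' -> w = w'.
  move=> H H'; have := RL (-1) _ _ _ _ H H'; rewrite scaleN1r addNr => /R0.
  by rewrite scaleN1r addrC => /eqP; rewrite subr_eq0 => /eqP ->.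
have Rex v : T v -> exists w, R v w.
  move=> Tv; apply: (@lspan_ind _ _ _ (fun v => exists w, R v w)) (T_span Tv).
    split; first by exists 0, [::], (fun=> 0); rewrite !big_nil; split.
    by move=> a u u' [w Hw] [w' Hw']; exists (a *: w + w'); exact: RL.
  by move=> u [l Tu]; exists (phi l u); exact: Rk.
have Rex' v : exists w, T v -> R v w.
  have [Tv|nT] := pselect (T v); last by exists 0.
  by have [w Hw] := Rex v Tv; exists w.
have [Phi HPhi] := choice Rex'; exists Phi; split=> [a u v Tu Tv|l v Tv].
  apply: (Rfun (a *: u + v)); first by apply: HPhi; exact: (subspL T_subspace).
  by apply: RL; exact: HPhi.
by apply: (Rfun v); [apply: HPhi; exact: Tk_T Tv|exact: Rk].
Qed.

Lemma T_ind (P : V -> Prop) : P 0 -> (forall a u v, T u -> T v -> P u -> P v -> P (a *: u + v)) ->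
  (forall l v, Tk l v -> P v) -> forall v, T v -> P v.
Proof.
move=> P0 PL Pk v Tv.
have [] // : T v /\ P v.
apply: (@lspan_ind _ _ _ (fun v => T v /\ P v)) (T_span Tv).
  split; first by split=> //; exact: (subsp0 T_subspace).
  move=> a u w [Tu Pu] [Tw Pw]; split; first exact: (subspL T_subspace).
  exact: PL.
by move=> u [l Tu]; split; [exact: Tk_T Tu|exact: Pk Tu].
Qed.

Local Notation linear_onT := (linear_on T).

Lemma linT0 (W : lmodType K) (f : V -> W) : linear_onT f -> f 0 = 0.
Proof.
move=> lf; have T0 := subsp0 T_subspace.
by have := lf (-1) 0 0 T0 T0; rewrite scaler0 addr0 scaleN1r addNr.
Qed.

Lemma linTZ (W : lmodType K) (f : V -> W) a v : linear_onT f -> T v -> f (a *: v) = a *: f v.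
Proof.
move=> lf Tv; have := lf a v 0 Tv (subsp0 T_subspace).
by rewrite (linT0 lf) !addr0.
Qed.

Lemma linTD (W : lmodType K) (f : V -> W) u v : linear_onT f -> T u -> T v -> f (u + v) = f u + f v.
Proof. by move=> lf Tu Tv; have := lf 1 u v Tu Tv; rewrite !scale1r. Qed.

Lemma linTB (W : lmodType K) (f : V -> W) u v : linear_onT f -> T u -> T v -> f (u - v) = f u - f v.
Proof.
move=> lf Tu Tv; rewrite -scaleN1r addrC lf // scaleN1r addrC //.
Qed.

Lemma linT_eq (W : lmodType K) (f h : V -> W) : linear_onT f -> linear_onT h ->
  (forall l v, Tk l v -> f v = h v) -> forall v, T v -> f v = h v.
Proof.
move=> lf lh E; apply: T_ind => //; first by rewrite !linT0.
by move=> a u v Tu Tv Eu Ev; rewrite lf // lh // Eu Ev.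
Qed.

Lemma linT_comp (W : lmodType K) (f : V -> V) (h : V -> W) :
  linear_onT f -> (forall v, T v -> T (f v)) -> linear_onT h -> linear_onT (h \o f).
Proof. by move=> lf Tf lh a u v Tu Tv /=; rewrite lf // lh //; exact: Tf. Qed.

Lemma linT_lin (W : lmodType K) b (f h : V -> W) :
  linear_onT f -> linear_onT h -> linear_onT (fun v => f v + b *: h v).
Proof.
move=> lf lh a u v Tu Tv; rewrite lf // lh // !scalerDr !scalerA [b * a]mulrC.
by rewrite addrACA.
Qed.

Lemma cmp_exists : exists c : V -> deg' -> V, (forall k, linear_onT (c^~ k)) /\
  forall l v, Tk l v -> forall k, c v k = if k == l then v else 0.
Proof.
pose phi (l : deg') (v : V) : @loop K D V := fun k => if k == l then v else 0.
have lphi (l : deg') a u v : Tk l u -> Tk l v -> phi l (a *: u + v) = a *: phi l u + phi l v.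
  move=> _ _; apply/funext => k; rewrite -[RHS]/(a *: phi l u k + phi l v k) /phi.
  by case: ifP => // _; rewrite scaler0 addr0.
have [Phi [lP PE]] := T_extend lphi.
exists Phi; split=> [k a u v Tu Tv|l v Tv k]; last by rewrite (PE l v Tv).
by rewrite lP.
Qed.

(** [cmp v k] is the component of v in T_k. *)
Definition cmp : V -> deg' -> V := projT1 (cid cmp_exists).

Lemma cmp_lin k : linear_onT (cmp^~ k).
Proof. by have [H _] := projT2 (cid cmp_exists); exact: H. Qed.

Lemma cmp_Tk l v k : Tk l v -> cmp v k = if k == l then v else 0.
Proof. by have [_ H] := projT2 (cid cmp_exists) => Tv; exact: H. Qed.

Lemma Tk_cmp v k : T v -> Tk k (cmp v k).
Proof.
move: v; apply: T_ind.
- by rewrite (linT0 (cmp_lin k)); exact: (subsp0 (Tk_subspace k)).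
- by move=> a u v Tu Tv H1 H2; rewrite cmp_lin //; exact: (subspL (Tk_subspace k)).
- by move=> l v Tv; rewrite (cmp_Tk k Tv); case: eqP => [->|_] //;
    exact: (subsp0 (Tk_subspace k)).
Qed.

Lemma cmp_eq0 v : T v -> (forall k, cmp v k = 0) -> v = 0.
Proof.
move=> Tv; have [s [us Es]] : exists s : seq deg', uniq s /\ v = \sum_(l <- s) cmp v l.
  have Tl w l : T w -> Tk l (cmp w l) by move=> Tw; exact: Tk_cmp.
  suff [s Hs] : exists s : seq deg', forall t : seq deg', uniq t -> {subset s <= t} ->
      v = \sum_(l <- t) cmp v l.
    exists (undup s); split; first exact: undup_uniq.
    by apply: Hs => [|l]; [exact: undup_uniq|rewrite mem_undup].
  move: v Tv; apply: T_ind.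
  - exists [::] => t _ _; rewrite big1 // => l _; exact: (linT0 (cmp_lin l)).
  - move=> a u v Tu Tv [s Hs] [s' Hs']; exists (s ++ s') => t ut st.
    under eq_bigr do rewrite cmp_lin //.
    rewrite big_split -scaler_sumr -Hs // -?Hs' // => l ls; apply: st; rewrite mem_cat ls ?orbT //.
  - move=> l v Tv; exists [:: l] => t ut lt.
    rewrite (bigD1_seq l) //=; last by apply: lt; rewrite inE.
    by rewrite (cmp_Tk l Tv) eqxx big1 ?addr0 // => k kl; rewrite (cmp_Tk k Tv) (negbTE kl).
by move=> c0; rewrite Es big1.
Qed.

Lemma cmp_homog (f : V -> V) (k : deg') : linear_onT f ->
  (forall l v, Tk l v -> Tk (l + k) (f v)) ->
  forall v l, T v -> cmp (f v) l = f (cmp v (l - k)).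
Proof.
move=> lf fk v l; move: v.
have Tf v : T v -> T (f v).
  move: v; apply: T_ind => [||j v /fk /Tk_T //].
    by rewrite (linT0 lf); exact: (subsp0 T_subspace).
  by move=> a u v Tu Tv H1 H2; rewrite lf //; exact: (subspL T_subspace).
apply: (@linT_eq V (fun v => cmp (f v) l) (fun v => f (cmp v (l - k)))).
- exact: (linT_comp lf Tf (cmp_lin l)).
- apply: (linT_comp (cmp_lin (l - k))) => //.
  by move=> v Tv; exact: Tk_T (Tk_cmp _ Tv).
move=> j v Tv; rewrite (cmp_Tk l (fk _ _ Tv)) (cmp_Tk _ Tv).
by rewrite subr_eq; case: ifP => // _; rewrite (linT0 lf).
Qed.

(** * Coset sums *)

Local Notation X := (fun (j : deg') (x : g) => rho (tX (deg0 j) x)).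

Lemma Gsym (a b : deg') : G (a - b) -> G (b - a).
Proof. by move=> /GN; rewrite opprB. Qed.

Lemma Gtrans (b a c : deg') : G (a - b) -> G (b - c) -> G (a - c).
Proof. by move=> /GD H /H; rewrite addrA subrK. Qed.

Lemma T_psi_exists : exists c : V -> deg' -> V, (forall k, linear_on T (c^~ k)) /\
  forall l v, Tk l v -> forall k, c v k = if `[< G (k - l) >] then kk (k - l) v else 0.
Proof.
pose phi (l : deg') (v : V) : @loop K D V :=
  fun k => if `[< G (k - l) >] then kk (k - l) v else 0.
have lphi (l : deg') a u v : Tk l u -> Tk l v -> phi l (a *: u + v) = a *: phi l u + phi l v.
  move=> _ _; apply/funext => k; rewrite -[RHS]/(a *: phi l u k + phi l v k) /phi.
  case: asboolP => [Gk|_]; last by rewrite scaler0 addr0.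
  exact: (kk_lin Gk).
have [Phi [lP PE]] := T_extend lphi.
exists Phi; split=> [k a u v Tu Tv|l v Tv k]; last by rewrite (PE l v Tv).
by rewrite lP.
Qed.

(** [psi v k] is the sum of the t^(k-l) v_l over the components v_l of v with l in k +
    Gamma. These coset sums depend only on the image of v in T / W, and they determine
    it. *)
Definition psi : V -> deg' -> V := projT1 (cid T_psi_exists).

Lemma psi_lin k : linear_on T (psi^~ k).
Proof. by have [H _] := projT2 (cid T_psi_exists); exact: H. Qed.

Lemma psi_in l v k : Tk l v -> G (k - l) -> psi v k = kk (k - l) v.
Proof.
have [_ H] := projT2 (cid T_psi_exists) => Tv Gk.
by rewrite /psi (H _ _ Tv k); case: asboolP.
Qed.

Lemma psi_out l v k : Tk l v -> ~ G (k - l) -> psi v k = 0.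
Proof.
have [_ H] := projT2 (cid T_psi_exists) => Tv Gk.
by rewrite /psi (H _ _ Tv k); case: asboolP.
Qed.

Lemma psi_diag l v : Tk l v -> psi v l = v.
Proof. by move=> Tv; rewrite (psi_in Tv) subrr ?kk0 //; exact: G0. Qed.

Lemma psi0 k : psi 0 k = 0.
Proof. exact: (linT0 (psi_lin k)). Qed.

Lemma Tk_psi v k : T v -> Tk k (psi v k).
Proof.
have H0 := subsp0 (Tk_subspace k).
move: v; apply: T_ind => [||l v Tv]; first by rewrite psi0.
  by move=> a u v Tu Tv Hu Hv; rewrite psi_lin //; exact: (subspL (Tk_subspace k)).
have [Gk|Gk] := pselect (G (k - l)); last by rewrite (psi_out Tv Gk).
by rewrite (psi_in Tv Gk); have := kk_Tk Gk Tv; rewrite addrC subrK.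
Qed.

Lemma T_psi v k : T v -> T (psi v k).
Proof. by move=> Tv; exact: Tk_T (Tk_psi k Tv). Qed.

Lemma psi_op (f : V -> V) (j : deg') : linear_on T f ->
  (forall l v, Tk l v -> Tk (l + j) (f v)) ->
  (forall r v, G r -> T v -> f (kk r v) = kk r (f v)) ->
  forall v k, T v -> psi (f v) k = f (psi v (k - j)).
Proof.
move=> lf fj fk v k; move: v.
have fT v : T v -> T (f v).
  move: v; apply: T_ind => [||l v /fj /Tk_T //].
    by rewrite (linT0 lf); exact: (subsp0 T_subspace).
  by move=> a u v Tu Tv H1 H2; rewrite lf //; exact: (subspL T_subspace).
apply: (linT_eq (f := fun v => psi (f v) k) (h := fun v => f (psi v (k - j)))).
- exact: (linT_comp lf fT (psi_lin k)).
- by apply: (linT_comp (psi_lin (k - j))) => // v Tv; exact: T_psi.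
move=> l v Tv; have E : k - (l + j) = k - j - l by rewrite opprD addrAC addrA.
have [Gk|Gk] := pselect (G (k - j - l)); last first.
  by rewrite (psi_out Tv Gk) (linT0 lf) (psi_out (fj _ _ Tv)) // E.
rewrite (psi_in Tv Gk) (psi_in (fj _ _ Tv)) E //.
by rewrite fk //; exact: Tk_T Tv.
Qed.

Lemma psi_kk r v k : G r -> T v -> psi (kk r v) k = psi v k.
Proof.
move=> Gr; move: v; apply: (linT_eq (f := fun v => psi (kk r v) k) (h := psi^~ k)).
- apply: (linT_comp (linear_onW (kk_lin Gr)) _ (psi_lin k)).
  by move=> v; exact: kk_T.
- exact: psi_lin.
move=> l v Tv; have Tv' := kk_Tk Gr Tv.
have E : k - l = k - (l + r) + r by rewrite opprD addrA subrK.
have [Gk|Gk] := pselect (G (k - (l + r))); last first.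
  rewrite (psi_out Tv' Gk) (psi_out Tv) // => H; apply: Gk.
  by have := GD H (GN Gr); rewrite E addrK.
rewrite (psi_in Tv' Gk) (psi_in Tv); last by rewrite E; exact: GD.
by rewrite E kk_mul //; exact: Tk_T Tv.
Qed.

Lemma psi_shift r v k : G r -> T v -> psi v (k + r) = kk r (psi v k).
Proof.
move=> Gr Tv; rewrite -(psi_kk (k + r) Gr Tv).
rewrite (psi_op (linear_onW (kk_lin Gr))
  (fun l v => @kk_Tk r l v Gr)) ?addrK //.
by move=> s u Gs Tu; rewrite kk_comm.
Qed.

Lemma psi_X j x v k : gring j x -> T v -> psi (X j x v) k = X j x (psi v (k - j)).
Proof.
move=> gx; apply: psi_op; first exact: linear_onW (X_lin gx).
  by move=> l u; exact: (Tk_rho (gring_tz gx)).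
by move=> r u Gr Tu; rewrite /kk (X_K _ _ gx Gr) (linZ (X_lin gx)).
Qed.

Lemma dd_zero i l v : Tk l v -> dd i 0 v = (lam.2 0 (lift ord0 i) + (l 0 i)%:~R) *: v.
Proof. by case=> _ H; rewrite /dd deg0_zero H. Qed.

Lemma dd_T i r v : G r -> T v -> T (dd i r v).
Proof. by move=> Gr Tv; exact: (T_zero (tz_d _ Gr)). Qed.

Lemma dd_linT i r : G r -> linear_on T (dd i r).
Proof. by move=> Gr; exact: linear_onW (dd_lin i Gr). Qed.

Lemma linT_sub (W : lmodType K) (f h : V -> W) :
  linear_on T f -> linear_on T h -> linear_on T (fun v => f v - h v).
Proof.
move=> lf lh a u v Tu Tv; rewrite lf // lh // scalerBr opprD.
by rewrite addrACA.
Qed.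

(** The corrections needed to move t^(k-l) across t^r d_i and across d_i differ by a
    scalar multiple of t^r that is the same for all l. *)
Lemma psi_dd i r v k : G r -> T v ->
  psi (dd i r v - dd i 0 v) k = dd i r (psi v (k - r))
    - (lam.2 0 (lift ord0 i) + ((k - r) 0 i)%:~R) *: kk r (psi v (k - r)).
Proof.
move=> Gr; have G0' : G (0 : deg') by exact: G0.
set c : K := lam.2 _ _ + _.
move: v; apply: (linT_eq (f := fun v => psi (dd i r v - dd i 0 v) k)
  (h := fun v => dd i r (psi v (k - r)) - c *: kk r (psi v (k - r)))).
- apply: (linT_comp (h := psi^~ k) (f := fun v => dd i r v - dd i 0 v)); last exact: psi_lin.
    by apply: linT_sub; exact: dd_linT.
  by move=> v Tv; apply: (subspB T_subspace); exact: dd_T.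
- have Tp v : T v -> T (psi v (k - r)) by move=> Tv; exact: T_psi.
  apply: linT_sub; first exact: (linT_comp (psi_lin _) Tp (dd_linT i Gr)).
  apply: (linT_comp (h := fun v => c *: kk r v) (psi_lin _) Tp).
  by apply: linear_onW; apply: lin_scale; exact: kk_lin.
move=> l v Tv; have Td := dd_Tk i Gr Tv; have Td0 := dd_Tk i G0' Tv.
rewrite (linTB (psi_lin k)); try exact: Tk_T Td; try exact: Tk_T Td0.
have [Gk|Gk] := pselect (G (k - r - l)); last first.
  rewrite (psi_out Tv Gk) (lin0 (dd_lin i Gr)) (lin0 (kk_lin Gr)) scaler0.
  rewrite addr0 in Td0; rewrite (psi_out Td0) => [|H]; last first.
    by apply: Gk; have := GD H (GN Gr); rewrite addrAC.
  by rewrite (psi_out Td) // opprD addrA addrAC.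
have E : k - (l + r) = k - r - l by rewrite opprD addrAC addrA.
have E' : k - l = k - r - l + r by rewrite [in RHS]addrAC subrK.
rewrite (psi_in Td) E // (psi_in Tv Gk) (d_kk i _ Gr Gk).
rewrite (dd_zero i Tv) (linTZ _ (psi_lin k)); last exact: Tk_T Tv.
rewrite (psi_in Tv) E'; last exact: GD.
rewrite (kk_mul Gr Gk); last exact: Tk_T Tv.
rewrite [r + _]addrC -[RHS]addrA; congr (_ + _); rewrite -scalerBl -scaleNr; congr (_ *: _).
by rewrite /c !mxE; ring.
Qed.

(** * The quotient of T by W *)

Local Notation W := (lspan (W_gen rho C0)).
Local Notation pi := (lproj (W_gen rho C0)).

Local Notation box := {dffun forall i : 'I_n, 'I_(@mord K D (lift ord0 i))}.

(** The degrees k with 0 <= k_i < m_i represent the cosets of Gamma. *)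
Definition box_deg (b : box) : deg' := \row_i (b i : nat)%:Z.

Lemma inG_deg0 (r : deg') : G r <-> forall i, (@mord K D (lift ord0 i) %| r 0%R i)%Z.
Proof.
split=> [H i|H i]; first by have := H (lift ord0 i); rewrite deg0_lift.
case: (unliftP ord0 i) => [j ->|->]; first by rewrite deg0_lift; exact: H.
by rewrite deg0_0; exact: dvdz0.
Qed.

Lemma box_repr (l : deg') : exists b : box, G (box_deg b - l).
Proof.
have Hm i : (`|(l 0%R i %% @mord K D (lift ord0 i))%Z| < @mord K D (lift ord0 i))%N.
  have m0 := m_gt0 HD (lift ord0 i).
  rewrite -ltz_nat gez0_abs; last by apply: modz_ge0; rewrite eqz_nat -lt0n.
  by apply: ltz_pmod; rewrite ltz_nat.
exists (finfun (fun i : 'I_n => Ordinal (Hm i))); apply/inG_deg0 => i.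
rewrite !mxE ffunE /= gez0_abs; last first.
  by apply: modz_ge0; rewrite eqz_nat -lt0n; exact: (m_gt0 HD).
by rewrite -eqz_mod_dvd modz_mod.
Qed.

Lemma box_inj (b b' : box) : G (box_deg b - box_deg b') -> b = b'.
Proof.
move=> /inG_deg0 H; apply/ffunP => i; apply/val_inj => /=.
have := H i; rewrite !mxE -eqz_mod_dvd !modz_nat eqz_nat.
by rewrite !modn_small ?ltn_ord // => /eqP.
Qed.

Definition box_of l : box := projT1 (cid (box_repr l)).

Lemma box_ofP l : G (box_deg (box_of l) - l).
Proof. exact: projT2 (cid (box_repr l)). Qed.

Lemma box_of_uniq l b : G (box_deg b - l) -> b = box_of l.
Proof. move=> H; apply: box_inj; apply: Gtrans H _; apply: Gsym; exact: box_ofP. Qed.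

Lemma W_T w : W w -> T w /\ forall k, psi w k = 0.
Proof.
apply: (@lspan_ind _ _ _ (fun w => T w /\ forall k, psi w k = 0)).
  split; first by split; [exact: (subsp0 T_subspace)|move=> k; exact: psi0].
  move=> a u v [Tu Hu] [Tv Hv]; split; first exact: (subspL T_subspace).
  by move=> k; rewrite psi_lin // Hu Hv scaler0 addr0.
move=> _ [r [v [Gr Tv ->]]]; rewrite -/(kk r v).
have Tkv := kk_T Gr Tv; split; first exact: (subspB T_subspace).
by move=> k; rewrite (linTB (psi_lin k)) // psi_kk // subrr.
Qed.

Lemma W_kk r v : G r -> T v -> W (kk r v - v).
Proof. by move=> Gr Tv; apply: lspan_in; exists r, v. Qed.

(** Modulo W, each component v_l is congruent to t^(k-l) v_l. *)
Lemma W_box v : T v -> W (v - \sum_b psi v (box_deg b)).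
Proof.
have HW := lspan_subspace (W_gen rho C0).
move: v; apply: T_ind.
- rewrite big1 ?subr0; first exact: subsp0.
  by move=> b _; exact: psi0.
- move=> a u v Tu Tv Hu Hv.
  under eq_bigr do rewrite psi_lin //.
  by rewrite big_split -scaler_sumr opprD addrACA -scalerBr; exact: subspL.
- move=> l v Tv; rewrite (bigD1 (box_of l)) //= big1 ?addr0.
    rewrite (psi_in Tv (box_ofP l)) -opprB; apply: subspN => //.
    by apply: W_kk; [exact: box_ofP|exact: Tk_T Tv].
  move=> b bl; apply: (psi_out Tv) => H.
  by case/eqP: bl; exact: box_of_uniq.
Qed.

Lemma pi_lin : linear pi. Proof. exact: lproj_linear. Qed.

(** Coset sums are invariant under t^r, so they vanish on W; conversely [W_box] recovers
    v from them. *)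
Lemma pi_eq0 v : T v -> pi v = 0 <-> forall k, psi v k = 0.
Proof.
move=> Tv; rewrite -(lin0 pi_lin) lproj_eq subr0; split=> [/W_T [] //|H].
have := W_box Tv; rewrite big1 ?subr0 // => b _; exact: H.
Qed.

Lemma pi_eq u v : T u -> T v -> pi u = pi v <-> forall k, psi u k = psi v k.
Proof.
move=> Tu Tv; have Tuv := subspB T_subspace Tu Tv; have [H1 H2] := pi_eq0 Tuv.
split=> [E k|E].
  have : psi (u - v) k = 0 by apply: H1; rewrite (linB pi_lin) E subrr.
  by rewrite (linTB (psi_lin k)) // => /eqP; rewrite subr_eq0 => /eqP.
apply/eqP; rewrite -subr_eq0 -(linB pi_lin); apply/eqP; apply: H2 => k.
by rewrite (linTB (psi_lin k)) // E subrr.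
Qed.

Lemma pi_kk r v : G r -> T v -> pi (kk r v) = pi v.
Proof. by move=> Gr Tv; apply/pi_eq => // [|k]; [exact: kk_T|rewrite psi_kk]. Qed.

Lemma pi_box v : T v -> pi v = \sum_b pi (psi v (box_deg b)).
Proof.
move=> Tv; rewrite -(lin_sum pi_lin); apply/lproj_eq; exact: W_box.
Qed.

Lemma T_repr v : T v -> T (lrepr (pi v)).
Proof.
move=> Tv; have : W (lrepr (pi v) - v) by apply/lproj_eq; rewrite lprojK.
by move=> /W_T [Tw _]; rewrite -(subrK v (lrepr _)); exact: (subspD T_subspace).
Qed.

Lemma pi_repr v : pi (lrepr (pi v)) = pi v.
Proof. exact: lprojK. Qed.

(** [ee i r] is I(u, r) for u the i-th basis vector. *)
Definition ee i r v := dd i r v - dd i 0 v.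

Lemma ee_lin i r : G r -> linear (ee i r).
Proof. by move=> Gr; apply: lin_sub; apply: dd_lin => //; exact: G0. Qed.

Lemma ee_T i r v : G r -> T v -> T (ee i r v).
Proof.
move=> Gr Tv; apply: (subspB T_subspace); apply: dd_T => //; exact: G0.
Qed.

Lemma LtI_ee u r v : Lt_act rho C0 (LtI u r) v = \sum_(i < n) u 0 i *: ee i r v.
Proof. by rewrite /= -sumrB; apply: eq_bigr => i _; rewrite -scalerBr. Qed.

Lemma Lt_act_lin s : Lt_ok D s -> linear (Lt_act rho C0 s).
Proof.
case: s => [j x|u r] ok; first exact: (X_lin ok).
move=> a v w; rewrite !LtI_ee scaler_sumr -big_split; apply: eq_bigr => i _.
by rewrite (ee_lin i ok) scalerDr !scalerA mulrC.
Qed.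

Lemma X_T j x v : gring j x -> T v -> T (X j x v).
Proof. by move=> gx Tv; exact: (T_zero (gring_tz gx)). Qed.

Lemma Lt_act_T s v : Lt_ok D s -> T v -> T (Lt_act rho C0 s v).
Proof.
case: s => [j x|u r] ok Tv; first exact: X_T.
rewrite LtI_ee; apply: (subsp_sum T_subspace) => // i _.
by apply: (subspZ T_subspace); exact: ee_T.
Qed.

Lemma Lt_act_pi0 s v : Lt_ok D s -> T v -> pi v = 0 -> pi (Lt_act rho C0 s v) = 0.
Proof.
case: s => [j x|u r] ok Tv /(pi_eq0 Tv) H.
  by apply/(pi_eq0 (X_T ok Tv)) => k; rewrite /= psi_X // H (lin0 (X_lin ok)).
rewrite LtI_ee (lin_sum pi_lin) big1 // => i _.
rewrite (linZ pi_lin) (_ : pi _ = 0) ?scaler0 //.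
apply/(pi_eq0 (ee_T i ok Tv)) => k; rewrite psi_dd // H.
by rewrite (lin0 (dd_lin i ok)) (lin0 (kk_lin ok)) scaler0 subr0.
Qed.

Lemma Vtilde_act_pi s v : Lt_ok D s -> T v ->
  Vtilde_act rho C0 s (pi v) = pi (Lt_act rho C0 s v).
Proof.
move=> ok Tv; have Tr := T_repr Tv; rewrite /Vtilde_act.
apply/eqP; rewrite -subr_eq0 -(linB pi_lin) -(linB (Lt_act_lin ok)); apply/eqP.
apply: Lt_act_pi0 => //; first exact: (subspB T_subspace).
by rewrite (linB pi_lin) pi_repr subrr.
Qed.

Lemma Vtilde_subspace : is_subspace (Vtilde rho C0).
Proof.
split; first by exists 0; [exact: (subsp0 T_subspace)|exact: (lin0 pi_lin)].
move=> a _ _ [u Tu <-] [v Tv <-]; exists (a *: u + v); last exact: pi_lin.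
exact: (subspL T_subspace).
Qed.

Lemma Vtilde_pi v : T v -> Vtilde rho C0 (pi v).
Proof. by exists v. Qed.

Lemma pi_Tk_inj l v : Tk l v -> pi v = 0 -> v = 0.
Proof.
move=> Tv /(pi_eq0 (Tk_T Tv)) /(_ l).
by rewrite (psi_diag Tv).
Qed.

Lemma Vtilde_neq0 : exists2 x, Vtilde rho C0 x & x != 0.
Proof.
have [v Tv vn] := Tk0_neq0; exists (pi v); first by exists v => //; exact: Tk_T Tv.
by apply: contra_neq vn; exact: pi_Tk_inj Tv.
Qed.

Lemma Vtilde_findim : findim (Vtilde rho C0).
Proof.
have [s Hs] := choice (fun b : box => Tk_findim (box_deg b)).
exists (flatten [seq [seq pi v | v <- s b] | b <- index_enum box]).
move=> _ [v Tv <-]; rewrite pi_box //.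
apply: (subsp_sum (lspan_subspace _)) => // b _.
have := Hs b _ (Tk_psi (box_deg b) Tv).
apply: (@lspan_ind _ _ _ (fun w => lspan [set` _] (pi w))).
  split; first by rewrite (lin0 pi_lin); exact: (subsp0 (lspan_subspace _)).
  move=> a u w Hu Hw; rewrite (pi_lin a u w); exact: (subspL (lspan_subspace _)).
move=> u us; apply: lspan_in; apply/flattenP; exists [seq pi v | v <- s b].
  by apply: map_f; rewrite mem_index_enum.
exact: map_f.
Qed.

(** * Loop modules as twists of T *)

(** The action of L on T in which D(u, r) is replaced by D(u, r) + (u, p) t^r. *)
Definition twist (p : deg') (s : L_sym D) (v : V) : V :=
  match s with
  | LX j x => X j x v
  | LD u r => \sum_(i < n) u 0 i *: (dd i r v + (p 0 i)%:~R *: kk r v)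
  | LA r => kk r v
  | Ld0 r => dz r v
  end.

Lemma twist_T p s v : L_ok D s -> T v -> T (twist p s v).
Proof.
case: s => [j x|u r|r|r] ok Tv /=.
- exact: (X_T ok).
- apply: (subsp_sum T_subspace) => // i _; apply: (subspZ T_subspace).
  apply: (subspD T_subspace); first exact: dd_T.
  by apply: (subspZ T_subspace); exact: kk_T.
- exact: kk_T.
- exact: dz_T.
Qed.

(** An element of T_l goes to its image in T / W placed in degree l + p. This is an
    isomorphism from the twist of T by p to L(V~)(p). *)
Definition iota (p : deg') (v : V) : @loop K D (lquot (W_gen rho C0)) :=
  fun l => pi (cmp v (l - p)).

Lemma iota_lin p : linear_on T (iota p).
Proof.
move=> a u v Tu Tv; apply/funext => l.
rewrite -[RHS]/(a *: pi (cmp u (l - p)) + pi (cmp v (l - p))).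
by rewrite /iota cmp_lin // pi_lin.
Qed.

Lemma iota_Tk p l v : Tk l v -> iota p v = tens (pi v) (l + p).
Proof.
move=> Tv; apply/funext => k; rewrite /iota (cmp_Tk _ Tv) /tens subr_eq.
by case: ifP => // _; exact: (lin0 pi_lin).
Qed.

Lemma iota_inj p v : T v -> iota p v = 0 -> v = 0.
Proof.
move=> Tv E; apply: (@cmp_eq0 v Tv) => l; have Tl := Tk_cmp l Tv.
apply: (pi_Tk_inj Tl).
by have := congr1 (fun f => f (l + p)) E; rewrite /iota addrK.
Qed.

Lemma iota_LV p v : T v -> LVtilde rho C0 lam p (iota p v).
Proof.
have HS : is_subspace (LVtilde rho C0 lam p) := lspan_subspace _.
move: v; apply: T_ind.
- by rewrite (linT0 (@iota_lin p)); exact: (subsp0 HS).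
- by move=> a u v Tu Tv Hu Hv; rewrite iota_lin //; exact: (subspL HS).
- move=> l v Tv; apply: lspan_in; exists l, (pi v), 0; split; first by exists v.
    by exact: G0.
  by rewrite (iota_Tk p Tv) addr0.
Qed.

Lemma iota_surj p f : LVtilde rho C0 lam p f -> exists2 v, T v & iota p v = f.
Proof.
apply: (@lspan_ind _ _ _ (fun f => exists2 v, T v & iota p v = f)).
  split; first by exists 0; [exact: (subsp0 T_subspace)|exact: (linT0 (@iota_lin p))].
  move=> a _ _ [u Tu <-] [v Tv <-]; exists (a *: u + v); last exact: iota_lin.
  exact: (subspL T_subspace).
move=> _ [k [_ [r [[v Tv <-] Gr ->]]]]; exists (kk r v).
  by apply: kk_T => //; exact: Tk_T Tv.
rewrite (iota_Tk p (kk_Tk Gr Tv)) pi_kk //; exact: Tk_T Tv.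
Qed.

Lemma cmp_kk r v l : G r -> T v -> cmp (kk r v) l = kk r (cmp v (l - r)).
Proof.
move=> Gr Tv; apply: cmp_homog => //; first exact: linear_onW (kk_lin Gr).
by move=> k u; exact: kk_Tk.
Qed.

Lemma cmp_X j x v l : gring j x -> T v -> cmp (X j x v) l = X j x (cmp v (l - j)).
Proof.
move=> gx Tv; apply: (@cmp_homog (X j x)) => //;
  first exact: linear_onW (X_lin gx).
by move=> k u; exact: (Tk_rho (gring_tz gx)).
Qed.

Lemma cmp_dd i r v l : G r -> T v -> cmp (dd i r v) l = dd i r (cmp v (l - r)).
Proof.
move=> Gr Tv; apply: cmp_homog => //; first exact: dd_linT.
by move=> k u; exact: dd_Tk.
Qed.

Lemma linT_sum (U : lmodType K) (f : V -> U) I (r : seq I) (F : I -> V) :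
  linear_on T f -> (forall i, T (F i)) -> f (\sum_(i <- r) F i) = \sum_(i <- r) f (F i).
Proof.
move=> lf TF; elim: r => [|i r IH]; first by rewrite !big_nil; exact: (linT0 lf).
rewrite !big_cons (linTD lf) // ?IH //.
exact: (subsp_sum T_subspace).
Qed.

Lemma T_cmp v k : T v -> T (cmp v k).
Proof. by move=> Tv; exact: Tk_T (Tk_cmp k Tv). Qed.

(** In degree l the scalar (u, l - r + alpha) splits as (u, l - r - p + alpha), the
    eigenvalue of D(u, 0) on the component of v, and (u, p). *)
Lemma iota_act p s v : L_ok D s -> T v ->
  iota p (twist p s v) = LVtilde_act rho C0 lam s (iota p v).
Proof.
move=> ok Tv; apply/funext => l; case: s ok => [j x|u r|r|r] ok.
- rewrite /iota [twist _ _ _]/= cmp_X // /LVtilde_act /= Vtilde_act_pi //.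
    by rewrite /= [l - j - p]addrAC.
  exact: T_cmp.
- have E : l - p - r = l - r - p by rewrite addrAC.
  set w := cmp v (l - r - p).
  have Tw : Tk (l - r - p) w := Tk_cmp _ Tv.
  have Tdk i : T (dd i r v + (p 0 i)%:~R *: kk r v).
    apply: (subspD T_subspace); first exact: dd_T.
    by apply: (subspZ T_subspace); exact: kk_T.
  rewrite /iota [twist _ _ _]/= (linT_sum _ (cmp_lin (l - p))); last first.
    by move=> i; apply: (subspZ T_subspace).
  have Ei i : cmp (u 0 i *: (dd i r v + (p 0 i)%:~R *: kk r v)) (l - p) =
      u 0 i *: (dd i r w + (p 0 i)%:~R *: kk r w).
    rewrite (linTZ _ (cmp_lin (l - p))) // (linTD (cmp_lin (l - p))) //.
    - by rewrite cmp_dd // (linTZ _ (cmp_lin (l - p))) ?cmp_kk ?E //; exact: kk_T.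
    - exact: dd_T.
    - by apply: (subspZ T_subspace); exact: kk_T.
  under eq_bigr do rewrite Ei.
  rewrite /LVtilde_act /loop_act -/w Vtilde_act_pi //; last exact: Tk_T Tw.
  rewrite LtI_ee !(lin_sum pi_lin) /dot scaler_suml -big_split; apply: eq_bigr => i _ /=.
  rewrite !(linZ pi_lin) -scalerA -scalerDr; congr (_ *: _).
  rewrite (linD pi_lin) (linB pi_lin) (dd_zero i Tw).
  rewrite (linZ pi_lin _ (kk r w)) (linZ pi_lin _ w).
  rewrite pi_kk //; last exact: Tk_T Tw.
  rewrite -addrA; congr (_ + _); rewrite -scaleNr -scalerDl; congr (_ *: _).
  by rewrite /alpha_of !mxE; ring.
- rewrite /iota [twist _ _ _]/= cmp_kk // pi_kk //; last exact: T_cmp.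
  by rewrite /LVtilde_act /= [l - r - p]addrAC.
- rewrite /iota [twist _ _ _]/= (dz_scalar ok Tv).
  rewrite (linTZ _ (cmp_lin (l - p))); last exact: kk_T.
  rewrite cmp_kk // (linZ pi_lin) pi_kk //; last exact: T_cmp.
  by rewrite /LVtilde_act /= [l - r - p]addrAC.
Qed.

(** A nonzero homomorphism between the twists of T by p and by q. It is bijective
    because T is irreducible. *)
Record intertw (p q : deg') (F : V -> V) : Prop := {
  iw_lin : linear_on T F;
  iw_T : forall v, T v -> T (F v);
  iw_neq0 : exists2 v, T v & F v != 0;
  iw_X : forall j x v, gring j x -> T v -> F (X j x v) = X j x (F v);
  iw_kk : forall r v, G r -> T v -> F (kk r v) = kk r (F v);
  iw_dd : forall i r v, G r -> T v ->
    F (dd i r v) = dd i r (F v) + ((q - p) 0 i)%:~R *: kk r (F v)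
}.

Lemma intertw_twist p q F s v : intertw p q F -> L_ok D s -> T v ->
  F (twist p s v) = twist q s (F v).
Proof.
case=> lF TF _ FX Fk Fd; case: s => [j x|u r|r|r] ok Tv /=.
- exact: FX.
- have Td i := dd_T i ok Tv; have Tk' := kk_T ok Tv.
  have Tdk i : T (dd i r v + (p 0 i)%:~R *: kk r v).
    by apply: (subspD T_subspace) => //; apply: (subspZ T_subspace).
  rewrite (linT_sum _ lF); last by move=> i; apply: (subspZ T_subspace).
  apply: eq_bigr => i _; rewrite (linTZ _ lF) // (linTD lF) //; last first.
    exact: (subspZ T_subspace).
  rewrite (linTZ _ lF) // Fd // Fk // -addrA -scalerDl; congr (_ *: (_ + _ *: _)).
  by rewrite !mxE; ring.
- exact: Fk.
- rewrite (dz_scalar ok Tv) (linTZ _ lF (kk_T ok Tv)) Fk //.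
  by rewrite (dz_scalar ok (TF _ Tv)).
Qed.

Lemma intertw_inj p q F v : intertw p q F -> T v -> F v = 0 -> v = 0.
Proof.
case=> lF TF [w Tw Fw] FX Fk Fd Tv Fv; apply: contrapT => /eqP vn; case/eqP: Fw.
suff /(_ _ Tw) [] : T `<=` [set u | T u /\ F u = 0] by [].
apply: T_irr_L.
- split; first by split; [exact: (subsp0 T_subspace)|exact: (linT0 lF)].
  move=> a u u' [Tu Hu] [Tu' Hu']; split; first exact: (subspL T_subspace).
  by rewrite lF // Hu Hu' scaler0 addr0.
- by move=> u [].
- by exists v.
- move=> j x u gx [Tu Hu]; split; first exact: X_T.
  by rewrite FX // Hu (lin0 (X_lin gx)).
- move=> i r u Gr [Tu Hu]; split; first exact: dd_T.
  by rewrite Fd // Hu (lin0 (dd_lin i Gr)) (lin0 (kk_lin Gr)) scaler0 addr0.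
- move=> r u Gr [Tu Hu]; split; first exact: kk_T.
  by rewrite Fk // Hu (lin0 (kk_lin Gr)).
Qed.

Lemma intertw_surj p q F w : intertw p q F -> T w -> exists2 v, T v & F v = w.
Proof.
case=> lF TF [v0 Tv0 Fv0] FX Fk Fd; move: w.
suff H : T `<=` [set w | exists2 v, T v & F v = w] by move=> w /H.
apply: T_irr_L.
- split; first by exists 0; [exact: (subsp0 T_subspace)|exact: (linT0 lF)].
  move=> a _ _ [u Tu <-] [v Tv <-]; exists (a *: u + v); last exact: lF.
  exact: (subspL T_subspace).
- by move=> _ [v Tv <-]; exact: TF.
- by exists (F v0) => //; exists v0.
- by move=> j x _ gx [v Tv <-]; exists (X j x v); [exact: X_T|exact: FX].
- move=> i r _ Gr [v Tv <-]; exists (dd i r v - ((q - p) 0 i)%:~R *: kk r v).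
    apply: (subspB T_subspace); first exact: dd_T.
    by apply: (subspZ T_subspace); exact: kk_T.
  have Tkv := kk_T Gr Tv; have Tkv' := subspZ T_subspace ((q - p) 0 i)%:~R Tkv.
  by rewrite (linTB lF (dd_T i Gr Tv) Tkv') (linTZ _ lF Tkv) Fd // Fk // addrK.
- by move=> r _ Gr [v Tv <-]; exists (kk r v); [exact: kk_T|exact: Fk].
Qed.

Definition iotaI p f : V := if pselect (LVtilde rho C0 lam p f) is left H
  then projT1 (cid2 (iota_surj H)) else 0.

Lemma iotaI_T p f : T (iotaI p f).
Proof.
rewrite /iotaI; case: pselect => [H|_]; last exact: (subsp0 T_subspace).
by case: cid2.
Qed.

Lemma iotaIK p f : LVtilde rho C0 lam p f -> iota p (iotaI p f) = f.
Proof. by rewrite /iotaI; case: pselect => // H _; case: cid2. Qed.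

Lemma iota_inj2 p u v : T u -> T v -> iota p u = iota p v -> u = v.
Proof.
move=> Tu Tv E; apply/eqP; rewrite -subr_eq0; apply/eqP.
apply: (@iota_inj p); first exact: (subspB T_subspace).
by rewrite (linTB (@iota_lin p)) // E subrr.
Qed.

Lemma iotaK p v : T v -> iotaI p (iota p v) = v.
Proof.
move=> Tv; apply: (@iota_inj2 p) => //; first exact: iotaI_T.
by rewrite iotaIK //; exact: iota_LV.
Qed.

Local Notation LVact := (LVtilde_act rho C0 lam).
Local Notation LV := (LVtilde rho C0 lam).

Lemma intertw_iso p q F : intertw p q F -> module_iso (L_ok D) LVact (LV p) LVact (LV q).
Proof.
move=> iF; have [lF TF _ _ _ _] := iF.
exists (fun f => iota q (F (iotaI p f))); split.
- split.
  + by move=> f Lf; apply: iota_LV; apply: TF; exact: iotaI_T.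
  + move=> f f' /set_mem Lf /set_mem Lf' E.
    rewrite -(iotaIK Lf) -(iotaIK Lf'); congr iota.
    apply/eqP; rewrite -subr_eq0; apply/eqP; apply: (intertw_inj iF).
      by apply: (subspB T_subspace); exact: iotaI_T.
    rewrite (linTB lF); [|exact: iotaI_T|exact: iotaI_T].
    by apply/eqP; rewrite subr_eq0; apply/eqP; apply: iota_inj2 E; apply: TF; exact: iotaI_T.
  + move=> f /iota_surj [w Tw <-]; have [v Tv Ev] := intertw_surj iF Tw.
    by exists (iota p v); [exact: iota_LV|rewrite iotaK // Ev].
- move=> a f f' Lf Lf'; rewrite -(iota_lin q); try exact/TF/iotaI_T.
  rewrite -lF; try exact: iotaI_T.
  congr (iota q (F _)); apply: (@iota_inj2 p); first exact: iotaI_T.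
    by apply: (subspL T_subspace); exact: iotaI_T.
  rewrite iota_lin ?iotaIK //; try exact: iotaI_T.
  exact: (subspL (lspan_subspace _)).
- move=> s ok f Lf; rewrite -(iotaIK Lf); set v := iotaI p f.
  have Tv : T v := iotaI_T _ _.
  rewrite -iota_act // !iotaK //; last exact: twist_T.
  by rewrite (intertw_twist iF) // iota_act //; exact: TF.
Qed.

Lemma twist_delta p i r v : twist p (LD (delta_mx 0 i) r) v = dd i r v + (p 0 i)%:~R *: kk r v.
Proof.
rewrite /= (bigD1 i) //= big1 ?addr0 => [|j ji]; first by rewrite mxE !eqxx scale1r.
by rewrite mxE eqxx (negbTE ji) scale0r.
Qed.

Lemma iso_intertw p q : module_iso (L_ok D) LVact (LV p) LVact (LV q) -> exists F, intertw p q F.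
Proof.
case=> f [[fLL finj _] lf fact].
pose F v := iotaI q (f (iota p v)).
have TF v : T (F v) := iotaI_T _ _.
have FE v : T v -> iota q (F v) = f (iota p v).
  by move=> Tv; rewrite iotaIK //; apply: fLL; exact: iota_LV.
have lF : linear_on T F.
  move=> a u v Tu Tv; apply: (@iota_inj2 q) => //; first exact: (subspL T_subspace).
  rewrite FE; last exact: (subspL T_subspace).
  by rewrite iota_lin // lf ?iota_lin ?FE //; exact: iota_LV.
have Ftw s v : L_ok D s -> T v -> F (twist p s v) = twist q s (F v).
  move=> ok Tv; apply: (@iota_inj2 q) => //; first exact: twist_T.
  rewrite FE; last exact: twist_T.
  by rewrite !iota_act // fact ?FE //; exact: iota_LV.
exists F; split=> //.
- have [v Tv vn] := Tk0_neq0; have Tv' := Tk_T Tv; exists v => //.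
  apply: contra_neq vn => Fv0; apply: (@iota_inj p) => //.
  have L0 := subsp0 (lspan_subspace _ : is_subspace (LV p)).
  apply: finj; try exact/mem_set/iota_LV; first exact/mem_set.
  rewrite -FE // Fv0 (linT0 (@iota_lin q)).
  have := lf (-1) 0 0 L0 L0.
  by rewrite scaler0 addr0 scaleN1r addNr.
- by move=> j x v gx Tv; exact: (Ftw (LX j x) v gx Tv).
- by move=> r v Gr Tv; exact: (Ftw (LA r) v Gr Tv).
- move=> i r v Gr Tv; have := Ftw (LD (delta_mx 0 i) r) v Gr Tv.
  have Tk' := kk_T Gr Tv.
  have Tk2 := subspZ T_subspace (p 0 i)%:~R Tk'.
  rewrite !twist_delta (linTD lF (dd_T i Gr Tv) Tk2) (linTZ _ lF Tk').
  rewrite -[F (kk r v)]/(F (twist p (LA r) v)) Ftw // => /eqP.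
  rewrite eq_sym -subr_eq => /eqP <-.
  rewrite -addrA -scalerBl; congr (_ + _ *: _).
  by rewrite !mxE; ring.
Qed.

(** * Submodules of the quotient and isomorphisms of twists *)

Local Notation Vt := (Vtilde rho C0).
Local Notation irreducible_Vt := (irreducible_module (Lt_ok D) (Vtilde_act rho C0) Vt).

Lemma intertw_pi0 p q F v : intertw p q F -> T v -> pi v = 0 -> pi (F v) = 0.
Proof.
case=> lF TF _ _ Fk _ Tv pv.
have : lspan (W_gen rho C0) v by rewrite -[v]subr0; apply/lproj_eq; rewrite (lin0 pi_lin).
have H0 := subsp0 T_subspace.
suff H w : lspan (W_gen rho C0) w -> T w /\ pi (F w) = 0 by move=> /H [].
apply: (@lspan_ind _ _ _ (fun w => T w /\ pi (F w) = 0)).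
  split; first by split=> //; rewrite (linT0 lF) (lin0 pi_lin).
  move=> a u u' [Tu Hu] [Tu' Hu']; split; first exact: (subspL T_subspace).
  by rewrite lF // pi_lin Hu Hu' scaler0 addr0.
move=> _ [r [u [Gr Tu ->]]]; rewrite -/(kk r u); have Tku := kk_T Gr Tu.
split; first exact: (subspB T_subspace).
by rewrite (linTB lF) // Fk // (linB pi_lin) pi_kk ?subrr //; exact: TF.
Qed.

Lemma intertw_Tk p q F l v : intertw p q F -> Tk l v -> Tk (l + (p - q)) (F v).
Proof.
case=> lF TF _ _ _ Fd Tl; have Tv := Tk_T Tl; split; first exact: TF.
move=> i; have GZ : G (0 : deg') by exact: G0.
rewrite -[td 0 _]/(td (0 : deg) (lift ord0 i)) -deg0_zero -/(dd i 0 (F v)).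
have := Fd i 0 v GZ Tv; rewrite kk0 (dd_zero i Tl) (linTZ _ lF) // => /eqP.
rewrite -subr_eq => /eqP <-; rewrite -scalerBl; congr (_ *: _).
by rewrite !mxE; ring.
Qed.

(** F induces an endomorphism of T / W, which has finite dimension. Each of its
    eigenspaces is a submodule, so it is a scalar c. For v in T_0, the elements F v of
    T_(p - q) and c v of T_0 have the same image, so p - q lies in Gamma. *)
Lemma irr_intertw p q F : irreducible_Vt -> intertw p q F -> G (p - q).
Proof.
case=> _ irr iF; have [lF TF _ FX Fk Fd] := iF.
pose phi (x : lquot (W_gen rho C0)) := pi (F (lrepr x)).
have phiE v : T v -> phi (pi v) = pi (F v).
  move=> Tv; have Tr := T_repr Tv.
  apply/eqP; rewrite -subr_eq0 -(linB pi_lin) -(linTB lF) //; apply/eqP.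
  apply: (intertw_pi0 iF); first exact: (subspB T_subspace).
  by rewrite (linB pi_lin) pi_repr subrr.
have HVt := Vtilde_subspace.
have lphi : linear_on Vt phi.
  move=> a _ _ [u Tu <-] [v Tv <-]; rewrite -pi_lin !phiE //.
    by rewrite lF // pi_lin.
  exact: (subspL T_subspace).
have phiV x : Vt x -> Vt (phi x).
  by move=> [v Tv <-]; rewrite phiE //; apply: Vtilde_pi; exact: TF.
have idlin : linear_on Vt (@id (lquot (W_gen rho C0))) by [].
have idV (x : lquot (W_gen rho C0)) : Vt x -> Vt (id x) by [].
have idi (x : lquot (W_gen rho C0)) : Vt x -> id x = 0 -> x = 0 by [].
have ids (x : lquot (W_gen rho C0)) : Vt x -> exists2 y, Vt y & id y = x by exists x.
have fV := Vtilde_findim.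
have [c [x [Vx xn Ex]]] := pencil_singular HVt HVt fV fV lphi idlin phiV idV
  Vtilde_neq0 idi ids.
have HU : submodule_of (Lt_ok D) (Vtilde_act rho C0) Vt [set x | Vt x /\ phi x = c *: x].
  split=> [|y []|s ok y [[v Tv <-]]] //.
  - split.
      split; first exact: subsp0.
      rewrite scaler0 -{1}(lin0 pi_lin) phiE ?(linT0 lF) ?(lin0 pi_lin) //.
      exact: (subsp0 T_subspace).
    move=> a u w [Vu Hu] [Vw Hw]; split; first exact: subspL.
    by rewrite lphi // Hu Hw scalerDr !scalerA mulrC.
  rewrite phiE // => Ev.
  have Tw := Lt_act_T ok Tv.
  rewrite Vtilde_act_pi //; split; first exact: Vtilde_pi.
  have -> : c *: pi (Lt_act rho C0 s v) = pi (Lt_act rho C0 s (F v)).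
    rewrite -[in RHS]Vtilde_act_pi //; last exact: TF.
    rewrite Ev -(linZ pi_lin c v) Vtilde_act_pi //; last first.
      exact: (subspZ T_subspace).
    by rewrite (linZ (Lt_act_lin ok)) (linZ pi_lin).
  rewrite phiE //; case: s ok Tw => [j z|u r] ok Tw.
    by rewrite /= FX.
  rewrite !LtI_ee (linT_sum _ lF); last first.
    by move=> i; apply: (subspZ T_subspace); exact: ee_T.
  rewrite !(lin_sum pi_lin); apply: eq_bigr => i _.
  have GZ : G (0 : deg') by exact: G0.
  have Td := dd_T i ok Tv; have Td0 := dd_T i GZ Tv.
  rewrite (linTZ _ lF); last exact: ee_T.
  rewrite !(linZ pi_lin) /ee (linTB lF) // !Fd // kk0 opprD addrACA -scalerBr.
  rewrite (linD pi_lin) (linZ pi_lin _ (_ - _)) (linB pi_lin (kk _ _)).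
  by rewrite (pi_kk ok (TF _ Tv)) subrr scaler0 addr0.
have [E|E] := irr _ HU.
  have : [set x | Vt x /\ phi x = c *: x] x by [].
  by rewrite E => /eqP; rewrite (negbTE xn).
have [v Tv vn] := Tk0_neq0; have Tv' := Tk_T Tv.
have : [set x | Vt x /\ phi x = c *: x] (pi v) by rewrite E; exact: Vtilde_pi.
move=> [_]; rewrite phiE // -(linZ pi_lin) => Ev.
apply: contrapT => nG.
have TFv : Tk (p - q) (F v) by have := intertw_Tk iF Tv; rewrite add0r.
have Tcv := subspZ (Tk_subspace 0) c Tv.
have := (pi_eq (TF _ Tv') (Tk_T Tcv)).1 Ev (p - q).
rewrite (psi_diag TFv) (psi_out Tcv); last by rewrite subr0.
by move=> /(intertw_inj iF Tv') /eqP; rewrite (negbTE vn).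
Qed.

Section Submodule.
Variable U : set (lquot (W_gen rho C0)).
Hypothesis HU : submodule_of (Lt_ok D) (Vtilde_act rho C0) Vt U.

Local Notation ok v := (T v /\ U (pi v)).

Let HsU : is_subspace U. Proof. by case: HU. Qed.

Lemma okL a u v : ok u -> ok v -> ok (a *: u + v).
Proof.
move=> [Tu Hu] [Tv Hv]; split; first exact: (subspL T_subspace).
by rewrite pi_lin; exact: subspL.
Qed.

Lemma ok0 : ok 0.
Proof.
split; first exact: (subsp0 T_subspace).
by rewrite (lin0 pi_lin); exact: subsp0.
Qed.

Lemma ok_X j x v : gring j x -> ok v -> ok (X j x v).
Proof.
move=> gx [Tv Hv]; split; first exact: X_T.
have := Vtilde_act_pi (s := LtX j x) gx Tv; rewrite [Lt_act _ _ _ _]/= => <-.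
by case: HU => _ _; apply.
Qed.

Lemma ok_ee i r v : G r -> ok v -> ok (ee i r v).
Proof.
move=> Gr [Tv Hv]; split; first exact: ee_T.
have := Vtilde_act_pi (s := LtI (delta_mx 0 i) r) Gr Tv.
rewrite LtI_ee (bigD1 i) //= big1 => [|j ji]; last by rewrite mxE eqxx (negbTE ji) scale0r.
by rewrite mxE !eqxx scale1r addr0 => <-; case: HU => _ _; apply.
Qed.

Lemma psi_cong v (k k' : deg') : T v -> G (k' - k) -> psi v k != 0 -> psi v k' != 0.
Proof.
move=> Tv Gk; apply: contra_neq => E.
have := psi_shift k Gk Tv; rewrite addrC subrK E => /esym.
by apply: (kk_inj Gk); exact: T_psi.
Qed.

Definition supp v : {set box} := [set b : box | psi v (box_deg b) != 0].

Variables (x : V) (a : deg').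
Hypotheses (okx : ok x) (xa : psi x a != 0).
Hypothesis xmin : forall y, ok y -> pi y != 0 -> (#|supp x| <= #|supp y|)%N.

(** Operators of degree i map [moved j] to [moved (j + i)], and only the class of j
    modulo Gamma matters. In particular the operators of degree j map x into this
    space. *)
Definition moved (j : deg') : set V :=
  [set y | ok y /\ forall k, psi y (k + j) != 0 -> psi x k != 0].

Lemma moved_lin j c y z : moved j y -> moved j z -> moved j (c *: y + z).
Proof.
move=> [oy Hy] [oz Hz]; split; first exact: okL.
move=> k; rewrite psi_lin //; [|by case: oy|by case: oz].
have [y0|yn] := eqVneq (psi y (k + j)) 0; last by move=> _; exact: Hy.
by rewrite y0 scaler0 add0r; exact: Hz.
Qed.

Lemma moved0 j : moved j 0.
Proof. by split=> [|k]; [exact: ok0|rewrite psi0 eqxx]. Qed.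

Lemma moved_x : moved 0 x.
Proof. by split=> // k; rewrite addr0. Qed.

Lemma moved_X j i z y : gring i z -> moved j y -> moved (j + i) (X i z y).
Proof.
move=> gz [oy Hy]; split; first exact: ok_X.
move=> k; rewrite psi_X //; last by case: oy.
rewrite addrA addrK => H; apply: Hy; move: H; apply: contra_neq => ->.
exact: (lin0 (X_lin gz)).
Qed.

Lemma moved_shift j r y : G r -> moved j y -> moved (j + r) y.
Proof.
move=> Gr [oy Hy]; split=> // k H; apply: Hy.
have Ty : T y by case: oy.
by move: H; rewrite addrA; apply: psi_cong => //; rewrite opprD addrA subrr sub0r; exact: GN.
Qed.

Lemma moved_ee j i r y : G r -> moved j y -> moved (j + r) (ee i r y).
Proof.
move=> Gr [oy Hy]; split; first exact: ok_ee.
move=> k; rewrite psi_dd //; last by case: oy.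
rewrite addrA addrK => H; apply: Hy; move: H; apply: contra_neq => ->.
by rewrite (lin0 (dd_lin i Gr)) (lin0 (kk_lin Gr)) scaler0 subrr.
Qed.

(** If the support of y is strictly smaller than the translate of the support of x, the
    minimality of x makes y zero in T / W. Hence a single coset sum determines all the
    others. *)
Lemma moved_eq0 j y k : moved j y -> psi x k != 0 -> psi y (k + j) = 0 ->
  forall l, psi y l = 0.
Proof.
move=> [oy Hy] xk yk; have [Ty Uy] := oy; have [Tx Ux] := okx.
apply/(pi_eq0 Ty); apply: contrapT => /eqP yn.
have := xmin oy yn; rewrite leqNgt => /negP; apply.
(* h translates cosets by j, and the support of y misses the translate of k *)
pose h (b : box) : box := box_of (box_deg b + j).
have hP b : G (box_deg (h b) - (box_deg b + j)) := box_ofP _.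
have hk : h (box_of k) \in h @: supp x.
  apply: imset_f; rewrite inE; apply: psi_cong Tx _ xk; exact: box_ofP.
apply: leq_trans _ (leq_imset_card h (supp x)).
apply: proper_card; apply/properP; split; last first.
  exists (h (box_of k)) => //; rewrite inE negbK; apply/eqP.
  apply: contrapT => /eqP; have := box_ofP k; set b := box_of k => Gb H.
  suff : psi y (k + j) != 0 by rewrite yk eqxx.
  apply: psi_cong Ty _ H; apply: (@Gtrans (box_deg b + j)); last exact/Gsym/hP.
  by rewrite opprD addrACA subrr addr0; exact: Gsym.
apply/fintype.subsetP => b; rewrite inE => yb.
have Gb := box_ofP (box_deg b - j); set b0 := box_of _ in Gb.
have xb : psi x (box_deg b - j) != 0 by apply: Hy; rewrite subrK.
apply/imsetP; exists b0; first by rewrite inE; exact: psi_cong Tx Gb xb.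
apply: box_of_uniq; apply: Gsym.
by move: Gb; rewrite opprB addrA.
Qed.

(** The elements of T whose components of degree l are all coset sums at l of elements
    of [moved (l - a)] form a nonzero subspace, which is stable under X(k), t^r d_i and
    t^r. *)
Lemma moved_onto l v : Tk l v -> exists2 y, moved (l - a) y & psi y l = v.
Proof.
pose T' := [set v | T v /\ forall j, exists2 y, moved j y & psi y (a + j) = cmp v (a + j)].
have [Tx Ux] := okx.
have H : T `<=` T'.
  apply: T_irr_L.
  - split.
      split=> [|j]; first exact: (subsp0 T_subspace).
      exists 0; first exact: moved0.
      by rewrite psi0 (linT0 (cmp_lin (a + j))).
    move=> c u w [Tu Hu] [Tw Hw]; split=> [|j]; first exact: (subspL T_subspace).
    have [y My Ey] := Hu j; have [z Mz Ez] := Hw j.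
    exists (c *: y + z); first exact: moved_lin.
    have [[Ty _] _] := My; have [[Tz _] _] := Mz.
    by rewrite psi_lin // cmp_lin // Ey Ez.
  - by move=> u [].
  - exists (psi x a) => //; have Ta := Tk_psi a Tx; split=> [|j]; first exact: Tk_T Ta.
    rewrite (cmp_Tk _ Ta) addrC -subr_eq0 addrK; have [->|jn] := eqVneq j 0.
      by exists x; [exact: moved_x|rewrite add0r].
    by exists 0; [exact: moved0|rewrite psi0].
  - move=> i z u gz [Tu Hu]; split=> [|j]; first exact: X_T.
    have [y My Ey] := Hu (j - i); exists (X i z y).
      by have := moved_X gz My; rewrite subrK.
    have [[Ty _] _] := My.
    by rewrite psi_X // cmp_X // -addrA Ey.
  - move=> i r u Gr [Tu Hu]; split=> [|j]; first exact: dd_T.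
    have [y My Ey] := Hu (j - r).
    have Mey := moved_ee i Gr My; have My' := moved_shift Gr My; rewrite subrK in Mey My'.
    have [[Ty _] _] := My; have [[Tey _] _] := Mey.
    (* the multiple of y restores the scalar d_i removed from t^r d_i in [ee i r] *)
    exists ((lam.2 0 (lift ord0 i) + ((a + j - r) 0 i)%:~R) *: y + ee i r y).
      exact: moved_lin.
    rewrite psi_lin // psi_dd // cmp_dd //.
    have -> : psi y (a + j) = kk r (psi y (a + j - r)).
      by rewrite -(psi_shift _ Gr Ty) subrK.
    by rewrite addrC subrK -addrA Ey.
  - move=> r u Gr [Tu Hu]; split=> [|j]; first exact: kk_T.
    have [y My Ey] := Hu (j - r); have [[Ty _] _] := My; exists y.
      by have := moved_shift Gr My; rewrite subrK.
    rewrite cmp_kk // -[a + j - r]addrA -Ey -(psi_shift _ Gr Ty).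
    by rewrite addrA subrK.
move=> Tv; have [_ /(_ (l - a)) [y My Ey]] := H _ (Tk_T Tv).
exists y => //; move: Ey; rewrite addrC subrK => ->.
by rewrite (cmp_Tk _ Tv) eqxx.
Qed.

(** By [moved_onto] and [moved_eq0], an element v of T_l is [psi y l] for an essentially
    unique y in [moved (l - a)]. Let F v be the coset sum of this y at l + b - a. *)
Lemma supp_intertw b : psi x b != 0 -> exists F, intertw b a F.
Proof.
move=> xb; have [Tx Ux] := okx; pose e := b - a.
pose R l v w := exists2 y, moved (l - a) y & psi y l = v /\ psi y (l + e) = w.
have RT l v w : R l v w -> Tk (l + e) w.
  by move=> [y [[Ty _] _] [_ <-]]; exact: Tk_psi.
have RL l c v w v' w' : R l v w -> R l v' w' -> R l (c *: v + v') (c *: w + w').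
  move=> [y My [Ev Ew]] [y' My' [Ev' Ew']]; exists (c *: y + y'); first exact: moved_lin.
  have [[Ty _] _] := My; have [[Ty' _] _] := My'.
  by rewrite !psi_lin // Ev Ew Ev' Ew'.
have Rfun l v w w' : R l v w -> R l v w' -> w = w'.
  move=> H H'; have [y My [Ev Ew]] := RL _ (-1) _ _ _ _ H H'.
  have := moved_eq0 My xa; rewrite addrC subrK Ev scaleN1r addNr => /(_ erefl (l + e)).
  by rewrite Ew scaleN1r addrC => /eqP; rewrite subr_eq0 => /eqP ->.
have [phi Hphi] : exists phi : deg' -> V -> V, forall l v, Tk l v -> R l v (phi l v).
  have H (l : deg') (v : V) : exists w, Tk l v -> R l v w.
    have [Tv|] := pselect (Tk l v); last by exists 0.
    by have [y My Ey] := moved_onto Tv; exists (psi y (l + e)) => _; exists y.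
  by exists (fun l => projT1 (choice (H l))) => l; exact: projT2 (choice (H l)).
have [F [lF FE]] : exists F : V -> V, linear_on T F /\ forall l v, Tk l v -> F v = phi l v.
  apply: T_extend => l c u v Tu Tv.
  apply: (Rfun l (c *: u + v)); last by apply: RL; exact: Hphi.
  by apply: Hphi; exact: (subspL (Tk_subspace l)).
have RF l v : Tk l v -> R l v (F v) by move=> Tv; rewrite (FE _ _ Tv); exact: Hphi.
have FR l v w : Tk l v -> R l v w -> F v = w by move=> Tv; apply: Rfun; exact: RF.
have TF v : T v -> T (F v).
  move: v; apply: T_ind => [||l v Tv]; last exact: Tk_T (RT _ _ _ (RF _ _ Tv)).
    by rewrite (linT0 lF); exact: (subsp0 T_subspace).
  by move=> c u v Tu Tv H1 H2; rewrite lF //; exact: (subspL T_subspace).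
exists F; split=> //.
- exists (psi x a); first exact: T_psi.
  suff -> : F (psi x a) = psi x b by [].
  apply: (FR a); first exact: Tk_psi.
  by exists x; [rewrite subrr; exact: moved_x|rewrite /e addrC subrK].
- move=> j z v gz; move: v; apply: (linT_eq (f := fun v => F (X j z v))
    (h := fun v => X j z (F v))).
  + by apply: (linT_comp (linear_onW (X_lin gz))) => // v; exact: X_T.
  + by apply: (linT_comp lF) => //; exact: linear_onW (X_lin gz).
  move=> l v Tv; apply: (FR (l + j)); first exact: (Tk_rho (gring_tz gz)).
  have [y My [Ev Ew]] := RF _ _ Tv; have [[Ty _] _] := My.
  exists (X j z y); first by have := moved_X gz My; rewrite addrAC.
  by rewrite !psi_X // [l + j + e]addrAC !addrK Ev Ew.
- move=> r v Gr; move: v; apply: (linT_eq (f := fun v => F (kk r v))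
    (h := fun v => kk r (F v))).
  + by apply: (linT_comp (linear_onW (kk_lin Gr))) => // v; exact: kk_T.
  + by apply: (linT_comp lF) => //; exact: linear_onW (kk_lin Gr).
  move=> l v Tv; apply: (FR (l + r)); first exact: kk_Tk.
  have [y My [Ev Ew]] := RF _ _ Tv; have [[Ty _] _] := My.
  exists y; first by have := moved_shift Gr My; rewrite addrAC.
  by rewrite [l + r + e]addrAC (psi_shift l Gr Ty) (psi_shift (l + e) Gr Ty) Ev Ew.
- move=> i r v Gr; move: v; apply: (linT_eq (f := fun v => F (dd i r v))
    (h := fun v => dd i r (F v) + ((a - b) 0 i)%:~R *: kk r (F v))).
  + by apply: (linT_comp (dd_linT i Gr)) => // v; exact: dd_T.
  + apply: (@linT_lin V ((a - b) 0 i)%:~R (dd i r \o F) (kk r \o F)).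
    * exact: (linT_comp lF TF (dd_linT i Gr)).
    * exact: (linT_comp lF TF (linear_onW (kk_lin Gr))).
  move=> l v Tv; apply: (FR (l + r)); first exact: dd_Tk.
  have [y My [Ev Ew]] := RF _ _ Tv.
  have Mey := moved_ee i Gr My; have My' := moved_shift Gr My.
  have E : l - a + r = l + r - a by rewrite addrAC.
  have [[Ty _] _] := My; have [[Tey _] _] := Mey; rewrite E in Mey My'.
  exists ((lam.2 0 (lift ord0 i) + (l 0 i)%:~R) *: y + ee i r y); first exact: moved_lin.
  rewrite !psi_lin // !psi_dd // [l + r + e]addrAC (psi_shift l Gr Ty).
  rewrite (psi_shift (l + e) Gr Ty) !addrK Ev Ew.
  split; first by rewrite addrC subrK.
  rewrite addrCA -scalerBl; congr (_ + _ *: _).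
  by rewrite /e !mxE; ring.
Qed.

(** If x is supported on a single coset, then so is every y in [moved (l - a)], and y
    has the same image in T / W as its coset sum at l. By [moved_onto] these coset sums
    fill T_l. *)
Lemma supp_full : (forall b, psi x b != 0 -> G (b - a)) -> Vt `<=` U.
Proof.
move=> one _ [v Tv <-]; move: v Tv; apply: T_ind.
- by case: ok0.
- move=> c u v Tu Tv Hu Hv; by have [] := okL c (conj Tu Hu) (conj Tv Hv).
- move=> l v Tv; have [y My Ey] := moved_onto Tv; have [[Ty Uy] Hy] := My.
  suff -> : pi v = pi y by [].
  apply/(pi_eq (Tk_T Tv) Ty) => k.
  have [Gk|nG] := pselect (G (k - l)).
    by rewrite (psi_in Tv Gk) -Ey -psi_shift // addrC subrK.
  rewrite (psi_out Tv nG); apply/esym/eqP; apply: contrapT => /negP yk.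
  apply: nG; have := Hy (k - (l - a)); rewrite subrK => /(_ yk) /one.
  by rewrite opprB addrA addrAC addrK.
Qed.

End Submodule.

(** An element of minimal support in a nonzero submodule is supported on one coset, or
    else two cosets of its support yield isomorphic twists. *)
Lemma irr_of_twists : (forall p q F, intertw p q F -> G (p - q)) -> irreducible_Vt.
Proof.
move=> Htw; split.
  have [x Vx xn] := Vtilde_neq0; move=> E.
  by move: Vx xn; rewrite E => ->; rewrite eqxx.
move=> U HU; have [HsU UV Uact] := HU.
have [U0|] := pselect (forall u, U u -> u = 0).
  by left; apply/seteqP; split=> [u /U0 //|u ->]; exact: subsp0.
move=> /existsNP [u /not_implyP [Uu /eqP un]]; right.
apply/seteqP; split=> //.
pose Q m := exists y, [/\ T y /\ U (pi y), pi y != 0 & #|supp y| = m].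
have exQ : exists m, `[< Q m >].
  have [v Tv Ev] := UV _ Uu.
  by exists #|supp v|; apply/asboolP; exists v; rewrite Ev.
case: (ex_minnP exQ) => m /asboolP [x [okx xn Em]] Hm.
have xmin y : T y /\ U (pi y) -> pi y != 0 -> (#|supp x| <= #|supp y|)%N.
  by move=> oy yn; rewrite Em; apply: Hm; apply/asboolP; exists y.
have [a xa] : exists a, psi x a != 0.
  apply: contrapT => N; case/eqP: xn; apply/(pi_eq0 okx.1) => k.
  by apply: contrapT => /eqP xk; apply: N; exists k.
apply: (supp_full HU okx xa) => b xb.
have [F HF] := supp_intertw HU okx xa xmin xb.
exact: Htw HF.
Qed.

End Top_of_V.

Theorem theorem8p17 (R : realType) (D : datum R[i])
    (HD : standing_assumptions D)
    (V : lmodType R[i]) (rho : tau_sym D -> V -> V)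
    (HV : tau_module rho)
    (Virr : irreducible_module (tau_ok D) rho setT)
    (Vint : integrable rho)
    (C0 : R[i]) (C0_gt0 : 0 < C0)
    (HK0 : forall v, rho (tK 0 ord0) v = C0 *: v)
    (HKi : forall (i : 'I_(nvar D)) v, rho (tK 0 (lift ord0 i)) v = 0)
    (lam : Hdual D)
    (Hlam : exists v : V, [/\ v != 0, Tspace rho v & weight_space rho lam v]) :
  irreducible_module (Lt_ok D) (Vtilde_act rho C0) (Vtilde rho C0) <->
  (forall p q : 'rV[int]_(nvar D), ~ in_Gamma (deg0 (p - q)) ->
     ~ module_iso (L_ok D)
         (LVtilde_act rho C0 lam) (LVtilde rho C0 lam p)
         (LVtilde_act rho C0 lam) (LVtilde rho C0 lam q)).
Proof.
have LM : @level_module R[i] D V rho C0 by split=> //; rewrite gt_eqF.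
split=> [irr p q nG /(iso_intertw LM Hlam) [F HF]|noiso].
  by apply: nG; exact: (irr_intertw LM Hlam irr HF).
apply: (irr_of_twists LM Hlam) => p q F HF; apply: contrapT => /noiso; apply.
exact: (intertw_iso LM Hlam HF).
Qed.
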